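(* Let $H$ be a Hilbert space of any dimension, and let $T=(T_1,\ldots,T_d)\in\mathcal{B}(H)^d$ be a tuple of (not necessarily self-adjoint) contractions. Then for any SD-tuple $(a_1,\ldots,a_d)$, it holds that (i) $\mathcal{W}(T)\subseteq\mathcal{W}^{\min}\big(\prod_{i=1}^d a_i\overline{\mathbb{D}}\big)$, and (ii) there exists a normal tuple $N$ which dilates $T$ and has $\|N_i\|\le a_i$ for each $i$. In particular, we may choose $a_i=\mathcal{U}(d)$ for all $i$; and if $H$ is finite-dimensional, we may choose $N$ acting on a finite-dimensional space.
   Context: Let $\mathcal{M}^d=\bigcup_{n\ge1}M_n^d$, where $M_n^d$ is the set of $d$-tuples of complex $n\times n$ matrices. UCP means unital completely positive. For $T\in\mathcal{B}(H)^d$, the matrix range is $\mathcal{W}(T)=\bigcup_n\mathcal{W}_n(T)$, where $\mathcal{W}_n(T)=\{(\psi(T_1),\ldots,\psi(T_d)):\psi:\mathcal{B}(H)\to M_n\text{ UCP}\}$. A tuple of operators is normal if its members are normal and commute with each other; $\sigma(N)$ denotes the joint spectrum of a normal tuple. $Y\in\mathcal{B}(K)^d$ is a dilation of $X\in\mathcal{B}(H)^d$ if there is an isometry $V:H\to K$ with $X_i=V^*Y_iV$ for all $i$. For a compact convex set $K\subseteq\mathbb{C}^d$ (or $K\subseteq\mathbb{R}^d\subseteq\mathbb{C}^d$), $\mathcal{W}^{\min}(K)$ is the set of $X\in\mathcal{M}^d$ having a normal dilation $N$ with $\sigma(N)\subseteq K$, and $\mathcal{W}^{\max}(K)=\{X\in\mathcal{M}^d:\mathcal{W}_1(X)\subseteq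 K\}$. $\overline{\mathbb{D}}\subset\mathbb{C}$ is the closed unit disk. $\Delta_n\subseteq\mathbb{R}^n$ is the convex hull of $0$ and the standard basis vectors, and $\diamond_n$ is the closed $\ell^1$ unit ball of $\mathbb{R}^n$. A tuple $(a_1,\ldots,a_d)$ of positive numbers is an SD-tuple if for every $n\in\mathbb{Z}^+$, $\mathcal{W}^{\max}(\Delta_n^d)\subseteq\mathcal{W}^{\min}\big(\prod_{j=1}^d a_j\cdot\diamond_n\big)$. Set $\mathcal{U}(d):=\inf\{C>0:(C,\ldots,C)\text{ is an SD-tuple of length }d\}$. *)

(* Defs.v *)
From HB Require Import structures.
From mathcomp Require Import all_boot all_order all_algebra.
From mathcomp Require Import complex.
From mathcomp Require Import all_classical all_reals all_analysis.

Set Implicit Arguments.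
Unset Strict Implicit.
Unset Printing Implicit Defensive.

Import Order.TTheory GRing.Theory Num.Theory.
Import numFieldNormedType.Exports.

Local Open Scope classical_set_scope.
Local Open Scope ring_scope.
Local Open Scope complex_scope.

HB.mixin Record CompleteNormedModule_isHilbert (R : realType) H
    & CompleteNormedModule R[i] H := {
  inner : {dot H for Num.conj};
  inner_normE : forall x, inner x x = `|x| ^+ 2
}.

#[short(type="hilbertType")]
HB.structure Definition Hilbert (R : realType) :=
  {H of CompleteNormedModule R[i] H & CompleteNormedModule_isHilbert R H}.


Section BoundedOperators.
Variables (R : realType) (H K : hilbertType R).

Definition bounded_op : {pred H -> K} := fun f : H -> K =>
  `[< linear f /\ exists M : R, forall x, `|f x| <= M%:C * `|x| >].

Lemma bounded_op_submod : submod_closed bounded_op.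
Proof.
split.
  apply/asboolP; split; first by move=> a x y; rewrite /= scaler0 addr0.
  by exists 0 => x; rewrite normr0 mul0r.
move=> a f g /asboolP[lf [M fM]] /asboolP[lg [N gN]]; apply/asboolP; split.
  move=> b x y; rewrite !fctE lf lg !scalerDr !scalerA [b * a]mulrC.
  by rewrite addrACA.
exists (Normc.normc a * M + N) => x.
rewrite (le_trans (ler_normD _ _))// rmorphD rmorphM /= mulrDl lerD//.
rewrite [X in `|X|](_ : _ = a *: f x)// normrZ -mulrA.
by rewrite ler_wpM2l.
Qed.

Record bop := Bop { bop_fun :> H -> K; bop_subproof : bop_fun \in bounded_op }.

HB.instance Definition _ := [isSub for bop_fun].
HB.instance Definition _ := gen_eqMixin bop.
HB.instance Definition _ := [Choice of bop by <:].
HB.instance Definition _ :=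
  GRing.SubChoice_isSubLmodule.Build _ _ _ bop
    (GRing.submod_closed_semi bounded_op_submod).

Lemma bop_linear (A : bop) : linear A.
Proof. by have /asboolP[] := bop_subproof A. Qed.

HB.instance Definition _ (A : bop) := GRing.isLinear.Build _ _ _ _ A (bop_linear A).

Lemma bop_bounded (A : bop) : exists M : R, forall x, `|A x| <= M%:C * `|x|.
Proof. by have /asboolP[] := bop_subproof A. Qed.

End BoundedOperators.

Section Composition.
Variables (R : realType) (H K L : hilbertType R).

Lemma bop_id_subproof : (id : H -> H) \in @bounded_op R H H.
Proof. by apply/asboolP; split=> //; exists 1 => x; rewrite mul1r. Qed.

Definition bop1 : bop H H := Bop bop_id_subproof.

Lemma bop_comp_subproof (A : bop K L) (B : bop H K) :
  (A \o B) \in @bounded_op R H L.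
Proof.
apply/asboolP; split; first by move=> a x y; rewrite /= !linearP.
have [M AM] := bop_bounded A; have [N BN] := bop_bounded B.
exists (`|M| * N) => x /=; rewrite (le_trans (AM _))// rmorphM -mulrA /=.
rewrite (@le_trans _ _ (`|M|%:C * `|B x|))//.
  by rewrite ler_wpM2r// lecR ler_norm.
by rewrite ler_wpM2l// ler0c.
Qed.

Definition bop_comp (A : bop K L) (B : bop H K) : bop H L :=
  Bop (bop_comp_subproof A B).

End Composition.

Section EuclideanSpace.
Variable R : realType.

Definition euclid (n : nat) := 'cV[R[i]]_n.
HB.instance Definition _ n := GRing.Lmodule.on (euclid n).
HB.instance Definition _ n := Vector.on (euclid n).

Definition cdot n (u v : euclid n) : R[i] := \sum_k u k 0 * (v k 0)^*%R.

Lemma cdot_linearr n (u : euclid n) :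
  GRing.linear_for (Num.conj \; *%R) (cdot u).
Proof.
move=> a v w; rewrite /cdot /= mulr_sumr -big_split /=.
by apply: eq_bigr => k _; rewrite !mxE rmorphD rmorphM mulrDr mulrCA.
Qed.

Lemma cdot_linearl n (v : euclid n) :
  GRing.linear_for *%R ((@cdot n)^~ v).
Proof.
move=> a u w; rewrite /cdot /= mulr_sumr -big_split /=.
by apply: eq_bigr => k _; rewrite !mxE mulrDl mulrA.
Qed.

HB.instance Definition _ n := bilinear_isBilinear.Build R[i] (euclid n)
  (euclid n) R[i] *%R (Num.conj \; *%R) (@cdot n)
  (@cdot_linearl n, @cdot_linearr n).

Lemma cdot_hermitian n (u v : euclid n) :
  cdot u v = (-1) ^+ false * (cdot v u)^*%R.
Proof.
rewrite expr0 mul1r /cdot rmorph_sum /=; apply: eq_bigr => k _.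
by rewrite rmorphM /= conjCK mulrC.
Qed.

HB.instance Definition _ n := isHermitianSesquilinear.Build _ _ _ _ (@cdot n)
  (@cdot_hermitian n).

Lemma cdot_gt0 n (u : euclid n) : u != 0 -> 0 < cdot u u.
Proof.
move=> u0; rewrite /cdot lt_def sumr_ge0; last by move=> k _; rewrite mul_conjC_ge0.
rewrite andbT; apply: contra u0 => /eqP/psumr_eq0P u0.
apply/eqP/colP => k; rewrite mxE; apply/eqP.
rewrite -mul_conjC_eq0 u0// => j _; exact: mul_conjC_ge0.
Qed.

HB.instance Definition _ n := isDotProduct.Build _ _ (@cdot n) (@cdot_gt0 n).

Lemma cdot_ge0 n (u : euclid n) : 0 <= cdot u u.
Proof. by rewrite /cdot sumr_ge0// => k _; rewrite mul_conjC_ge0. Qed.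

Definition cnorm n (u : euclid n) : R[i] := sqrtC (cdot u u).

Lemma cnormD n (u v : euclid n) : cnorm (u + v) <= cnorm u + cnorm v.
Proof. exact: (triangle_lerif (@cdot n)). Qed.

Lemma cnormZ n (a : R[i]) (u : euclid n) : cnorm (a *: u) = `|a| * cnorm u.
Proof.
rewrite /cnorm linearZl_LR linearZr_LR /= mulrA -normCK sqrtCM ?sqrCK//.
all: by rewrite ?nnegrE ?exprn_ge0 ?cdot_ge0.
Qed.

Lemma cnorm_eq0 n (u : euclid n) : cnorm u = 0 -> u = 0.
Proof.
move=> /eqP; rewrite sqrtC_eq0 => u0; apply/eqP; apply: contraLR u0.
by move/cdot_gt0; rewrite lt_def => /andP[].
Qed.

HB.instance Definition _ n := Lmodule_isNormed.Build R[i] (euclid n)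
  (@cnormD n) (@cnormZ n) (@cnorm_eq0 n).

Lemma normr_coord_le n (u : euclid n) k : `|u k 0| <= `|u|.
Proof.
rewrite -[leLHS]sqrCK// ler_sqrtC ?nnegrE ?exprn_ge0 ?cdot_ge0//.
rewrite normCK /cdot (bigD1 k)//= lerDl sumr_ge0// => j _.
exact: mul_conjC_ge0.
Qed.

Lemma norm_le_coord n (u : euclid n) : `|u| <= \sum_k `|u k 0|.
Proof.
rewrite {1}(matrix_sum_delta u) exchange_big big_ord1 /=.
rewrite (le_trans (ler_norm_sum _ _ _))// ler_sum// => k _.
rewrite normrZ -[leRHS]mulr1 ler_wpM2l//.
suff dE : cdot (delta_mx k 0 : euclid n) (delta_mx k 0) = 1.
  by rewrite -[leRHS]sqrtC1 -dE.
rewrite /cdot (bigD1 k)//= big1 ?mxE ?eqxx ?addr0; last first.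
  by move=> j /negbTE jk; rewrite !mxE jk mul0r.
by rewrite mul1r rmorph1.
Qed.

Lemma complex_cauchy_cvg (F : set_system R[i]^o) :
  ProperFilter F -> cauchy F -> cvg F.
Proof.
move=> FF /cauchy_ballP cF.
have coordP (f : R[i] -> R) : (forall x y, `|f x - f y|%:C <= `|x - y|) ->
    cvg (f @ F).
  move=> fle; apply: cauchy_cvg; apply/cauchy_ballP => e e0.
  have e0' : 0 < e%:C by rewrite ltcR.
  rewrite near_map2.
  have := cF _ e0'.
  apply: filterS => -[x y] /= xy.
  rewrite /ball /= -ltcR (le_lt_trans (fle _ _))//.
have /cvg_ex[a Fa] : cvg (@complex.Re R @ F).
  by apply: coordP => x y; rewrite -raddfB normc_ge_Re.
have /cvg_ex[b Fb] : cvg (@complex.Im R @ F).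
  apply: coordP => x y; rewrite -raddfB normc_def lecR -sqrtr_sqr.
  by rewrite ler_wsqrtr// lerDr sqr_ge0.
apply/cvg_ex; exists (a +i* b).
apply/cvgrPdist_lt => e e0.
have [r r0 er] : exists2 r : R, 0 < r & e = r%:C.
  exists (complex.Re e); first by move: e0; rewrite ltcE => /andP[].
  by rewrite RRe_real// gtr0_real.
have subE (c : R[i]) : a +i* b - c =
    (a - complex.Re c)%:C + 'i%C * (b - complex.Im c)%:C.
  by case: c => c1 c2 /=; simpc.
have norm_re (x : R) : `|x%:C| = `|x|%:C.
  by rewrite normc_def /= expr0n addr0 sqrtr_sqr.
have norm_i : `|'i%C : R[i]| = 1.
  by rewrite normc_def /= expr0n expr1n add0r sqrtr1.
have r2 : 0 < r / 2 by rewrite divr_gt0.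
move/cvgrPdist_lt : Fa => /(_ _ r2) Fa.
move/cvgrPdist_lt : Fb => /(_ _ r2) Fb.
near=> z.
have za : `|a - complex.Re z| < r / 2 by near: z.
have zb : `|b - complex.Im z| < r / 2 by near: z.
rewrite subE (le_lt_trans (ler_normD _ _))// normrM norm_i mul1r.
by rewrite er (splitr r) [ltRHS]rmorphD ltrD// norm_re ltcR.
Unshelve. all: by end_near. Qed.

Lemma euclid_complete n (F : set_system (euclid n)) :
  ProperFilter F -> cauchy F -> cvg F.
Proof.
move=> FF /cauchy_ballP cF.
have coordP k : cvg ((fun u : euclid n => u k 0 : R[i]^o) @ F).
  apply: complex_cauchy_cvg; apply/cauchy_ballP => e e0.
  rewrite near_map2.
  have := cF _ e0.
  apply: filterS => -[x y] /= xy.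
  have := normr_coord_le (x - y) k; rewrite !mxE => /le_lt_trans; apply.
  by move: xy; rewrite -ball_normE.
pose l : euclid n := \col_k lim ((fun u : euclid n => u k 0 : R[i]^o) @ F).
apply/cvg_ex; exists l; apply/cvgrPdist_lt => e e0.
have en0 : 0 < e / n.+1%:R by rewrite divr_gt0.
have ln : \forall u \near F, forall k, `|(l - u) k 0| < e / n.+1%:R.
  apply: filter_forall => k; have /cvgrPdist_lt /(_ _ en0) := coordP k.
  by apply: filterS => u; rewrite !mxE.
near=> u.
have lu : forall k, `|(l - u) k 0| < e / n.+1%:R by near: u.
rewrite (le_lt_trans (norm_le_coord _))//.
rewrite (@le_lt_trans _ _ (\sum_(k < n) e / n.+1%:R))//.
  by apply: ler_sum => k _; rewrite ltW.
rewrite sumr_const card_ord -[ltLHS]mulr_natr -mulrA gtr_pMr//.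
by rewrite mulrC ltr_pdivrMr// mul1r ltr_nat.
Unshelve. all: by end_near. Qed.

HB.instance Definition _ n := Uniform_isComplete.Build (euclid n) (@euclid_complete n).

Lemma cdot_normE n (u : euclid n) : cdot u u = `|u| ^+ 2.
Proof. by rewrite sqrtCK. Qed.

HB.instance Definition _ n := CompleteNormedModule_isHilbert.Build R (euclid n) (@cdot_normE n).

End EuclideanSpace.

Section MatrixOperators.
Variable R : realType.

Lemma mxop_subproof n (A : 'M[R[i]]_n) :
  (fun v : euclid R n => A *m v : euclid R n) \in
    @bounded_op R (euclid R n) (euclid R n).
Proof.
apply/asboolP; split; first by move=> a u v; rewrite mulmxDr scalemxAr.
exists (\sum_i \sum_j Normc.normc (A i j)) => v.
rewrite (le_trans (norm_le_coord _))// rmorph_sum mulr_suml ler_sum// => i _.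
rewrite rmorph_sum mulr_suml mxE (le_trans (ler_norm_sum _ _ _))//.
by apply: ler_sum => j _; rewrite normrM ler_wpM2l// normr_coord_le.
Qed.

Definition mxop n (A : 'M[R[i]]_n) : bop (euclid R n) (euclid R n) :=
  Bop (mxop_subproof A).

End MatrixOperators.

Section Operators.
Variable R : realType.
Implicit Types H K : hilbertType R.

Definition opnorm H K (A : bop H K) : R :=
  sup [set complex.Re `|A x| | x in [set x : H | `|x| <= 1]].

(* Total and functional by the Riesz representation theorem. *)
Definition is_adjoint H K (A : bop H K) (B : bop K H) : Prop :=
  forall x y, inner (A x) y = inner x (B y).

Definition op_isometry H K (V : bop H K) : Prop := forall x, `|V x| = `|x|.

Definition normal_tuple H (I : Type) (N : I -> bop H H) : Prop :=
  (forall i, exists2 S, is_adjoint (N i) S &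
     bop_comp (N i) S = bop_comp S (N i)) /\
  (forall i j, bop_comp (N i) (N j) = bop_comp (N j) (N i)).

Definition dilates H K (I : Type) (Y : I -> bop K K) (X : I -> bop H H) : Prop :=
  exists (V : bop H K) (W : bop K H),
    [/\ op_isometry V, is_adjoint V W &
        forall i, X i = bop_comp W (bop_comp (Y i) V)].

Definition finite_dim H : Prop :=
  exists (n : nat) (e : 'I_n -> H), forall x : H,
    exists c : 'I_n -> R[i], x = \sum_k c k *: e k.

Definition is_cstar_algebra H (A : set (bop H H)) : Prop :=
  [/\ A (bop1 H) /\ (forall S T, A S -> A T -> A (S + T)),
      forall (c : R[i]) S, A S -> A (c *: S),
      forall S T, A S -> A T -> A (bop_comp S T),
      forall S S', is_adjoint S S' -> A S -> A S' &
      forall S, (forall e : R, 0 < e -> exists2 T, A T & opnorm (S - T) < e) ->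
        A S].

Definition cstar_generated H (I : Type) (N : I -> bop H H) : set (bop H H) :=
  smallest (@is_cstar_algebra H) (range N).

(* The points z such that the elements N_i - z_i generate a proper ideal of
   the unital C*-algebra generated by N, which is commutative when N is a
   normal tuple. *)
Definition joint_spectrum H (I : finType) (N : I -> bop H H) : set (I -> R[i]) :=
  [set z | ~ exists2 B : I -> bop H H,
     forall i, cstar_generated N (B i) &
     \sum_i bop_comp (B i) (N i - z i *: bop1 H) = bop1 H].

End Operators.

Section MatrixSets.
Variable R : realType.
Implicit Types H K : hilbertType R.

(* Positivity of a k x k matrix over B(H) as an operator on H^k. *)
Definition opmx_ge0 H k (A : 'M[bop H H]_k) : Prop :=
  forall x : 'I_k -> H, 0 <= \sum_i \sum_j inner (A i j (x j)) (x i).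

Definition ucp H n (psi : bop H H -> 'M[R[i]]_n) : Prop :=
  [/\ linear psi, psi (bop1 H) = 1%:M &
      forall k (A : 'M[bop H H]_k),
        opmx_ge0 A -> opmx_ge0 (map_mx (fun S => mxop (psi S)) A)].

Definition matrix_range_at H (I : Type) n (T : I -> bop H H) :
    set (I -> 'M[R[i]]_n) :=
  [set X | exists2 psi : bop H H -> 'M[R[i]]_n,
     ucp psi & forall i, X i = psi (T i)].

(* The matrix level n >= 1 is encoded by the tag n - 1. *)
Definition mxtuple (I : Type) : Type := {m : nat & I -> 'M[R[i]]_m.+1}.

Definition mxtuple_op I (X : mxtuple I) (i : I) := mxop (tagged X i).

Definition matrix_range H (I : Type) (T : I -> bop H H) : set (mxtuple I) :=
  [set X | matrix_range_at T (tagged X)].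

Definition Wmin (I : finType) (K : set (I -> R[i])) : set (mxtuple I) :=
  [set X | exists (L : hilbertType R) (N : I -> bop L L),
     [/\ normal_tuple N, dilates N (mxtuple_op X) & joint_spectrum N `<=` K]].

(* W_1(X) consists of tuples of 1 x 1 matrices. *)
Definition Wmax (I : Type) (K : set (I -> R[i])) : set (mxtuple I) :=
  [set X | forall Y : I -> 'M[R[i]]_1,
     matrix_range_at (mxtuple_op X) Y -> K (fun i => Y i 0 0)].

End MatrixSets.

Section SimplexDiamond.
Variable R : realType.

Definition convex_hull (E : lmodType R) (S : set E) : set E :=
  smallest (@convex_set R E) S.

Definition simplex n : set 'rV[R]_n :=
  convex_hull ([set 0] `|` range (fun k : 'I_n => delta_mx 0 k)).

Definition diamond n : set 'rV[R]_n := [set x | \sum_k `|x 0 k| <= 1].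

(* The product of A_1, ..., A_d in (R^n)^d, as a subset of C^(d n). *)
Definition real_prod d n (A : 'I_d -> set 'rV[R]_n) : set ('I_d * 'I_n -> R[i]) :=
  [set z | exists2 x : 'I_d -> 'rV[R]_n,
     forall j, A j (x j) & forall j k, z (j, k) = (x j 0 k)%:C].

Definition SDtuple d (a : 'I_d -> R) : Prop :=
  (forall j, 0 < a j) /\
  forall n, (0 < n)%N ->
    Wmax (real_prod (fun _ : 'I_d => @simplex n)) `<=`
    Wmin (real_prod (fun j => [set a j *: x | x in @diamond n])).

Definition U_const (d : nat) : R :=
  inf [set C : R | 0 < C /\ SDtuple (fun _ : 'I_d => C)].

Definition polydisk d (a : 'I_d -> R) : set ('I_d -> R[i]) :=
  [set z | forall j, [set (a j)%:C * w | w in [set w : R[i] | `|w| <= 1]] (z j)].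

End SimplexDiamond.

(* Main.v *)
Require Import Defs.
From HB Require Import structures.
From mathcomp Require Import all_boot all_order all_algebra.
From mathcomp Require Import cyclic separable cyclotomic complex ring lra zify.
From mathcomp Require Import all_classical all_reals all_analysis.

Set Implicit Arguments.
Unset Strict Implicit.
Unset Printing Implicit Defensive.

Import Order.TTheory GRing.Theory Num.Theory.
Import numFieldNormedType.Exports.

Local Open Scope classical_set_scope.
Local Open Scope ring_scope.
Local Open Scope complex_scope.

(** For compact K, membership in Wmin(K) is dual to an inequality: X lies in it iff
    Re (tr A_0 + sum_i tr (A_i X_i)) >= 0 whenever the Hermitian part of
    A_0 + sum_i z_i A_i is positive for all z in K.  A normal dilation satisfies
    it because a joint approximate eigenvector at the bottom of the spectrum of
    sum_i A_i (x) N_i would produce a point of the joint spectrum where positivity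
    fails (this uses Fuglede's theorem); conversely, separating convex hulls in
    finite dimension writes X as a compression of a diagonal tuple over K.
    A contraction T is, up to a factor tending to 1, the moment sum_k w^k P_k of
    positive operators P_k adding up to 1, obtained by evaluating Fejer kernels at
    the rotations of T by the m-th roots of unity.  The P_k form a tuple in
    Wmax(simplex), so the SD property dilates them to a normal tuple over scaled
    diamonds, whose moments are normal with spectrum in scaled disks.  For infinite
    dimensional H, dilations exact on finite subsets are glued by an
    ultraproduct. *)

(** No spectral theorem is used. A normal tuple is studied through the real and imaginary parts of
    its members. The definition does not ask [N i] to commute with the adjoint of [N j], so these
    parts form one commuting selfadjoint family only thanks to Fuglede's theorem; joint eigenvalues
    then exist approximately, one operator after the other. The dual inequality has a further
    benefit: it survives limits. This absorbs the factor (m-1)/m left by the Fejer kernels, and it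
    shows that the infimum U(d) is attained: (d,...,d) is an SD-tuple, every admissible constant is
    at least 1 when d > 0, and the inequalities for constants approaching U(d) pass to the limit.
    Limits of bounded families are taken along ultrafilters, so compactness needs no subsequences,
    and most estimates are made on squared norms, kept as real numbers. *)

Local Notation cj := Num.conj.
Local Notation Re := complex.Re.
Local Notation Im := complex.Im.
Local Notation normc := Normc.normc.

(** * Complex arithmetic and semi-inner products *)

Section ComplexNumbers.
Variable R : realType.
Implicit Types (x y z : R[i]) (a b : R).

Lemma ReD x y : Re (x + y) = Re x + Re y. Proof. by case: x; case: y. Qed.
Lemma ReB x y : Re (x - y) = Re x - Re y. Proof. by case: x; case: y. Qed.
Lemma ReN x : Re (- x) = - Re x. Proof. by case: x. Qed.
Lemma ImN x : Im (- x) = - Im x. Proof. by case: x. Qed.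
Lemma ImD x y : Im (x + y) = Im x + Im y. Proof. by case: x; case: y. Qed.

Lemma Re_sum (I : Type) (r : seq I) (P : pred I) (F : I -> R[i]) :
  Re (\sum_(i <- r | P i) F i) = \sum_(i <- r | P i) Re (F i).
Proof. by apply: (big_morph _ ReD). Qed.

Lemma Im_sum (I : Type) (r : seq I) (P : pred I) (F : I -> R[i]) :
  Im (\sum_(i <- r | P i) F i) = \sum_(i <- r | P i) Im (F i).
Proof. by apply: (big_morph _ ImD). Qed.

Lemma Re_realM a x : Re (a%:C * x) = a * Re x.
Proof. by case: x => u v; rewrite /= mul0r subr0. Qed.

Lemma Im_realM a x : Im (a%:C * x) = a * Im x.
Proof. by case: x => u v; rewrite /= mul0r addr0. Qed.

Lemma ReM x y : Re (x * y) = Re x * Re y - Im x * Im y.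
Proof. by case: x; case: y. Qed.

Lemma ImM x y : Im (x * y) = Re x * Im y + Im x * Re y.
Proof. by case: x; case: y. Qed.

Lemma Re_conj x : Re (cj x) = Re x. Proof. by case: x. Qed.
Lemma Im_conj x : Im (cj x) = - Im x. Proof. by case: x. Qed.

Lemma cjN x : cj (- x) = - cj x. Proof. exact: rmorphN. Qed.
Lemma cjD x y : cj (x + y) = cj x + cj y. Proof. exact: rmorphD. Qed.
Lemma cjM x y : cj (x * y) = cj x * cj y. Proof. exact: rmorphM. Qed.

Lemma conj_real a : cj a%:C = a%:C.
Proof. by rewrite [LHS]conjc_real. Qed.

Lemma realCM a b : (a * b)%:C = a%:C * b%:C.
Proof. exact: rmorphM. Qed.

Lemma normc_ge0 x : 0 <= normc x.
Proof. by case: x => u v; rewrite /= sqrtr_ge0. Qed.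

Lemma normc_real a : normc a%:C = `|a|.
Proof. by rewrite /= expr0n addr0 sqrtr_sqr. Qed.

Lemma normcN x : normc (- x) = normc x.
Proof. by case: x => u v; rewrite /= !sqrrN. Qed.

Lemma normc_i : normc ('i%C : R[i]) = 1.
Proof. by rewrite /= expr0n add0r expr1n sqrtr1. Qed.

Lemma normc_nat n : normc (n%:R : R[i]) = n%:R.
Proof. by rewrite -(rmorph_nat (real_complex R)) [LHS]normc_real ger0_norm. Qed.

Lemma normcX x n : normc (x ^+ n) = normc x ^+ n.
Proof.
elim: n => [|n IHn]; first by rewrite !expr0 Normc.normc1.
by rewrite !exprS Normc.normcM IHn.
Qed.

Lemma normcE x : `|x| = (normc x)%:C.
Proof. by case: x. Qed.

Lemma sqr_normc x : normc x ^+ 2 = Re x ^+ 2 + Im x ^+ 2.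
Proof. by case: x => u v; rewrite /= sqr_sqrtr// addr_ge0// sqr_ge0. Qed.

Lemma mulr_conj x : x * cj x = (normc x ^+ 2)%:C.
Proof. by rewrite -normCK normcE rmorphXn. Qed.

Lemma normc_conj x : normc (cj x) = normc x.
Proof. by case: x => u v; rewrite /= sqrrN. Qed.

Lemma Re_le_normc x : Re x <= normc x.
Proof. by rewrite -lecR -normcE (le_trans _ (normc_ge_Re x))// lecR ler_norm. Qed.

Lemma normcD x y : normc (x + y) <= normc x + normc y.
Proof. by rewrite -lecR rmorphD -!normcE ler_normD. Qed.

Lemma normc_sum (I : Type) (r : seq I) (P : pred I) (F : I -> R[i]) :
  normc (\sum_(i <- r | P i) F i) <= \sum_(i <- r | P i) normc (F i).
Proof.
rewrite -lecR -normcE rmorph_sum (le_trans (ler_norm_sum _ _ _))//.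
Qed.

Lemma complexP x y : Re x = Re y -> Im x = Im y -> x = y.
Proof. by case: x => a b; case: y => c d /= -> ->. Qed.

Lemma ge0_complex x : 0 <= x -> x = (Re x)%:C.
Proof. by case: x => u v; rewrite lecE /= => /andP[/eqP->]. Qed.

Lemma ge0_Re x : 0 <= x -> 0 <= Re x.
Proof. by rewrite lecE => /andP[]. Qed.

Lemma discriminant_le (n c e : R) : 0 <= n ->
  (forall t, 0 <= n * t ^+ 2 + 2 * c * t + e) -> c ^+ 2 <= n * e.
Proof.
rewrite le_eqVlt => /predU1P[n0|n0] q.
  have c0 : c = 0.
    (* For [n = 0] the polynomial is affine; if [c] were nonzero it would take the value -1 at this
       point. *)
    apply/eqP; apply: contraT => c0; have := q (- (e + 1) / (2 * c)).
    rewrite -n0 mul0r add0r.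
    have -> : 2 * c * (- (e + 1) / (2 * c)) = - (e + 1) by field.
    by rewrite opprD addrAC addNr add0r ler0N1.
  by rewrite c0 -n0 mul0r expr0n.
have := q (- c / n).
have -> : n * (- c / n) ^+ 2 + 2 * c * (- c / n) + e = (n * e - c ^+ 2) / n.
  by field; rewrite gt_eqF.
by rewrite pmulr_lge0 ?invr_gt0// subr_ge0.
Qed.

(** Replaces passages to the limit: errors along fast Cauchy sequences are multiples of 4^-k. *)
Lemma le_geometric0 (b c : R) : (forall k, b <= c * (4^-1) ^+ k) -> b <= 0.
Proof.
move=> bc; rewrite leNgt; apply/negP => b0.
have c0 : 0 < c by have := bc 0%N; rewrite expr0 mulr1; apply: lt_le_trans.
have /archi_boundP := ltW (divr_gt0 c0 b0).
set n := Num.bound _ => cn.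
have := bc n; rewrite exprVn ler_pdivlMr ?exprn_gt0// leNgt => /negP; apply.
rewrite mulrC -ltr_pdivrMr// (lt_le_trans cn)//.
elim: (n) => [|k IHk]; first by rewrite expr0.
have : 1 <= 4 ^+ k :> R by rewrite exprn_ege1// ler1n.
by rewrite exprS -[k.+1%:R]natr1; lra.
Qed.

End ComplexNumbers.

Section SemiInnerProduct.
Variables (R : realType) (E : lmodType R[i]).
Variable ip : {hermitian E for false & (@Num.conj R[i])}.
Hypothesis ip_ge0 : forall x, 0 <= ip x x.

(** A squared seminorm kept as a real number, which avoids square roots and complex-valued norms.
    The form may be degenerate, because the results also serve the forms of positive matrices and
    the ultraproduct before its quotient. *)
Definition nsq x : R := Re (ip x x).

Lemma ipC x y : ip x y = cj (ip y x).
Proof. by rewrite hermC expr0 mul1r. Qed.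

Lemma Re_ipC x y : Re (ip x y) = Re (ip y x).
Proof. by rewrite ipC Re_conj. Qed.

Lemma ipZl c x y : ip (c *: x) y = c * ip x y.
Proof. exact: linearZl_LR. Qed.

Lemma ipZr c x y : ip x (c *: y) = cj c * ip x y.
Proof. exact: linearZr_LR. Qed.

Lemma ipDl x y z : ip (x + y) z = ip x z + ip y z.
Proof. exact: linearDl. Qed.

Lemma ipDr x y z : ip x (y + z) = ip x y + ip x z.
Proof. exact: linearDr. Qed.

Lemma ipNl x y : ip (- x) y = - ip x y. Proof. exact: linearNl. Qed.
Lemma ipNr x y : ip x (- y) = - ip x y. Proof. exact: linearNr. Qed.
Lemma ip0l x : ip 0 x = 0. Proof. exact: linear0l. Qed.
Lemma ip0r x : ip x 0 = 0. Proof. exact: linear0r. Qed.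

Lemma ipBl x y z : ip (x - y) z = ip x z - ip y z.
Proof. exact: linearBl. Qed.

Lemma ipBr x y z : ip x (y - z) = ip x y - ip x z.
Proof. exact: linearBr. Qed.

Lemma ip_suml (I : Type) (r : seq I) (P : pred I) (F : I -> E) y :
  ip (\sum_(i <- r | P i) F i) y = \sum_(i <- r | P i) ip (F i) y.
Proof. exact: linear_sumlz. Qed.

Lemma ip_sumr (I : Type) (r : seq I) (P : pred I) (F : I -> E) y :
  ip y (\sum_(i <- r | P i) F i) = \sum_(i <- r | P i) ip y (F i).
Proof. exact: linear_sumr. Qed.

Lemma nsqE x : ip x x = (nsq x)%:C.
Proof. exact: ge0_complex. Qed.

Lemma nsq_ge0 x : 0 <= nsq x.
Proof. exact: ge0_Re. Qed.

Lemma nsq0 : nsq 0 = 0.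
Proof. by rewrite /nsq ip0l. Qed.

Lemma nsqZ a x : nsq (a *: x) = normc a ^+ 2 * nsq x.
Proof. by rewrite /nsq ipZl ipZr mulrA mulr_conj Re_realM. Qed.

Lemma nsqZr (a : R) x : nsq (a%:C *: x) = a ^+ 2 * nsq x.
Proof. by rewrite nsqZ normc_real real_normK// num_real. Qed.

Lemma nsqN x : nsq (- x) = nsq x.
Proof. by rewrite /nsq ipNl ipNr opprK. Qed.

Lemma nsqD x y : nsq (x + y) = nsq x + nsq y + 2 * Re (ip x y).
Proof.
rewrite /nsq ipDl !ipDr !ReD (Re_ipC y x); ring.
Qed.

Lemma nsqB x y : nsq (x - y) = nsq x + nsq y - 2 * Re (ip x y).
Proof. by rewrite nsqD nsqN ipNr ReN; ring. Qed.

Lemma nsqBC x y : nsq (x - y) = nsq (y - x).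
Proof. by rewrite -nsqN opprB. Qed.

Lemma parallelogram x y :
  nsq (x + y) + nsq (x - y) = 2 * (nsq x + nsq y).
Proof. rewrite nsqD nsqB; ring. Qed.

Lemma nsqD_le x y : nsq (x + y) <= 2 * (nsq x + nsq y).
Proof. by rewrite -parallelogram lerDl nsq_ge0. Qed.

Lemma nsqB_le x y : nsq (x - y) <= 2 * (nsq x + nsq y).
Proof. by rewrite -(nsqN y) nsqD_le. Qed.

(** The constant is crude, one factor 2 for each summand; later only the fact that it does not
    depend on the vectors matters. *)
Lemma nsq_sum_le (I : finType) (F : I -> E) :
  nsq (\sum_i F i) <= 2 ^+ #|I| * \sum_i nsq (F i).
Proof.
rewrite cardE -!big_enum; elim: (enum I) => [|i s IHs].
  by rewrite !big_nil nsq0 mulr0.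
rewrite !big_cons /= (le_trans (nsqD_le _ _))// exprS -mulrA ler_pM2l//.
rewrite mulrDr; apply: lerD; last exact: IHs.
by rewrite ler_peMl ?nsq_ge0// exprn_ege1// ler1n.
Qed.

Lemma ip_CSr x y : Re (ip x y) ^+ 2 <= nsq x * nsq y.
Proof.
set c := Re (ip x y).
have q t : 0 <= nsq x * t ^+ 2 + 2 * c * t + nsq y.
  have := nsq_ge0 (t%:C *: x + y).
  by rewrite nsqD nsqZr ipZl Re_realM -/c; lra.
by apply: discriminant_le q; exact: nsq_ge0.
Qed.

Lemma ip_CS x y : normc (ip x y) ^+ 2 <= nsq x * nsq y.
Proof.
set c := ip x y; have [->|c0] := eqVneq c 0.
  by rewrite Normc.normc0 expr0n mulr_ge0// nsq_ge0.
(* The factor [c] rotates the product: [ip x (c *: y)] is the real number |c|^2, and the real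
   inequality becomes |c|^4 <= |c|^2 |x|^2 |y|^2. *)
have := ip_CSr x (c *: y).
rewrite ipZr -/c mulrC mulr_conj nsqZ /=.
rewrite [leLHS]expr2 [leRHS]mulrCA ler_pM2l//.
rewrite exprn_gt0// lt_def normc_ge0 andbT.
by apply: contra c0 => /eqP/Normc.eq0_normc ->.
Qed.

Lemma nsq0_ip x y : nsq x = 0 -> ip x y = 0.
Proof.
move=> x0; apply: Normc.eq0_normc; apply/eqP; rewrite -sqrf_eq0.
by rewrite eq_le sqr_ge0 andbT (le_trans (ip_CS _ _))// x0 mul0r.
Qed.

Lemma sqrt_nsqD x y : Num.sqrt (nsq (x + y)) <= Num.sqrt (nsq x) + Num.sqrt (nsq y).
Proof.
rewrite -(@ler_pXn2r _ 2)// ?nnegrE ?addr_ge0 ?sqrtr_ge0//.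
rewrite sqr_sqrtr ?nsq_ge0// sqrrD !sqr_sqrtr ?nsq_ge0// nsqD.
suff : Re (ip x y) <= Num.sqrt (nsq x) * Num.sqrt (nsq y) by lra.
rewrite -sqrtrM ?nsq_ge0// (le_trans (ler_norm _))// -sqrtr_sqr ler_wsqrtr//.
exact: ip_CSr.
Qed.

(** Gram-Schmidt modulo null vectors: a remainder of seminorm 0 adds no vector, so expansions hold
    up to seminorm 0. The family is indexed by [nat] so that appending a vector does not change the
    index type. *)
Lemma orthonormalize (s : seq E) : exists (r : nat) (f : nat -> E),
  (forall i j, (i < r)%N -> (j < r)%N -> ip (f i) (f j) = (i == j)%:R) /\
  forall x, x \in s -> nsq (x - \sum_(i < r) ip x (f i) *: f i) = 0.
Proof.
elim: s => [|y s [r [f [fo fs]]]]; first by exists 0%N, (fun=> 0).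
pose w := y - \sum_(i < r) ip y (f i) *: f i.
have wo j : (j < r)%N -> ip w (f j) = 0.
  move=> jr; rewrite /w ipBl ip_suml (bigD1 (Ordinal jr))//= big1.
    by rewrite ipZl fo// eqxx mulr1 addr0 subrr.
  move=> i /eqP ij; rewrite ipZl fo//.
  by case: eqP => [ij'|]; [case: ij; apply: val_inj|rewrite mulr0].
have [w0|w0] := eqVneq (nsq w) 0.
  exists r, f; split=> // x; rewrite inE => /predU1P[->//|]; exact: fs.
have wgt0 : 0 < nsq w by rewrite lt_def w0 nsq_ge0.
pose c := Num.sqrt (nsq w); have cgt0 : 0 < c by rewrite sqrtr_gt0.
have c2 : c ^+ 2 = nsq w by rewrite sqr_sqrtr// ltW.
pose g i := if i == r then c^-1%:C *: w else f i.
have gl i : (i < r)%N -> g i = f i by rewrite /g => ir; rewrite ltn_eqF.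
have gr : g r = c^-1%:C *: w by rewrite /g eqxx.
exists r.+1, g; split.
  move=> i j; rewrite ltnS leq_eqVlt => /predU1P[->|ir];
    rewrite ltnS leq_eqVlt => /predU1P[->|jr].
  - rewrite eqxx gr ipZl ipZr nsqE -c2 conj_real -!realCM.
    by rewrite [X in X%:C](_ : _ = 1)//; field; rewrite gt_eqF.
  - by rewrite gr gl// ipZl wo// mulr0 gtn_eqF.
  - by rewrite gr gl// ipZr ipC wo// rmorph0 mulr0 ltn_eqF.
  - by rewrite !gl// fo.
have wg x : (forall j, (j < r)%N -> ip x (f j) = 0) -> x = w -> 
    x - ip x (g r) *: g r = 0.
  move=> _ ->; rewrite gr ipZr nsqE -c2 scalerA conj_real.
  rewrite -!realCM [X in X%:C](_ : _ = 1); last by field; rewrite gt_eqF.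
  by rewrite scale1r subrr.
move=> x; rewrite inE big_ord_recr /= opprD addrA => xs.
rewrite (eq_bigr (fun i : 'I_r => ip x (f i) *: f i)); last by move=> i _; rewrite gl.
case/predU1P: xs => [->|xs].
  rewrite -/w; suff -> : ip y (g r) = ip w (g r) by rewrite wg// nsq0.
  rewrite /w ipBl ip_suml big1 ?subr0// => i _.
  by rewrite gr ipZl ipZr [ip (f i) w]ipC wo// rmorph0 !mulr0.
set u := x - _; have u0 : nsq u = 0 by rewrite fs.
suff -> : ip x (g r) = 0 by rewrite scale0r subr0.
rewrite -[x](subrK (\sum_(i < r) ip x (f i) *: f i)) -/u ipDl nsq0_ip// add0r.
rewrite ip_suml big1// => i _.
by rewrite gr ipZl ipZr [ip (f i) w]ipC wo// rmorph0 !mulr0.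
Qed.

End SemiInnerProduct.

(** * Approximate joint eigenvectors of commuting selfadjoint operators *)

Section ApproximateEigenvectors.
Variables (R : realType) (E : lmodType R[i]).
Variable ip : {hermitian E for false & (@Num.conj R[i])}.
Hypothesis ip_ge0 : forall x, 0 <= ip x x.
Local Notation nsq := (nsq ip).
Implicit Types (F : set (E -> E)) (S G : E -> E).

(** When [F] consists of shifts [S_i - l_i], this says that [l] is a joint approximate
    eigenvalue. *)
Definition approx_null F := forall e : R, 0 < e ->
  exists x, nsq x = 1 /\ forall f, F f -> nsq (f x) <= e.

Definition selfadjoint S := forall x y, ip (S x) y = ip x (S y).

Definition nsq_bounded (c : R) S := forall x, nsq (S x) <= c * nsq x.

Lemma linear_fun0 S : linear S -> S 0 = 0.
Proof. by move=> lS; have := lS (-1) 0 0; rewrite scaler0 add0r scaleN1r addNr. Qed.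

Lemma linear_funZ S (lS : linear S) a x : S (a *: x) = a *: S x.
Proof. by have := lS a x 0; rewrite (linear_fun0 lS) !addr0. Qed.

Lemma linear_funD S (lS : linear S) x y : S (x + y) = S x + S y.
Proof. by have := lS 1 x y; rewrite !scale1r. Qed.

Lemma linear_funB S (lS : linear S) x y : S (x - y) = S x - S y.
Proof. by rewrite -scaleN1r (linear_funD lS) (linear_funZ lS) scaleN1r. Qed.

Lemma linear_shift S a : linear S -> linear (fun x => S x - a *: x).
Proof.
move=> lS b x y; rewrite lS scalerDr opprD addrACA scalerBr !scalerA.
by rewrite [a * b]mulrC.
Qed.

Lemma approx_null_sub F F' : F `<=` F' -> approx_null F' -> approx_null F.
Proof. by move=> FF' F'0 e /F'0[x [x1 xe]]; exists x; split=> // f /FF'/xe. Qed.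

Lemma approx_null_scaled F : (forall f, F f -> linear f) ->
  (forall e : R, 0 < e ->
     exists x, 0 < nsq x /\ forall f, F f -> nsq (f x) <= e * nsq x) ->
  approx_null F.
Proof.
move=> lF F0 e /F0[x [x0 xe]]; pose c := (Num.sqrt (nsq x))^-1.
have c2 : c ^+ 2 = (nsq x)^-1 by rewrite exprVn sqr_sqrtr// ltW.
exists (c%:C *: x); rewrite nsqZr c2 mulVf ?gt_eqF//; split=> // f Ff.
rewrite (linear_funZ (lF _ Ff)) nsqZr c2 mulrC ler_pdivrMr//.
exact: xe.
Qed.

(* The value mu below is the largest asymptotic value of |S x|^2 along the
   approximate kernel of F; a maximizing x is almost an eigenvector of S^2. *)
Lemma approx_null_eigen F S c : (forall f, F f -> linear f) -> linear S ->
  selfadjoint S -> nsq_bounded c S ->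
  (forall f, F f -> forall x, f (S x) = S (f x)) ->
  approx_null F ->
  exists l : R, approx_null (F `|` [set fun x => S x - l%:C *: x]).
Proof.
move=> lF lS Ssa Sc SF F0.
pose M := [set m : R | forall e : R, 0 < e ->
  exists x, [/\ nsq x = 1, forall f, F f -> nsq (f x) <= e & m <= nsq (S x)]].
have M0 : M 0.
  by move=> e /F0[x [x1 xe]]; exists x; split=> //; exact: nsq_ge0.
have Mc : ubound M c.
  move=> m /(_ 1 ltr01)[x [x1 _ mx]]; rewrite (le_trans mx)//.
  by rewrite (le_trans (Sc x))// x1 mulr1.
have c0 : 0 <= c by apply: Mc.
have Msup : has_sup M by split; [exists 0|exists c].
set mu := sup M.
have mu0 : 0 <= mu by apply: ub_le_sup => //; case: Msup.
(* Sufficiently null vectors cannot exceed [mu + eta]. Nullity is measured relative to [nsq x], so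
   that the bound can be applied to [S x] too. *)
have muD eta : 0 < eta -> exists2 d : R, 0 < d & forall x,
    (forall f, F f -> nsq (f x) <= d * nsq x) -> nsq (S x) <= (mu + eta) * nsq x.
  move=> eta0; have nM : ~ M (mu + eta).
    by move=> /(ub_le_sup (proj2 Msup)); rewrite leNgt ltrDl eta0.
  have [d d0 dP] : exists2 d : R, 0 < d & forall x, nsq x = 1 ->
      (forall f, F f -> nsq (f x) <= d) -> nsq (S x) <= mu + eta.
    apply: contrapT => nd; apply: nM => e e0; apply: contrapT => nx; apply: nd.
    exists e => // x x1 xe; rewrite leNgt; apply/negP => xS; apply: nx.
    by exists x; split=> //; exact: ltW.
  exists d => // x xd; have := nsq_ge0 ip_ge0 x.
  rewrite le_eqVlt => /predU1P[x0|x0].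
    by rewrite (le_trans (Sc x))// -x0 !mulr0.
  pose a := (Num.sqrt (nsq x))^-1.
  have a2 : a ^+ 2 = (nsq x)^-1 by rewrite exprVn sqr_sqrtr// ltW.
  have := dP (a%:C *: x).
  rewrite nsqZr a2 mulVf ?gt_eqF// => /(_ erefl).
  rewrite (linear_funZ lS) nsqZr a2 mulrC ler_pdivrMr//; apply => f Ff.
  rewrite (linear_funZ (lF _ Ff)) nsqZr a2 mulrC ler_pdivrMr//.
  exact: xd.
have muB eta (e : R) : 0 < eta -> 0 < e ->
    exists x, [/\ nsq x = 1, forall f, F f -> nsq (f x) <= e & mu - eta <= nsq (S x)].
  move=> eta0 e0; have /(_ _ eta0)[m Mm mm] := @sup_adherent _ M _ _ Msup.
  have [x [x1 xe xm]] := Mm e e0; exists x; split=> //.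
  by rewrite (le_trans (ltW mm)).
move: mu0; rewrite le_eqVlt => /predU1P[mu0|mu0].
  exists 0 => e e0; have [d d0 dP] := muD e e0.
  have de0 : 0 < Num.min d e by rewrite lt_min d0.
  have [x [x1 xe]] := F0 _ de0.
  exists x; split=> // f [/xe|->]; first by rewrite le_min => /andP[].
  rewrite scale0r subr0 (le_trans (dP x _))//; last by rewrite -mu0 add0r x1 mulr1.
  by move=> g /xe; rewrite le_min x1 mulr1 => /andP[].
(* |S S x - mu x|^2 = |S S x|^2 - 2 mu |S x|^2 + mu^2. As [S x] is again almost null, the first term
   is at most (mu + eta') |S x|^2, and |S x|^2 >= mu - eta' bounds the whole by 2 mu eta'. *)
have S2F eta : 0 < eta -> exists x, [/\ nsq x = 1, forall f, F f -> nsq (f x) <= eta &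
    nsq (S (S x) - mu%:C *: x) <= eta].
  move=> eta0; pose eta' := Num.min (mu / 2) (eta / (2 * mu)).
  have eta'0 : 0 < eta' by rewrite lt_min !divr_gt0// mulr_gt0.
  have [d d0 dP] := muD _ eta'0.
  (* Here [mu / 2] is a lower bound of |S x|^2, needed because the nullity of [S x] is relative to
     its length. *)
  pose e := Num.min eta (d * (mu / 2) / (c + 1)).
  have c1 : 0 < c + 1 by rewrite ltr_wpDl.
  have e0 : 0 < e by rewrite lt_min eta0 divr_gt0// mulr_gt0// divr_gt0.
  have [x [x1 xe xS]] := muB _ _ eta'0 e0.
  have mu2 : mu / 2 <= nsq (S x).
    rewrite (le_trans _ xS)//; have : eta' <= mu / 2 by rewrite ge_min lexx.
    by lra.
  exists x; split=> //.
    by move=> f /xe /le_trans; apply; rewrite ge_min lexx.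
  rewrite nsqB// nsqZr x1 mulr1 ipZr conj_real Re_realM Ssa.
  rewrite [Re _]/(nsq _).
  have SS : nsq (S (S x)) <= (mu + eta') * nsq (S x).
    apply: dP => f Ff; rewrite SF// (le_trans (Sc _))//.
    apply: (@le_trans _ _ (c * e)); first by rewrite ler_wpM2l// xe.
    apply: (@le_trans _ _ (d * (mu / 2))); last by rewrite ler_wpM2l// ltW.
    apply: (@le_trans _ _ ((c + 1) * e)).
      by rewrite ler_wpM2r ?ltW// ltrDl.
    by rewrite mulrC -ler_pdivlMr// ge_min lexx orbT.
  have eta'e : 2 * (mu * eta') <= eta.
    rewrite mulrA mulrC -ler_pdivlMr ?mulr_gt0// /eta' ge_min lexx.
    by rewrite orbT.
  have : (eta' - mu) * nsq (S x) <= (eta' - mu) * (mu - eta').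
    rewrite ler_wnM2l// subr_le0 /eta' ge_min; apply/orP; left; lra.
  have : 0 <= eta' ^+ 2 by rewrite sqr_ge0.
  nra.
pose rho := Num.sqrt mu; have rho2 : rho ^+ 2 = mu by rewrite sqr_sqrtr// ltW.
(* S^2 - mu = (S - rho)(S + rho): either S + rho gets small on almost null unit vectors and [- rho]
   is an eigenvalue, or the vectors (S + rho) x stay away from 0 and serve for [rho]. *)
have [nul|nnul] := pselect (approx_null (F `|` [set fun x => S x - (- rho)%:C *: x])).
  by exists (- rho).
have [d d0 dP] : exists2 d : R, 0 < d & forall x, nsq x = 1 ->
    (forall f, F f -> nsq (f x) <= d) -> d < nsq (S x - (- rho)%:C *: x).
  apply: contrapT => nd; apply: nnul => e e0; apply: contrapT => nx; apply: nd.
  exists e => // x x1 xe; rewrite ltNge; apply/negP => xS; apply: nx.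
  by exists x; split=> // f [/xe|->].
exists rho; apply: approx_null_scaled.
  by move=> f [/lF//|->]; exact: linear_shift.
move=> e e0; pose e' := Num.min d (Num.min (e * d) (e * d / (2 * (c + mu)))).
have cmu : 0 < c + mu by rewrite ltr_wpDl.
have e'0 : 0 < e' by rewrite !lt_min d0 mulr_gt0//= divr_gt0// mulr_gt0.
have [x [x1 xe xS]] := S2F e' e'0; pose y := S x - (- rho)%:C *: x.
have e'd : e' <= d by rewrite /e' ge_min lexx.
have dy : d < nsq y by apply: dP => // f /xe /le_trans; apply.
exists y; split; first exact: lt_trans dy.
have eC : 2 * (c + mu) * e' <= e * d.
  rewrite mulrC -ler_pdivlMr ?mulr_gt0//.
  by rewrite /e' !ge_min lexx !orbT.
move=> f [Ff|->]; rewrite (@le_trans _ _ (e * d)) ?ler_pM2l ?(ltW dy)//.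
  rewrite /y (linear_funB (lF _ Ff)) SF// (linear_funZ (lF _ Ff)).
  rewrite (le_trans (nsqB_le ip_ge0 _ _))// nsqZr sqrrN rho2.
  apply: le_trans eC; rewrite -mulrA ler_pM2l// mulrDl lerD//.
    by rewrite (le_trans (Sc _))// ler_wpM2l// xe.
  by rewrite ler_pM2l// xe.
have -> : S y - rho%:C *: y = S (S x) - mu%:C *: x.
  rewrite /y (linear_funB lS) (linear_funZ lS) rmorphN !scaleNr !opprK -rho2.
  rewrite scalerDr scalerA -rmorphM -expr2 opprD addrA.
  by rewrite -[S (S x) + _ - _]addrA subrr addr0.
by rewrite (le_trans xS)// /e' !ge_min lexx !orbT.
Qed.

(** One operator is added at a time: commutation lets [approx_null_eigen] be applied to [F] enlarged
    by the shifts already found. *)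
Lemma joint_approx_null (I : eqType) (s : seq I) F (S : I -> E -> E) :
  (forall f, F f -> linear f) -> (forall i, linear (S i)) ->
  (forall i, selfadjoint (S i)) -> (forall i, exists c, nsq_bounded c (S i)) ->
  (forall i f, F f -> forall x, f (S i x) = S i (f x)) ->
  (forall i j x, S i (S j x) = S j (S i x)) ->
  approx_null F ->
  exists l : I -> R, approx_null
    (F `|` [set g | exists2 i, i \in s & g = fun x => S i x - (l i)%:C *: x]).
Proof.
move=> lF lS Ssa Sb SF SS F0; elim: s => [|i s [l ls]].
  exists (fun=> 0); apply: approx_null_sub F0 => f [//|[k]]; by rewrite in_nil.
have [si|si] := boolP (i \in s).
  exists l; apply: approx_null_sub ls => f [|[j]]; first by left.
  by rewrite inE => /predU1P[->|js ->]; right; [exists i|exists j].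
have [c ci] := Sb i.
case: (@approx_null_eigen _ (S i) c _ (lS i) (Ssa i) ci _ ls) => [f|f|l0 l0P].
- by move=> [/lF//|[j _ ->]]; exact: linear_shift.
- move=> [/SF//|[j _ ->] x]; rewrite SS (linear_funB (lS _)).
  by rewrite [in RHS](linear_funZ (lS _)).
exists (fun j => if j == i then l0 else l j); apply: approx_null_sub l0P => f.
case=> [Ff|[j]]; first by left; left.
rewrite inE => /predU1P[-> ->|js ->]; first by right; rewrite eqxx.
left; right; exists j => //; case: eqP => // ji.
by move: si; rewrite -ji js.
Qed.

(** The infimum of the form of [G] on unit vectors is [- s]. Shifted by [s] the operator is
    positive, and a positive operator is small at vectors where its form is small. *)
Lemma approx_null_bottom G c : linear G -> selfadjoint G -> nsq_bounded c G ->
  (exists x, Re (ip (G x) x) < 0) ->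
  exists2 s : R, 0 < s & approx_null [set fun x => G x + s%:C *: x].
Proof.
move=> lG Gsa Gc [x0 x00].
have unit_scale x : 0 < nsq x -> exists2 a : R, a ^+ 2 = (nsq x)^-1 & nsq (a%:C *: x) = 1.
  move=> x1; exists (Num.sqrt (nsq x))^-1; first by rewrite exprVn sqr_sqrtr// ltW.
  by rewrite nsqZr exprVn sqr_sqrtr ?ltW// mulVf ?gt_eqF.
have formZ (a : R) x : Re (ip (G (a%:C *: x)) (a%:C *: x)) = a ^+ 2 * Re (ip (G x) x).
  by rewrite (linear_funZ lG) ipZl ipZr conj_real !Re_realM mulrA.
have x0gt0 : 0 < nsq x0.
  rewrite lt_def nsq_ge0// andbT; apply: contraTneq x00 => x00.
  by rewrite ipC nsq0_ip// rmorph0 ltxx.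
have c0 : 0 <= c.
  by have := nsq_ge0 ip_ge0 (G x0); move/le_trans => /(_ _ (Gc _)); rewrite pmulr_lge0.
pose A := [set Re (ip (G x) x) | x in [set x | nsq x = 1]].
have Alb : lbound A (- (c + 1)).
  move=> _ [x x1 <-]; have := ip_CSr ip_ge0 (G x) x; have := Gc x.
  by rewrite x1 !mulr1 => Gx /le_trans/(_ Gx) {}Gx; nra.
have [a0 a02 a01] := unit_scale _ x0gt0.
have Ainf : has_inf A.
  split; last by exists (- (c + 1)).
  by exists (Re (ip (G (a0%:C *: x0)) (a0%:C *: x0))), (a0%:C *: x0).
pose s := - inf A.
have s0 : 0 < s.
  rewrite oppr_gt0 (@le_lt_trans _ _ (Re (ip (G (a0%:C *: x0)) (a0%:C *: x0))))//.
    by apply: ge_inf; [case: Ainf|exists (a0%:C *: x0)].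
  by rewrite formZ a02 pmulr_rlt0// invr_gt0.
exists s => //; pose P x := G x + s%:C *: x.
have lP : linear P.
  by move=> b x y; rewrite /P lG !scalerDr !scalerA [s%:C * b]mulrC addrACA.
have Psa : selfadjoint P.
  by move=> x y; rewrite /P ipDl ipDr ipZl ipZr conj_real Gsa.
have P0 x : 0 <= Re (ip (P x) x).
  rewrite /P ipDl ReD ipZl Re_realM -/(nsq x).
  have := nsq_ge0 ip_ge0 x; rewrite le_eqVlt => /predU1P[x1|x1].
    by rewrite -x1 mulr0 addr0 ipC nsq0_ip// rmorph0.
  have [a a2 a1] := unit_scale _ x1.
  have : inf A <= Re (ip (G (a%:C *: x)) (a%:C *: x)).
    by apply: ge_inf; [case: Ainf|exists (a%:C *: x)].
  rewrite formZ a2 ler_pdivlMl// /s mulrC; lra.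
pose C := c + 1 + s; have C0 : 0 < C by rewrite addr_gt0// ltr_wpDl.
have PC x : Re (ip (P x) x) <= C * nsq x.
  rewrite /P ipDl ReD ipZl Re_realM -/(nsq x) /C mulrDl lerD2r.
  have := ip_CSr ip_ge0 (G x) x; have := Gc x; have := nsq_ge0 ip_ge0 x.
  set n := nsq x; set g := nsq (G x); set r := Re _ => n0 gn rn.
  have : r ^+ 2 <= (c + 1) ^+ 2 * n ^+ 2.
    rewrite (le_trans rn)// (le_trans (ler_wpM2r n0 gn))//; nra.
  rewrite -exprMn => rr; rewrite (le_trans (ler_norm _))//.
  by rewrite -(@ler_pXn2r _ 2)// ?nnegrE ?mulr_ge0 ?addr_ge0// real_normK// num_real.
(* Positivity of [P] at [x - C^-1 P x], combined with <P P x, P x> <= C |P x|^2. *)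
have PP x : nsq (P x) <= C * Re (ip (P x) x).
  have := P0 (x - C^-1%:C *: P x).
  rewrite (linear_funB lP) (linear_funZ lP) ipBl !ipBr !ipZl !ipZr conj_real.
  rewrite !ReB !Re_realM [ip (P (P x)) x]Psa -/(nsq (P x)) => h.
  have : Re (ip (P (P x)) (P x)) <= C * nsq (P x) by exact: PC.
  have CC : 0 <= C^-1 * C^-1 by rewrite mulr_ge0// invr_ge0 ltW.
  move/(ler_wpM2l CC); rewrite -!mulrA mulKf ?gt_eqF// => h2.
  by rewrite mulrC -ler_pdivrMr// mulrC; lra.
move=> e e0; have eC0 : 0 < e / C by rewrite divr_gt0.
have [_ [x x1 <-] xe] := inf_adherent eC0 Ainf.
exists x; split=> // _ ->; rewrite (le_trans (PP x))// mulrC -ler_pdivlMr//.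
rewrite /P ipDl ReD ipZl Re_realM -/(nsq x) x1 mulr1 /s.
by rewrite lerBlDl ltW.
Qed.

End ApproximateEigenvectors.

(** * Riesz representation, adjoints and the operator norm *)

Section HilbertSpaces.
Variable R : realType.
Implicit Types H K L : hilbertType R.

Lemma inner_ge0 H (x : H) : 0 <= inner x x.
Proof. by rewrite inner_normE exprn_ge0. Qed.

Definition hnsq H (x : H) : R := Re (inner x x).
Definition hnorm H (x : H) : R := Num.sqrt (hnsq x).

Lemma innerC H (x y : H) : inner x y = cj (inner y x).
Proof. exact: ipC. Qed.

Lemma Re_innerC H (x y : H) : Re (inner x y) = Re (inner y x).
Proof. exact: Re_ipC. Qed.

Lemma innerDl H (x y z : H) : inner (x + y) z = inner x z + inner y z.
Proof. exact: ipDl. Qed.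

Lemma innerDr H (x y z : H) : inner x (y + z) = inner x y + inner x z.
Proof. exact: ipDr. Qed.

Lemma innerBl H (x y z : H) : inner (x - y) z = inner x z - inner y z.
Proof. exact: ipBl. Qed.

Lemma innerBr H (x y z : H) : inner x (y - z) = inner x y - inner x z.
Proof. exact: ipBr. Qed.

Lemma innerZl H c (x y : H) : inner (c *: x) y = c * inner x y.
Proof. exact: ipZl. Qed.

Lemma innerZr H c (x y : H) : inner x (c *: y) = cj c * inner x y.
Proof. exact: ipZr. Qed.

Lemma innerNr H (x y : H) : inner x (- y) = - inner x y.
Proof. exact: ipNr. Qed.

Lemma inner0r H (x : H) : inner x 0 = 0.
Proof. exact: ip0r. Qed.

Lemma inner_suml H (I : Type) (r : seq I) (P : pred I) (F : I -> H) y :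
  inner (\sum_(i <- r | P i) F i) y = \sum_(i <- r | P i) inner (F i) y.
Proof. exact: ip_suml. Qed.

Lemma inner_sumr H (I : Type) (r : seq I) (P : pred I) (F : I -> H) y :
  inner y (\sum_(i <- r | P i) F i) = \sum_(i <- r | P i) inner y (F i).
Proof. exact: ip_sumr. Qed.

Lemma hnsqZr H (a : R) (x : H) : hnsq (a%:C *: x) = a ^+ 2 * hnsq x.
Proof. exact: nsqZr. Qed.

Lemma hnsqD H (x y : H) : hnsq (x + y) = hnsq x + hnsq y + 2 * Re (inner x y).
Proof. exact: nsqD. Qed.

Lemma hnsq0 H : hnsq (0 : H) = 0.
Proof. exact: nsq0. Qed.

Lemma hnsqN H (x : H) : hnsq (- x) = hnsq x.
Proof. exact: nsqN. Qed.

Lemma hnsq_parallelogram H (x y : H) :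
  hnsq (x + y) + hnsq (x - y) = 2 * (hnsq x + hnsq y).
Proof. exact: parallelogram. Qed.

Lemma inner_CSr H (x y : H) : Re (inner x y) ^+ 2 <= hnsq x * hnsq y.
Proof. exact/ip_CSr/inner_ge0. Qed.

Lemma inner_CS H (x y : H) : normc (inner x y) ^+ 2 <= hnsq x * hnsq y.
Proof. exact/ip_CS/inner_ge0. Qed.

Lemma hnorm_ge0 H (x : H) : 0 <= hnorm x. Proof. exact: sqrtr_ge0. Qed.

Lemma hnsq_ge0 H (x : H) : 0 <= hnsq x. Proof. exact/nsq_ge0/inner_ge0. Qed.

Lemma sqr_hnorm H (x : H) : hnorm x ^+ 2 = hnsq x.
Proof. by rewrite sqr_sqrtr// hnsq_ge0. Qed.

Lemma inner_hnsq H (x : H) : inner x x = (hnsq x)%:C.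
Proof. exact/nsqE/inner_ge0. Qed.

Lemma normE H (x : H) : `|x| = (hnorm x)%:C.
Proof.
apply/eqP; rewrite -(@eqrXn2 _ 2)// ?ler0c ?hnorm_ge0//.
by rewrite -inner_normE inner_hnsq -sqr_hnorm rmorphXn.
Qed.

Lemma hnorm_eq0 H (x : H) : hnorm x = 0 -> x = 0.
Proof. by move=> x0; apply/eqP; rewrite -normr_eq0 normE x0. Qed.

Lemma hnsq_eq0 H (x : H) : hnsq x = 0 -> x = 0.
Proof. by move=> x0; apply: hnorm_eq0; rewrite /hnorm x0 sqrtr0. Qed.

Lemma hnormD H (x y : H) : hnorm (x + y) <= hnorm x + hnorm y.
Proof. by rewrite -lecR rmorphD /= -!normE; exact: ler_normD. Qed.

Lemma hnormN H (x : H) : hnorm (- x) = hnorm x.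
Proof. by rewrite /hnorm hnsqN. Qed.

Lemma hnormZ H a (x : H) : hnorm (a *: x) = normc a * hnorm x.
Proof. by apply: (@complexI R); rewrite -normE normrZ normcE normE realCM. Qed.

Lemma hnormBC H (x y : H) : hnorm (x - y) = hnorm (y - x).
Proof. by rewrite -hnormN opprB. Qed.

Lemma le_hnorm H K (x : H) (y : K) (c : R) : 0 <= c ->
  (hnorm x <= c * hnorm y) = (hnsq x <= c ^+ 2 * hnsq y).
Proof.
move=> c0; rewrite -!sqr_hnorm -exprMn ler_pXn2r ?nnegrE ?hnorm_ge0//.
by rewrite mulr_ge0// hnorm_ge0.
Qed.

Lemma inner_inj H (x y : H) : (forall z, inner z x = inner z y) -> x = y.
Proof.
move=> xy; apply/subr0_eq/hnsq_eq0.
by rewrite /hnsq innerBr xy subrr.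
Qed.

(** The steps have norm at most 2^-k, so the tail after [k] has norm at most 2 * 2^-k, whose square
    is the bound. Completeness of Hilbert spaces enters the later arguments in this form. *)
Lemma cauchy_fast H (x : nat -> H) :
  (forall k, hnsq (x k.+1 - x k) <= (4^-1) ^+ k) ->
  exists y, forall k, hnsq (y - x k) <= 4 * (4^-1) ^+ k.
Proof.
move=> xx; have xk k : hnorm (x k.+1 - x k) <= (2^-1) ^+ k.
  rewrite -(@ler_pXn2r _ 2)// ?nnegrE ?hnorm_ge0 ?exprn_ge0 ?invr_ge0//.
  rewrite sqr_hnorm (le_trans (xx k))// -exprM mulnC exprM expr2 -invfM.
  by rewrite (_ : 2 * 2 = 4 :> R)//; ring.
have xnk k n : hnorm (x (n + k)%N - x k) <= 2 * (2^-1) ^+ k - 2 * (2^-1) ^+ (n + k).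
  elim: n => [|n IHn]; first by rewrite add0n !subrr /hnorm hnsq0 sqrtr0.
  rewrite addSn -[x _ - _](subrKA (x (n + k)%N)) (le_trans (hnormD _ _))//.
  rewrite (le_trans (lerD (xk _) IHn))// exprS.
  set u := _ ^+ (n + k); set v := _ ^+ k.
  rewrite mulrA divff// mul1r; lra.
have xnk2 k n : (k <= n)%N -> hnorm (x n - x k) <= 2 * (2^-1) ^+ k.
  move=> /subnK <-; rewrite (le_trans (xnk _ _))// gerBl.
  by rewrite mulr_ge0// exprn_ge0// invr_ge0.
have pow2 (e : R) : 0 < e -> exists k, 2 * (2^-1) ^+ k < e.
  move=> e0; apply: contrapT => /forallNP ne.
  suff : e ^+ 2 <= 0 by rewrite leNgt exprn_gt0.
  apply: (@le_geometric0 _ _ 4) => k.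
  have := ne k => /negP; rewrite -leNgt => ek.
  rewrite (_ : 4^-1 = 2^-1 ^+ 2); last by rewrite expr2 -invfM (_ : 2 * 2 = 4 :> R)//; ring.
  rewrite (_ : 4 = 2 ^+ 2 :> R); last by rewrite expr2; ring.
  rewrite -exprM mulnC exprM -exprMn ler_pXn2r ?nnegrE//.
  exact: ltW.
have /cauchy_cvg/cvg_ex[y xy] : cauchy (x @ \oo).
  apply/cauchy_exP => e e0.
  have eE : e = (Re e)%:C by apply: ge0_complex; exact: ltW.
  have {}e0 : 0 < Re e by rewrite -ltcR -eE.
  have [k ke] := pow2 _ e0; exists (x k), k => // n /= kn.
  by rewrite -ball_normE /= normE eE ltcR hnormBC (le_lt_trans (xnk2 _ _ kn)).
exists y => k.
have -> : 4 * (4^-1) ^+ k = (2 * (2^-1) ^+ k) ^+ 2 :> R.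
  rewrite exprMn -exprM mulnC exprM !expr2 -invfM.
  by rewrite (_ : 2 * 2 = 4 :> R)//; ring.
rewrite -sqr_hnorm ler_pXn2r ?nnegrE ?hnorm_ge0 ?mulr_ge0 ?exprn_ge0 ?invr_ge0//.
apply/ler_addgt0Pl => e e0.
have eC : 0 < e%:C :> R[i] by rewrite ltcR.
move/cvgrPdist_lt : xy => /(_ _ eC)[n _ /(_ (n + k)%N (leq_addr _ _))] /=.
rewrite normE ltcR => yx.
rewrite -(subrKA (x (n + k)%N)) (le_trans (hnormD _ _))// lerD ?(ltW yx)//.
exact: xnk2 (leq_addl _ _).
Qed.

(** The vector is the minimiser of |x|^2 - 2 Re (f x): the parallelogram law makes minimising
    sequences Cauchy, and varying the minimiser along [h] gives Re (f h) = Re <h, w>. *)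
Lemma riesz H (f : H -> R[i]) (c : R) : 0 <= c -> scalar f ->
  (forall x, normc (f x) ^+ 2 <= c * hnsq x) ->
  exists w, forall x, f x = inner x w.
Proof.
move=> c0 lf fc; pose phi x : R := hnsq x - 2 * Re (f x).
have f0 : f 0 = 0 by have := lf (-1) 0 0; rewrite scaler0 add0r mulN1r addNr.
have fZ a x : f (a *: x) = a * f x by have := lf a x 0; rewrite !addr0 f0 addr0.
have fD x y : f (x + y) = f x + f y by have := lf 1 x y; rewrite scale1r mul1r.
have Ref x : Re (f x) ^+ 2 <= c * hnsq x.
  by rewrite (le_trans _ (fc x))// sqr_normc lerDl sqr_ge0.
have philb x : - c <= phi x.
  have := Ref x; rewrite /phi; have := hnsq_ge0 x.
  set n := hnsq x; set r := Re _ => n0 rn; rewrite leNgt; apply/negP => h.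
  have : (n + c) ^+ 2 < (2 * r) ^+ 2.
    by rewrite ltr_pXn2r// ?nnegrE; lra.
  by have := sqr_ge0 (n - c); nra.
pose A := range phi.
have Ainf : has_inf A.
  by split; [exists (phi 0), 0|exists (- c) => _ [x _ <-]].
have phi_inf x : inf A <= phi x by apply: ge_inf; [case: Ainf|exists x].
pose e k : R := 4^-1 * (4^-1) ^+ k.
have e0 k : 0 < e k by rewrite mulr_gt0 ?exprn_gt0 ?invr_gt0.
have xe k : exists x, phi x < inf A + e k.
  by have [_ [x _ <-] xk] := inf_adherent (e0 k) Ainf; exists x.
have [x xP] := choice xe.
have phid (u v : H) (E : R) : phi u < inf A + E -> phi v < inf A + E -> hnsq (u - v) <= 4 * E.
  move=> uE vE; have := phi_inf ((2^-1)%:C *: (u + v)).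
  have := hnsq_parallelogram u v.
  rewrite /phi hnsqZr fZ Re_realM fD ReD.
  move: uE vE; rewrite /phi; lra.
have [k|w wx] := @cauchy_fast _ x.
  have -> : (4^-1) ^+ k = 4 * e k by rewrite /e mulrA divff// mul1r.
  apply: phid => //; rewrite (lt_le_trans (xP _))// lerD2l.
  by rewrite /e exprS; have := e0 k; rewrite /e; lra.
have Rew h : Re (f h) = Re (inner h w).
  apply/eqP; rewrite -subr_eq0 -sqrf_eq0 eq_le sqr_ge0 andbT.
  (* The difference is a sum of two parts, of square at most 4 * 4^-k |h|^2 because [x k] is close
     to [w], and at most 4^-k |h|^2 / 4 because [x k] is almost minimal; 9 exceeds 2 (4 + 1/4). *)
  apply: (@le_geometric0 _ _ (9 * hnsq h)) => k.
  have q t : 0 <= hnsq h * t ^+ 2 + 2 * (Re (inner (x k) h) - Re (f h)) * t + e k.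
    have := phi_inf (x k + t%:C *: h); have := xP k.
    rewrite /phi hnsqD hnsqZr fD fZ innerZr conj_real ReD !Re_realM.
    by lra.
  have := discriminant_le (hnsq_ge0 h) q; have := inner_CSr (w - x k) h.
  rewrite innerBl ReB [Re (inner w h)]Re_innerC.
  have : hnsq (w - x k) * hnsq h <= 4 * (4^-1) ^+ k * hnsq h.
    by rewrite ler_wpM2r ?hnsq_ge0// wx.
  rewrite /e; set u := _ ^+ k; set a := Re (inner (x k) h); set b := Re (inner h w).
  set d := Re (f h); set n := hnsq h; set m := hnsq _ => h1 h2 h3.
  have un : 0 <= u * n by rewrite mulr_ge0 ?hnsq_ge0// exprn_ge0// invr_ge0.
  have : 0 <= ((a - d) - (b - a)) ^+ 2 by exact: sqr_ge0.
  nra.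
exists w => h; apply: complexP => //.
(* Real parts at -i h are imaginary parts at [h]. *)
have := Rew ((- 'i%C) *: h); rewrite fZ innerZl !ReM /=; lra.
Qed.

End HilbertSpaces.

Section BoundedOperators.
Variable R : realType.
Implicit Types H K L : hilbertType R.

Lemma bopP H K (A B : bop H K) : (forall x, A x = B x) -> A = B.
Proof. by move=> AB; apply: val_inj; apply/funext. Qed.

Lemma bop_addE H K (A B : bop H K) x : (A + B) x = A x + B x.
Proof. by []. Qed.

Lemma bop_zeroE H K x : (0 : bop H K) x = 0.
Proof. by []. Qed.

Lemma bop_scaleE H K c (A : bop H K) x : (c *: A) x = c *: A x.
Proof. by []. Qed.

Lemma bop_sumE H K (I : Type) (r : seq I) (P : pred I) (F : I -> bop H K) x :
  (\sum_(i <- r | P i) F i) x = \sum_(i <- r | P i) F i x.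
Proof. by apply: (big_morph (fun A : bop H K => A x)). Qed.

Lemma bop_hnsq H K (A : bop H K) :
  exists2 c : R, 0 <= c & forall x, hnsq (A x) <= c * hnsq x.
Proof.
have [M AM] := bop_bounded A; exists (`|M| ^+ 2); first exact: sqr_ge0.
move=> x; rewrite -le_hnorm// -lecR realCM -!normE (le_trans (AM x))//.
by rewrite ler_wpM2r// lecR ler_norm.
Qed.

Lemma exists_bop H K (f : H -> K) (c : R) : linear f ->
  (forall x, hnsq (f x) <= c * hnsq x) -> exists A : bop H K, forall x, A x = f x.
Proof.
move=> lf fc; have fb : f \in @bounded_op R H K.
  apply/asboolP; split=> //; exists (Num.sqrt `|c|) => x.
  rewrite !normE -realCM lecR le_hnorm ?sqrtr_ge0// sqr_sqrtr//.
  by rewrite (le_trans (fc x))// ler_wpM2r ?hnsq_ge0// ler_norm.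
by exists (Bop fb).
Qed.

Lemma adjoint_exists H K (A : bop H K) : exists B, is_adjoint A B.
Proof.
have [c c0 Ac] := bop_hnsq A.
have ex y : exists w, forall x, inner (A x) y = inner x w.
  apply: (@riesz _ _ (fun x => inner (A x) y) (c * hnsq y)) => [|a u v|x].
    by rewrite mulr_ge0// hnsq_ge0.
    by rewrite linearP /= innerDl innerZl.
  rewrite (le_trans (inner_CS _ _))//.
  by rewrite -[c * _ * _]mulrAC ler_wpM2r ?hnsq_ge0//; exact: Ac.
have [B BP] := choice ex.
have lB : linear B.
  move=> a u v; apply: inner_inj => z.
  by rewrite -BP !innerDr !innerZr -!BP.
have Bc y : hnsq (B y) <= c * hnsq y.
  have h : hnsq (B y) ^+ 2 <= c * hnsq (B y) * hnsq y.
    rewrite {1}/hnsq -BP (le_trans (inner_CSr _ _))//.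
    by rewrite ler_wpM2r ?hnsq_ge0//; exact: Ac.
  have := hnsq_ge0 (B y); rewrite le_eqVlt => /predU1P[<-|By].
    by rewrite mulr_ge0 ?hnsq_ge0.
  by rewrite -(ler_pM2l By) -expr2 (le_trans h)// mulrAC mulrC.
have [B' B'E] := exists_bop lB Bc; exists B' => x y.
by rewrite B'E BP.
Qed.

Lemma is_adjointC H K (A : bop H K) B : is_adjoint A B -> is_adjoint B A.
Proof. by move=> AB x y; rewrite innerC -AB [RHS]innerC. Qed.

Lemma opnorm_has_sup H K (A : bop H K) :
  has_sup [set Re `|A x| | x in [set x : H | `|x| <= 1]].
Proof.
split; first by exists (Re `|A 0|), 0 => //=; rewrite normr0.
have [c c0 Ac] := bop_hnsq A; exists (Num.sqrt c) => _ [x /= x1 <-].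
rewrite normE /= -[leRHS]mulr1; move: x1; rewrite normE lecR => x1.
rewrite (@le_trans _ _ (Num.sqrt c * hnorm x))//.
  by rewrite le_hnorm ?sqrtr_ge0// sqr_sqrtr.
by rewrite ler_wpM2l// sqrtr_ge0.
Qed.

Lemma opnorm_ge0 H K (A : bop H K) : 0 <= opnorm A.
Proof.
have [_ ub] := opnorm_has_sup A; apply: ub_le_sup => //.
by exists 0; rewrite /= ?normr0// linear0 normr0.
Qed.

Lemma le_opnorm H K (A : bop H K) x : hnorm (A x) <= opnorm A * hnorm x.
Proof.
have := hnorm_ge0 x; rewrite le_eqVlt => /predU1P[x0|x0].
  by rewrite -x0 mulr0 (hnorm_eq0 (esym x0)) linear0 /hnorm hnsq0 sqrtr0.
have [_ ub] := opnorm_has_sup A.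
rewrite -ler_pdivrMr//; apply: ub_le_sup => //.
exists ((hnorm x)^-1%:C *: x).
  rewrite /= normE lecR hnormZ normc_real ger0_norm ?invr_ge0 ?(ltW x0)//.
  by rewrite mulVf// gt_eqF.
rewrite linearZ normE /= hnormZ normc_real ger0_norm ?invr_ge0 ?ltW//.
by rewrite mulrC.
Qed.

Lemma opnorm_le H K (A : bop H K) (M : R) : 0 <= M ->
  (forall x, hnorm (A x) <= M * hnorm x) -> opnorm A <= M.
Proof.
move=> M0 AM; have [ne _] := opnorm_has_sup A; apply: ge_sup => //.
move=> _ [x /= x1 <-]; rewrite normE /= (le_trans (AM x))//.
by rewrite -[leRHS]mulr1 ler_wpM2l//; move: x1; rewrite normE lecR.
Qed.

Lemma opnormD H K (A B : bop H K) : opnorm (A + B) <= opnorm A + opnorm B.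
Proof.
apply: opnorm_le; first by rewrite addr_ge0 ?opnorm_ge0.
by move=> x; rewrite bop_addE (le_trans (hnormD _ _))// mulrDl lerD ?le_opnorm.
Qed.

Lemma opnormZ_le H K c (A : bop H K) : opnorm (c *: A) <= normc c * opnorm A.
Proof.
apply: opnorm_le; first by rewrite mulr_ge0 ?opnorm_ge0 ?normc_ge0.
by move=> x; rewrite bop_scaleE hnormZ -mulrA ler_wpM2l ?normc_ge0 ?le_opnorm.
Qed.

Lemma opnorm_comp H K L (A : bop K L) (B : bop H K) :
  opnorm (bop_comp A B) <= opnorm A * opnorm B.
Proof.
apply: opnorm_le; first by rewrite mulr_ge0 ?opnorm_ge0.
move=> x; rewrite (le_trans (le_opnorm A _))// -mulrA.
by rewrite ler_wpM2l ?opnorm_ge0 ?le_opnorm.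
Qed.

Lemma opnorm0_eq0 H K (A : bop H K) : opnorm A = 0 -> A = 0.
Proof.
move=> A0; apply: bopP => x; apply: hnorm_eq0; apply/eqP.
by rewrite eq_le hnorm_ge0 andbT (le_trans (le_opnorm _ _))// A0 mul0r.
Qed.

Lemma opnorm_adjoint_le H K (A : bop H K) B : is_adjoint A B -> opnorm B <= opnorm A.
Proof.
move=> AB; apply: opnorm_le (opnorm_ge0 _) _ => y.
have := hnorm_ge0 (B y); rewrite le_eqVlt => /predU1P[<-|By].
  by rewrite mulr_ge0 ?opnorm_ge0 ?hnorm_ge0.
rewrite -(ler_pM2l By) -expr2 sqr_hnorm {1}/hnsq -AB.
rewrite (@le_trans _ _ (hnorm (A (B y)) * hnorm y))//; last first.
  by rewrite mulrCA mulrA ler_wpM2r ?hnorm_ge0 ?le_opnorm.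
rewrite (le_trans (ler_norm _))// -sqrtr_sqr -sqrtrM ?hnsq_ge0//.
by rewrite ler_wsqrtr// inner_CSr.
Qed.

Lemma opnorm_adjoint H K (A : bop H K) B : is_adjoint A B -> opnorm B = opnorm A.
Proof.
move=> AB; apply/le_anti; rewrite opnorm_adjoint_le//=.
by apply: opnorm_adjoint_le; exact: is_adjointC.
Qed.

End BoundedOperators.

(** * Roots of unity and Fuglede's theorem *)

Section RootsOfUnity.
Variable R : realType.

Lemma prim_root_exists n : (0 < n)%N -> exists w : R[i], n.-primitive_root w.
Proof.
pose p : {poly R[i]} := 'X^n - 1; have [r Dp] := closed_field_poly_normal p.
move=> n_gt0; rewrite (monicP _) ?monicXnsubC // scale1r in Dp.
have rn1 : all n.-unity_root r by apply/allP=> z; rewrite -root_prod_XsubC -Dp.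
have sz_r : (n < (size r).+1)%N.
  by rewrite -(size_prod_XsubC r id) -Dp size_XnsubC.
have [|z] := hasP (has_prim_root n_gt0 rn1 _ sz_r); last by exists z.
by rewrite -separable_prod_XsubC -Dp separable_Xn_sub_1 // pnatr_eq0 -lt0n.
Qed.

Lemma normc_prim_root n (w : R[i]) : n.-primitive_root w -> normc w = 1.
Proof.
move=> wn; have := prim_expr_order wn; move/(congr1 Num.norm).
rewrite normrX normr1 => /eqP; rewrite pexpr_eq1 ?(prim_order_gt0 wn)//.
by rewrite normcE => /eqP/(@complexI R).
Qed.

Lemma sum_prim_root n (w : R[i]) e : n.-primitive_root w ->
  \sum_(k < n) w ^+ (k * e) = if (n %| e)%N then n%:R else 0.
Proof.
move=> wn; under eq_bigr do rewrite mulnC exprM.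
rewrite (prim_order_dvd wn); case: eqP => [->|/eqP we].
  by under eq_bigr do rewrite expr1n; rewrite sumr_const card_ord.
apply/eqP; have := subrX1 (w ^+ e) n.
rewrite -exprM mulnC exprM (prim_expr_order wn) expr1n subrr.
by move/esym/eqP; rewrite mulf_eq0 subr_eq0 (negbTE we).
Qed.

End RootsOfUnity.

(** Averaging a polynomial of degree at most [n] over the roots of unity of order [n.+1], with
    weights w^(k n) = w^-k, keeps the coefficients satisfying this divisibility: only that of degree
    1. *)
Lemma dvdn_succ_eq1 (n j : nat) : (0 < n)%N -> (j < n.+1)%N -> (n.+1 %| n + j)%N ->
  j = 1%N.
Proof. by move=> n0 jn /dvdnP[m]; case: m => [|[|m]]; lia. Qed.

(* Applying the first two estimates to (1 - t D/n)^n x gives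
   |(1 - t D/n)^n x| <= 4 |x| for large n; averaging over |t| = r against roots
   of unity isolates the coefficient of t and gives r |D x| <= 4 |x|. *)
Section BoundedOrbit.
Variables (R : realType) (V : lmodType R[i]) (nu : V -> R) (P : set V).
Variables (D : V -> V) (c : R).
Hypothesis nuD : forall x y, nu (x + y) <= nu x + nu y.
Hypothesis nuZ : forall a x, nu (a *: x) = normc a * nu x.
Hypothesis P_lin : forall a x y, P x -> P y -> P (a *: x + y).
Hypothesis DP : forall x, P x -> P (D x).
Hypothesis D_lin : linear D.
Hypothesis D_le : forall x, P x -> nu (D x) <= c * nu x.
Hypothesis D_ge : forall a x, P x ->
  (1 - c ^+ 2 * normc a ^+ 2) * nu x <= nu (x + a *: D x).

Let step a x := x + a *: D x.

Let nu0 : nu 0 = 0.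
Proof. by rewrite -(scale0r (0 : V)) nuZ Normc.normc0 mul0r. Qed.

Let nu_ge0 x : 0 <= nu x.
Proof.
have := nuD x ((-1) *: x); rewrite nuZ scaleN1r subrr nu0.
rewrite normcN Normc.normc1 mul1r; lra.
Qed.

Let nu_sum_le (I : finType) (F : I -> V) : nu (\sum_i F i) <= \sum_i nu (F i).
Proof.
elim/big_ind2 : _ => //; first by rewrite nu0.
by move=> x a y b xa yb; rewrite (le_trans (nuD _ _))// lerD.
Qed.

Let step_P a x : P x -> P (step a x).
Proof. by move=> Px; rewrite /step addrC; apply: P_lin => //; exact: DP. Qed.

Let iter_P a n x : P x -> P (iter n (step a) x).
Proof. by move=> Px; elim: n => // n IHn; exact: step_P. Qed.

Let step_lin a : linear (step a).
Proof.
move=> b x y; rewrite /step D_lin !scalerDr !scalerA [a * b]mulrC.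
by rewrite addrACA.
Qed.

Let step_D a x : step a (D x) = D (step a x).
Proof. by rewrite /step (linear_funD D_lin) (linear_funZ D_lin). Qed.

Let stepC a b x : step a (step b x) = step b (step a x).
Proof.
have E y : step a y = y + a *: D y by [].
by rewrite [LHS]E [in RHS]E (linear_funD (step_lin b)) (linear_funZ (step_lin b)) step_D.
Qed.

Let iter_step_comm a b n x :
  iter n (step a) (iter n (step b) x) = iter n (fun y => step a (step b y)) x.
Proof.
have comm m y : step a (iter m (step b) y) = iter m (step b) (step a y).
  by elim: m => //= m IHm; rewrite stepC IHm.
have comm2 m y : iter m (step a) (step b y) = step b (iter m (step a) y).
  by elim: m => //= m ->; rewrite stepC.
elim: n => //= n IHn; rewrite comm2 IHn.
by rewrite stepC.
Qed.

Let le_iter a n x : P x -> c ^+ 2 * normc a ^+ 2 <= 1 ->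
  (1 - c ^+ 2 * normc a ^+ 2) ^+ n * nu x <= nu (iter n (step a) x).
Proof.
move=> Px a1; elim: n => [|n IHn] /=; first by rewrite expr0 mul1r.
rewrite exprS -mulrA (le_trans _ (D_ge a (iter_P a n Px)))//.
by rewrite ler_wpM2l// subr_ge0.
Qed.

(** The steps at [a] and [- a] compose to 1 - a^2 D^2, so the growth per pair of steps is of second
    order in [a]. *)
Let iter_le a n x : P x ->
  nu (iter n (fun y => step a (step (- a) y)) x) <=
    (1 + c ^+ 2 * normc a ^+ 2) ^+ n * nu x.
Proof.
move=> Px; elim: n => [|n IHn] /=; first by rewrite expr0 mul1r.
set y := iter n _ x; have Py : P y.
  by rewrite /y -iter_step_comm; exact/iter_P/iter_P.
have -> : step a (step (- a) y) = y + (- a ^+ 2) *: D (D y).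
  rewrite /step (linear_funD D_lin) (linear_funZ D_lin) scalerDr scalerA.
  by rewrite mulrN expr2 !scaleNr addrA subrK.
rewrite (le_trans (nuD _ _))// nuZ normcN normcX [_ ^+ n.+1]exprS -mulrA.
apply: (@le_trans _ _ ((1 + c ^+ 2 * normc a ^+ 2) * nu y)); last first.
  by rewrite ler_wpM2l// addr_ge0// mulr_ge0// sqr_ge0.
rewrite mulrDl mul1r lerD2l [c ^+ 2 * _]mulrC -[leRHS]mulrA ler_wpM2l ?sqr_ge0//.
(* A negative [c] makes [nu] vanish on [P], since [nu (D x)] is nonnegative. *)
have [c0|c0] := leP 0 c.
  by rewrite (le_trans (D_le (DP Py)))// expr2 -mulrA ler_wpM2l// D_le.
have nz z : P z -> nu z = 0.
  move=> Pz; have := D_le Pz; have := nu_ge0 (D z); have := nu_ge0 z.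
  by move=> z0 Dz /(le_trans Dz); rewrite nmulr_rge0// => z1; lra.
by rewrite !nz ?mulr0//; exact/DP/DP.
Qed.

Let iter_coef n x : exists v : nat -> V,
  [/\ v 1%N = n%:R *: D x, forall j, (n < j)%N -> v j = 0, v 0%N = x &
      forall a, iter n (step a) x = \sum_(j < n.+1) a ^+ j *: v j].
Proof.
elim: n => [|n [v [v1 vn v0 vE]]].
  exists (fun j => if j == 0%N then x else 0); split=> //.
  - by rewrite scale0r.
  - by case.
  - by move=> a; rewrite big_ord1 expr0 scale1r.
exists (fun j => v j + if j is j'.+1 then D (v j') else 0); split.
- by rewrite v1 v0 -[n.+1%:R]natr1 scalerDl scale1r.
- by case=> // j nj; rewrite (vn j.+1) ?(ltnW nj)// (vn j)// (linear_fun0 D_lin) addr0.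
- by rewrite addr0.
move=> a /=; rewrite /step vE.
have -> : D (\sum_(j < n.+1) a ^+ j *: v j) = \sum_(j < n.+1) a ^+ j *: D (v j).
  rewrite (big_morph D (linear_funD D_lin) (linear_fun0 D_lin)).
  by apply: eq_bigr => j _; rewrite (linear_funZ D_lin).
under [in RHS]eq_bigr do rewrite scalerDr.
rewrite big_split /= [X in _ = X + _]big_ord_recr /= (vn n.+1)// [X in _ = _ + X + _]scaler0 addr0.
congr (_ + _); rewrite [RHS]big_ord_recl /= [X in _ = X + _]scaler0 add0r scaler_sumr.
by apply: eq_bigr => j _; rewrite scalerA -exprS.
Qed.

Lemma bounded_orbit_eq0 x : P x -> nu (D x) = 0.
Proof.
move=> Px; apply/eqP; rewrite eq_le nu_ge0 andbT.
have nu4 (r : R) : 0 < r -> r * nu (D x) <= 4 * nu x.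
  move=> r0; pose q := c ^+ 2 * r ^+ 2.
  have q0 : 0 <= q by rewrite mulr_ge0 ?sqr_ge0.
  pose n := (Num.bound (2 * q)).+1.
  have n0 : 0 < n%:R :> R by rewrite ltr0n.
  have qn : 2 * q <= n%:R.
    have /archi_boundP/ltW : 0 <= 2 * q by lra.
    by rewrite /n -natr1; lra.
  pose b := q / n%:R ^+ 2.
  have nb : n%:R * b <= 2^-1.
    have -> : n%:R * b = q / n%:R.
      by rewrite /b expr2 invfM mulrCA mulVKf// gt_eqF.
    by rewrite ler_pdivrMr//; lra.
  have b0 : 0 <= b by rewrite divr_ge0 ?sqr_ge0.
  have b1 : b <= 1.
    have : b <= n%:R * b by rewrite ler_peMl// ler1n.
    by lra.
  have bern m : 1 - m%:R * b <= (1 - b) ^+ m.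
    elim: m => [|m IHm]; first by rewrite mul0r subr0 expr0.
    have h : 0 <= 1 - b by lra.
    rewrite exprS (le_trans _ (ler_wpM2l h IHm))// -[m.+1%:R]natr1.
    have : 0 <= m%:R * b * b by rewrite mulr_ge0// mulr_ge0.
    by lra.
  have bn : 2^-1 <= (1 - b) ^+ n by have := bern n; lra.
  have bn2 : (1 + b) ^+ n <= 2.
    have : (1 - b) ^+ n * (1 + b) ^+ n <= 1.
      by rewrite -exprMn exprn_ile1//; nra.
    have : 0 <= (1 + b) ^+ n by rewrite exprn_ge0//; lra.
    by nra.
  have g4 a : normc a = r / n%:R -> nu (iter n (step a) x) <= 4 * nu x.
    move=> ar; have ab : c ^+ 2 * normc a ^+ 2 = b.
      by rewrite ar expr_div_n mulrA.
    (* Following the orbit at [a] by the steps at [- a] gives a product controlled by [iter_le],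
       while [le_iter] says that little norm was lost on the way. *)
    have := @le_iter (- a) n _ (iter_P a n Px).
    rewrite normcN ab iter_step_comm => /(_ b1).
    have := @iter_le (- a) n x Px; rewrite normcN ab opprK.
    have := nu_ge0 (iter n (step a) x); have := nu_ge0 x.
    by nra.
  have [v [v1 vn v0 vE]] := iter_coef n x.
  have [w wP] := @prim_root_exists R n.+1 (ltn0Sn n).
  pose a : R[i] := (r / n%:R)%:C.
  have na : normc a = r / n%:R by rewrite normc_real ger0_norm// divr_ge0// ltW.
  have avg : \sum_(k < n.+1) w ^+ (k * n) *: iter n (step (a * w ^+ k)) x =
      n.+1%:R *: (a *: v 1%N).
    under eq_bigr do rewrite vE scaler_sumr.
    have n1 : (1 < n.+1)%N by [].
    rewrite exchange_big /= (bigD1 (Ordinal n1))//= [X in _ + X]big1 ?addr0.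
      under eq_bigr => k _.
        rewrite expr1 scalerA mulrCA -exprD -mulnSr mulrC -scalerA; over.
      by rewrite -scaler_suml (sum_prim_root _ wP) dvdnn.
    move=> j /eqP j1; under eq_bigr => k _.
      rewrite scalerA exprMn mulrCA -exprM -exprD -mulnDr mulrC -scalerA; over.
    rewrite -scaler_suml (sum_prim_root _ wP); case: ifP => [|_]; last by rewrite scale0r.
    move=> nj; case: j1; apply: val_inj.
    exact: dvdn_succ_eq1 (n1 : (0 < n)%N) (ltn_ord j) nj.
  have := nu_sum_le (fun k : 'I_n.+1 => w ^+ (k * n) *: iter n (step (a * w ^+ k)) x).
  rewrite avg 2!nuZ v1 nuZ na !normc_nat => h.
  have h4 : n.+1%:R * (r / n%:R * (n%:R * nu (D x))) <= n.+1%:R * (4 * nu x).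
    rewrite (le_trans h)// mulr_natl -[n.+1 in leRHS]card_ord -sumr_const.
    apply: ler_sum => k _; rewrite nuZ normcX (normc_prim_root wP) expr1n mul1r.
    by apply: g4; rewrite Normc.normcM normcX (normc_prim_root wP) expr1n mulr1.
  by move: h4; rewrite ler_pM2l ?ltr0n// mulrA divfK ?gt_eqF.
rewrite leNgt; apply/negP => Dx0.
have := nu4 ((4 * nu x + 1) / nu (D x)).
rewrite divr_gt0// ?mulfVK ?gt_eqF//; last by have := nu_ge0 x; lra.
by move=> /(_ isT); lra.
Qed.

End BoundedOrbit.

Section Fuglede.
Variables (R : realType) (L : hilbertType R).
Implicit Types A B N S T : bop L L.

Lemma opnormZ a A : opnorm (a *: A) = normc a * opnorm A.
Proof.
apply/le_anti; rewrite opnormZ_le/=; have [->|a0] := eqVneq a 0.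
  by rewrite Normc.normc0 mul0r opnorm_ge0.
have na0 : 0 < normc a.
  by rewrite lt_def normc_ge0 andbT; apply: contra a0 => /eqP/Normc.eq0_normc ->.
rewrite mulrC -ler_pdivlMr// mulrC -Normc.normcV.
by rewrite -[in leLHS](scalerK a0 A) opnormZ_le.
Qed.

Lemma opnorm_expand A B : (forall x, hnorm x <= hnorm (A x)) ->
  opnorm B <= opnorm (bop_comp A B).
Proof.
move=> Age; apply: opnorm_le (opnorm_ge0 _) _ => x.
by rewrite (le_trans (Age _))//; exact: (le_opnorm (bop_comp A B)).
Qed.

(** A first-order version of Rosenblum's argument with the unitaries exp (a S - cj a N). If [A]
    commutes with [N], its commutator with [a *: S] is its commutator with the skew-adjoint [Z], and
    1 + Z and 1 - Z do not shrink norms. This gives the lower estimate required by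
    [bounded_orbit_eq0] on the commutant of [N]. *)
Lemma fuglede N S T : is_adjoint N S -> bop_comp N S = bop_comp S N ->
  bop_comp T N = bop_comp N T -> bop_comp T S = bop_comp S T.
Proof.
move=> NS NSC; pose D A := bop_comp S A - bop_comp A S.
pose P := [set A | bop_comp A N = bop_comp N A].
suff : forall A, P A -> opnorm (D A) = 0.
  by move=> DP TN; apply/esym/subr0_eq/opnorm0_eq0/DP.
have nsc x : N (S x) = S (N x) by rewrite -[LHS]/(bop_comp N S x) NSC.
have PE A x : P A -> A (N x) = N (A x).
  by move=> PA; rewrite -[LHS]/(bop_comp A N x) PA.
pose M := opnorm N; have SM : opnorm S = M by exact: opnorm_adjoint.
have M0 : 0 <= M by exact: opnorm_ge0.
apply: (@bounded_orbit_eq0 R (bop L L) (@opnorm R L L) P D (2 * M)).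
- exact: opnormD.
- exact: opnormZ.
- move=> a A B PA PB; apply: bopP => x.
  by rewrite -[LHS]/(a *: A (N x) + B (N x)) (PE A)// (PE B)// -linearP.
- move=> A PA; apply: bopP => x.
  rewrite -[LHS]/(S (A (N x)) - A (S (N x))) -nsc !(PE A)// -nsc.
  by rewrite -linearB.
- move=> a A B; apply: bopP => x.
  rewrite -[LHS]/(S (a *: A x + B x) - (a *: A (S x) + B (S x))) linearP.
  rewrite -[RHS]/(a *: (S (A x) - A (S x)) + (S (B x) - B (S x))).
  by rewrite scalerBr opprD addrACA.
- move=> A PA; rewrite (le_trans (opnormD _ _))// -scaleN1r opnormZ normcN.
  have := opnorm_comp S A; have := opnorm_comp A S.
  by rewrite Normc.normc1 mul1r SM; lra.
move=> a A PA; pose Z : bop L L := a *: S - cj a *: N.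
have ZE x : Z x = a *: S x - cj a *: N x by [].
have Zskew x y : inner (Z x) y = - inner x (Z y).
  rewrite !ZE innerBl innerBr !innerZl !innerZr conjCK NS (is_adjointC NS).
  by rewrite opprB.
have expand (e : bop L L) : (forall x y, inner (e x) y = - inner x (e y)) ->
    forall x, hnorm x <= hnorm ((bop1 L + e) x).
  move=> eskew x; rewrite -[leLHS]mul1r -[leRHS]mul1r.
  rewrite -(@ler_pXn2r _ 2)// ?nnegrE ?mul1r ?hnorm_ge0// !sqr_hnorm bop_addE /=.
  rewrite hnsqD; have : Re (inner x (e x)) = 0.
    have := congr1 (@complex.Re R) (eskew x x); rewrite ReN Re_innerC; lra.
  by move=> ->; rewrite mulr0 addr0 lerDl hnsq_ge0.
have Zle : opnorm Z <= 2 * normc a * M.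
  rewrite (le_trans (opnormD _ _))// -scaleNr !opnormZ normcN normc_conj SM.
  by rewrite -/M; lra.
have [A' AA'] := adjoint_exists A.
pose X := bop_comp A (bop1 L - Z); pose X' := bop_comp (bop1 L + Z) A'.
have XX' : is_adjoint X X'.
  move=> x y; rewrite -[X x]/(A (x - Z x)) AA' innerBl Zskew opprK -innerDr.
  by [].
(* The factor 1 - Z stands on the right; passing to adjoints turns it into 1 + Z on the left, where
   it visibly does not shrink norms. *)
have AX : opnorm A <= opnorm X.
  rewrite -(opnorm_adjoint AA') -(opnorm_adjoint XX').
  exact/opnorm_expand/expand.
have XY : opnorm X <= opnorm (bop_comp (bop1 L + Z) X) by exact/opnorm_expand/expand.
have XE : bop_comp (bop1 L + Z) X = (A + a *: D A) - bop_comp Z (bop_comp A Z).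
  apply: bopP => x; rewrite -[LHS]/(A (x - Z x) + Z (A (x - Z x))).
  rewrite -[RHS]/(A x + a *: (S (A x) - A (S x)) - Z (A (Z x))) (linearB A) (linearB Z) scalerBr.
  rewrite addrA; congr (_ - _); rewrite -addrA; congr (_ + _).
  rewrite !ZE (linearB A) !(linearZ_LR A) /= (PE A)//.
  by rewrite opprB addrC addrA subrK.
rewrite mulrBl mul1r lerBlDr (le_trans AX)// (le_trans XY)// XE.
rewrite (le_trans (opnormD _ _))// lerD2l -scaleN1r opnormZ normcN Normc.normc1 mul1r.
rewrite (le_trans (opnorm_comp _ _))//.
have AZ := opnorm_comp A Z; have Z0 := opnorm_ge0 Z; have A0 := opnorm_ge0 A.
apply: (@le_trans _ _ (opnorm Z * (opnorm A * opnorm Z))).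
  by rewrite ler_wpM2l.
rewrite mulrCA mulrC ler_wpM2r//.
have -> : (2 * M) ^+ 2 * normc a ^+ 2 = (2 * normc a * M) * (2 * normc a * M) by ring.
by rewrite ler_pM.
Qed.

End Fuglede.

(** * Necessity of the dual inequality *)

Section FormPositivity.
Variable R : realType.

Definition form_pos n (B : 'I_n -> 'I_n -> R[i]) := forall u : 'I_n -> R[i],
  0 <= Re (\sum_a \sum_b B a b * (u a * cj (u b))).

(** Expanding the [xi a] in an orthonormal family writes their Gram matrix as a sum of rank one
    matrices, and [form_pos] applies to each of them. *)
Lemma gram_form_pos (E : lmodType R[i])
    (ip : {hermitian E for false & (@Num.conj R[i])}) n
    (B : 'I_n -> 'I_n -> R[i]) (xi : 'I_n -> E) :
  (forall x, 0 <= ip x x) -> form_pos B ->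
  0 <= Re (\sum_a \sum_b B a b * ip (xi a) (xi b)).
Proof.
move=> ip_ge0 Bpos.
have [r [f [fo fs]]] := orthonormalize ip_ge0 (codom xi).
have ipE a b : ip (xi a) (xi b) = \sum_(j < r) ip (xi a) (f j) * cj (ip (xi b) (f j)).
  have := nsq0_ip ip_ge0 (xi b) (fs _ (codom_f xi a)).
  rewrite ipBl => /subr0_eq ->; rewrite ip_suml; apply: eq_bigr => j _.
  by rewrite ipZl [ip (f j) _]ipC.
under eq_bigr => a _ do under eq_bigr => b _ do rewrite ipE mulr_sumr.
under eq_bigr => a _ do rewrite exchange_big.
by rewrite exchange_big /= Re_sum sumr_ge0// => j _.
Qed.

End FormPositivity.

Section Amplification.
Variables (R : realType) (L : hilbertType R) (n : nat).
Implicit Types (xi eta : 'I_n -> L) (X : bop L L).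

(** The space L^n enters only through this form; no norm or completeness is put on it. *)
Definition ampip xi eta : R[i] := \sum_a inner (xi a) (eta a).

Lemma ampip_linearl eta : GRing.linear_for *%R (ampip^~ eta).
Proof.
move=> c x y; rewrite /ampip /= mulr_sumr -big_split; apply: eq_bigr => a _ /=.
by rewrite -innerZl -innerDl.
Qed.

Lemma ampip_linearr xi : GRing.linear_for (Num.conj \; *%R) (ampip xi).
Proof.
move=> c x y; rewrite /ampip /= mulr_sumr -big_split; apply: eq_bigr => a _ /=.
by rewrite -innerZr -innerDr.
Qed.

HB.instance Definition _ := bilinear_isBilinear.Build R[i] ('I_n -> L)
  ('I_n -> L) R[i] *%R (Num.conj \; *%R) ampip (ampip_linearl, ampip_linearr).

Lemma ampip_hermitian xi eta : ampip xi eta = (-1) ^+ false * cj (ampip eta xi).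
Proof.
rewrite expr0 mul1r /ampip rmorph_sum /=; apply: eq_bigr => a _.
by rewrite innerC.
Qed.

HB.instance Definition _ := isHermitianSesquilinear.Build _ _ _ _ ampip
  ampip_hermitian.

Lemma ampip_ge0 xi : 0 <= ampip xi xi.
Proof. by rewrite sumr_ge0// => a _; exact: inner_ge0. Qed.

Lemma ampnsqE xi : nsq ampip xi = \sum_a hnsq (xi a).
Proof. by rewrite /nsq /ampip Re_sum. Qed.

Definition amp X xi : 'I_n -> L := fun a => X (xi a).

(** The sum runs over the first index, so that [ampip (mact B xi) xi] is the form of [B] at [xi] in
    the convention of [form_pos]. *)
Definition mact (B : 'I_n -> 'I_n -> R[i]) xi : 'I_n -> L :=
  fun b => \sum_a B a b *: xi a.

Lemma amp_linear X : linear (amp X).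
Proof. by move=> c x y; apply/funext => a; exact: bop_linear. Qed.

Lemma mact_linear B : linear (mact B).
Proof.
move=> c x y; apply/funext => b; rewrite /mact.
rewrite -[RHS]/(c *: (\sum_a B a b *: x a) + \sum_a B a b *: y a).
rewrite scaler_sumr -big_split; apply: eq_bigr => a _ /=.
by rewrite -[(c *: x + y) a]/(c *: x a + y a) scalerDr !scalerA mulrC.
Qed.

Lemma mactB B xi eta : mact B (xi - eta) = mact B xi - mact B eta.
Proof. exact: (linear_funB (mact_linear B)). Qed.

Lemma amp_bounded X : exists c, nsq_bounded ampip c (amp X).
Proof.
have [c _ Xc] := bop_hnsq X; exists c => xi; rewrite !ampnsqE mulr_sumr.
by apply: ler_sum => a _; exact: Xc.
Qed.

Lemma mact_bounded B : exists2 c, 0 <= c & nsq_bounded ampip c (mact B).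
Proof.
pose m : R := \sum_a \sum_b normc (B a b) ^+ 2.
have m0 : 0 <= m by rewrite sumr_ge0// => a _; rewrite sumr_ge0// => b _; exact: sqr_ge0.
exists (n%:R * (2 ^+ #|'I_n| * m)).
  by rewrite mulr_ge0// mulr_ge0// exprn_ge0.
move=> xi; rewrite ampnsqE -mulrA mulr_natl.
have -> t : t *+ n = \sum_(b < n) t :> R by rewrite sumr_const card_ord.
apply: ler_sum => b _; rewrite (le_trans (nsq_sum_le (@inner_ge0 _ _) _))//.
rewrite -mulrA ler_wpM2l ?exprn_ge0// ampnsqE mulr_sumr; apply: ler_sum => a _.
rewrite nsqZ ler_wpM2r ?hnsq_ge0// /m (bigD1 a)//= (bigD1 b)//= -addrA lerDl.
rewrite addr_ge0// sumr_ge0// => j _; first exact: sqr_ge0.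
by rewrite sumr_ge0// => k _; exact: sqr_ge0.
Qed.

Lemma amp_mact X B xi : amp X (mact B xi) = mact B (amp X xi).
Proof.
apply/funext => b; rewrite /amp /mact linear_sum; apply: eq_bigr => a _.
by rewrite linearZ.
Qed.

Lemma amp_adjoint X X' xi eta : is_adjoint X X' ->
  ampip (amp X xi) eta = ampip xi (amp X' eta).
Proof. by move=> XX'; apply: eq_bigr => a _; exact: XX'. Qed.

Definition adjmx (B : 'I_n -> 'I_n -> R[i]) a b := cj (B b a).

Lemma ip_mact B xi eta :
  ampip (mact B xi) eta = \sum_a \sum_b B a b * inner (xi a) (eta b).
Proof.
rewrite exchange_big; apply: eq_bigr => b _; rewrite inner_suml.
by apply: eq_bigr => a _; rewrite innerZl.
Qed.

Lemma mact_adjoint B xi eta :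
  ampip (mact B xi) eta = ampip xi (mact (adjmx B) eta).
Proof.
rewrite ip_mact; apply: eq_bigr => a _; rewrite inner_sumr.
by apply: eq_bigr => b _; rewrite innerZr conjCK.
Qed.

End Amplification.

(** [None] will index the constant term: with the identity operator and the scalar 1 attached to it,
    the affine pencil A_0 + sum_i z_i A_i becomes a linear one. *)
Lemma sum_option (V : nmodType) (I : finType) (F : option I -> V) :
  \sum_j F j = F None + \sum_i F (Some i).
Proof.
rewrite (bigD1 None)//=; congr (_ + _).
rewrite (reindex_omap Some id); last by case.
by apply: eq_bigl => i; rewrite eqxx.
Qed.

Lemma quarter_le (R : realType) (a b m e : R) :
  m <= 2 * (a + b) -> a <= e -> b <= e -> 2^-1 ^+ 2 * m <= e.
Proof. lra. Qed.

Lemma half_frac_lt1 (R : realType) (D : R) : 0 <= D -> D * (2 * (D + 1))^-1 < 1.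
Proof. by move=> D0; rewrite ltr_pdivrMr; lra. Qed.

Lemma scale_comb (A : pzRingType) (V : lmodType A) (k l c m : A) (u v x : V) :
  k *: ((u - l *: x) + c *: (v - m *: x)) =
  k *: (u + c *: v) - (k * (l + c * m)) *: x.
Proof.
by rewrite [c *: (_ - _)]scalerBr addrACA -opprD scalerA -scalerDl scalerBr scalerA.
Qed.

(** Here [- s] is the bottom of a form and [C] bounds the effect of replacing operators by
    approximate eigenvalues; the tolerance s^2 / (4 (1 + C)) is chosen so that the total error is
    half of s^2. *)
Lemma small_shift_absurd (R : realType) (s C : R) : 0 < s -> 0 <= C ->
  s ^+ 2 <= 2 * (s ^+ 2 / (4 * (1 + C)) + C * (s ^+ 2 / (4 * (1 + C)))) -> False.
Proof.
move=> s0 C0; have -> : 2 * (s ^+ 2 / (4 * (1 + C)) + C * (s ^+ 2 / (4 * (1 + C)))) =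
  s ^+ 2 / 2 by field; rewrite gt_eqF// ltr_wpDr.
have : 0 < s ^+ 2 by rewrite exprn_gt0.
lra.
Qed.

Section JointPositivity.
Variables (R : realType) (L : hilbertType R) (I : finType).

(** The definition gives commutation of [N i] with [N j] and with its own adjoint; the mixed
    relation for distinct indices is Fuglede's theorem. *)
Lemma normal_tuple_commute (N S : I -> bop L L) : normal_tuple N ->
  (forall i, is_adjoint (N i) (S i)) ->
  [/\ forall i j x, N i (N j x) = N j (N i x),
      forall i j x, N i (S j x) = S j (N i x) &
      forall i j x, S i (S j x) = S j (S i x)].
Proof.
move=> [Nn Nc] NS.
have NN i j x : N i (N j x) = N j (N i x).
  by rewrite -[LHS]/(bop_comp (N i) (N j) x) Nc.
have NSc i j x : N i (S j x) = S j (N i x).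
  have [S' NS' NSC'] := Nn j.
  have SS' : S j = S'.
    by apply: bopP => y; apply: inner_inj => z; rewrite -NS -NS'.
  rewrite -[LHS]/(bop_comp (N i) (S j) x) (fuglede (NS j))//.
  by rewrite SS'.
split=> // i j x; apply: inner_inj => z.
by rewrite -!NS NN.
Qed.

Variables (n : nat) (N : I -> bop L L).
Hypothesis N_normal : normal_tuple N.
Local Notation ip := ((@ampip R L n) : {hermitian ('I_n -> L) for false & (@Num.conj R[i])}).

(* An approximate joint eigenvector of N at the point z shows that z is in the
   joint spectrum; if the form were negative somewhere, one could be found near
   the bottom of the spectrum of the amplified form. *)
Lemma joint_positivity (K : set (I -> R[i])) (A0 : 'I_n -> 'I_n -> R[i])
    (A : I -> 'I_n -> 'I_n -> R[i]) (xi : 'I_n -> L) :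
  joint_spectrum N `<=` K ->
  (forall z, K z -> form_pos (fun a b => A0 a b + \sum_i z i * A i a b)) ->
  0 <= Re (\sum_a \sum_b A0 a b * inner (xi a) (xi b) +
           \sum_i \sum_a \sum_b A i a b * inner (N i (xi a)) (xi b)).
Proof.
move=> NK Apos; pose E := 'I_n -> L.
have ge0 : forall x, 0 <= ip x x := @ampip_ge0 R L n.
have [S NS] := choice (fun i => adjoint_exists (N i)).
have [NNc NSc SSc] := normal_tuple_commute N_normal NS.
pose N' (j : option I) := if j is Some i then N i else bop1 L.
pose S' (j : option I) := if j is Some i then S i else bop1 L.
pose A' (j : option I) := if j is Some i then A i else A0.
have N'S' j : is_adjoint (N' j) (S' j) by case: j => //= i; exact: NS.
(* The amplified pencil, its adjoint, and their sum [G], a selfadjoint operator whose form is twice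
   the real number to be bounded below. *)
pose Hop (x : E) : E := \sum_j mact (A' j) (amp (N' j) x).
pose Had (x : E) : E := \sum_j mact (adjmx (A' j)) (amp (S' j) x).
pose G (x : E) : E := Hop x + Had x.
have HopE x y : ip (Hop x) y = ip x (Had y).
  rewrite /Hop /Had ip_suml ip_sumr; apply: eq_bigr => j _.
  apply: etrans (mact_adjoint _ _ _) _; apply: etrans (amp_adjoint _ _ (N'S' j)) _.
  by rewrite amp_mact.
have lsum (T : option I -> bop L L) (B : option I -> 'I_n -> 'I_n -> R[i]) :
    linear (fun x : E => \sum_j mact (B j) (amp (T j) x)).
  move=> c x y; rewrite scaler_sumr -big_split; apply: eq_bigr => j _ /=.
  by rewrite amp_linear mact_linear.
have lG : linear G.
  move=> c x y; rewrite /G /Hop lsum /Had lsum scalerDr.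
  by rewrite addrACA.
have Gsa : selfadjoint ip G.
  move=> x y; rewrite ipDl ipDr HopE addrC; congr (_ + _).
  by rewrite ipC -HopE -ipC.
have mb (T : bop L L) B : exists c, 0 <= c /\
    forall x : E, nsq ip (mact B (amp T x)) <= c * nsq ip x.
  have [c c0 Bc] := mact_bounded L B; have [d Td] := amp_bounded n T.
  exists (c * `|d|); split=> [|x]; first by rewrite mulr_ge0.
  rewrite (le_trans (Bc _))// -mulrA ler_wpM2l// (le_trans (Td _))//.
  by rewrite ler_wpM2r ?nsq_ge0// ler_norm.
have sb (T : option I -> bop L L) (B : option I -> 'I_n -> 'I_n -> R[i]) :
    exists2 c, 0 <= c & forall x : E,
      nsq ip (\sum_j mact (B j) (amp (T j) x)) <= c * nsq ip x.
  have [c cP] := choice (fun j => mb (T j) (B j)).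
  exists (2 ^+ #|{: option I}| * \sum_j c j).
    rewrite mulr_ge0 ?exprn_ge0// sumr_ge0// => j _.
    by case: (cP j).
  move=> x; rewrite (le_trans (nsq_sum_le ge0 _))// -mulrA ler_wpM2l ?exprn_ge0//.
  by rewrite mulr_suml ler_sum// => j _; have [_] := cP j; apply.
have [cH cH0 Hb] := sb N' A'; have [cS cS0 Sb] := sb S' (fun j => adjmx (A' j)).
have Gb : nsq_bounded ip (2 * (cH + cS)) G.
  move=> x; rewrite (le_trans (nsqD_le ge0 _ _))// -mulrA ler_pM2l//.
  by rewrite mulrDl; apply: lerD; [exact: Hb|exact: Sb].
have formE x : Re (ip (G x) x) = 2 * Re (ip (Hop x) x).
  by rewrite ipDl ReD [ip (Had x) x]ipC -HopE Re_conj; ring.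
have HopxiE x : ip (Hop x) x = \sum_a \sum_b A0 a b * inner (x a) (x b) +
    \sum_i \sum_a \sum_b A i a b * inner (N i (x a)) (x b).
  rewrite /Hop ip_suml sum_option; congr (_ + _); first exact: ip_mact.
  by apply: eq_bigr => i _; exact: ip_mact.
rewrite -HopxiE leNgt; apply/negP => xi0.
have [|s s0 Gs] := approx_null_bottom ge0 lG Gsa Gb.
  by exists xi; rewrite formE pmulr_rlt0.
(* Twice the real and twice the imaginary part of each [N i]; they commute with one another and,
   after amplification, with [G]. *)
pose P (k : I * bool) : bop L L :=
  if k.2 then N k.1 + S k.1 else (- 'i%C) *: (N k.1 - S k.1).
have PtE i x : P (i, true) x = N i x + S i x by [].
have PfE i x : P (i, false) x = (- 'i%C) *: (N i x - S i x) by [].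
have cji : cj ('i%C : R[i]) = - 'i%C by apply: complexP; rewrite /= ?oppr0.
have Psa k : is_adjoint (P k) (P k).
  have SN i := is_adjointC (NS i).
  case: k => i [] x y; first by rewrite !PtE innerDl innerDr NS SN addrC.
  rewrite !PfE innerZl innerZr innerBl innerBr NS SN cjN cji.
  by rewrite opprK mulNr -mulrN opprB.
have Pcomm (T : bop L L) k : (forall x, T (N k.1 x) = N k.1 (T x)) ->
    (forall x, T (S k.1 x) = S k.1 (T x)) -> forall x, T (P k x) = P k (T x).
  case: k => i b TN TS x.
  have {}TN y : T (N i y) = N i (T y) := TN y.
  have {}TS y : T (S i y) = S i (T y) := TS y.
  case: b; first by rewrite !PtE (linearD T) /= TN TS.
  by rewrite !PfE (linearZ_LR T) /= (linearB T) /= TN TS.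
have PN k i x : P k (N i x) = N i (P k x) by rewrite Pcomm.
have PS k i x : P k (S i x) = S i (P k x) by rewrite Pcomm.
have PP k k' x : P k (P k' x) = P k' (P k x) by rewrite Pcomm.
have PG k x : G (amp (P k) x) = amp (P k) (G x).
  have comm (T : option I -> bop L L) (B : option I -> 'I_n -> 'I_n -> R[i]) :
      (forall j x, P k (T j x) = T j (P k x)) ->
      \sum_j mact (B j) (amp (T j) (amp (P k) x)) =
      amp (P k) (\sum_j mact (B j) (amp (T j) x)).
    move=> PT; rewrite (big_morph _ (linear_funD (amp_linear (P k)))
      (linear_fun0 (amp_linear (P k)))); apply: eq_bigr => j _.
    by rewrite amp_mact; congr mact; apply/funext => a; rewrite /amp PT.
  rewrite /G (linear_funD (amp_linear (P k))) /Hop /Had !comm//.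
  - by case=> [i|] y //=; exact: PS.
  - by case=> [i|] y //=; exact: PN.
(* The search starts among approximate eigenvectors of [G] at [- s] and refines them to joint ones
   for all the [P k]. *)
have [] := @joint_approx_null R _ ip ge0 _ (enum {: I * bool})
    [set fun x => G x + s%:C *: x] (fun k => amp (P k)).
- by move=> f ->  c x y; rewrite lG !scalerDr !scalerA [s%:C * c]mulrC addrACA.
- by move=> k; exact: amp_linear.
- by move=> k x y; exact: amp_adjoint.
- by move=> k; exact: amp_bounded.
- move=> k f -> x; rewrite PG; apply/funext => a.
  by rewrite -[RHS]/(P k (G x a + s%:C *: x a)) linearD linearZ.
- by move=> k k' x; apply/funext => a; rewrite /amp PP.
- exact: Gs.
move=> l lP; pose z i : R[i] := (2^-1)%:C * ((l (i, true))%:C + 'i%C * (l (i, false))%:C).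
have two : (2^-1)%:C + (2^-1)%:C = 1 :> R[i].
  by rewrite -[LHS](rmorphD (real_complex R)) -div1r -splitr.
have ii : 'i%C * - 'i%C = 1 :> R[i] by rewrite mulrN -expr2 sqr_i opprK.
have approx (e : R) : 0 < e -> exists x : E, [/\ nsq ip x = 1,
    nsq ip (G x + s%:C *: x) <= e,
    forall i, nsq ip (amp (N i) x - z i *: x) <= e &
    forall i, nsq ip (amp (S i) x - cj (z i) *: x) <= e].
  move=> /lP[x [x1 xe]]; exists x.
  have w k : nsq ip (amp (P k) x - (l k)%:C *: x) <= e.
    by apply: (xe (fun x => amp (P k) x - (l k)%:C *: x)); right; exists k; rewrite ?mem_enum.
  (* The choice [c = 'i%C] recombines the two parts into [N i], and [c = - 'i%C] into its
     adjoint. *)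
  have half (c : R[i]) i : normc c = 1 ->
      nsq ip ((2^-1)%:C *: ((amp (P (i, true)) x - (l (i, true))%:C *: x) +
      c *: (amp (P (i, false)) x - (l (i, false))%:C *: x))) <= e.
    move=> c1; rewrite nsqZr; apply: quarter_le (nsqD_le ge0 _ _) (w (i, true)) _.
    by rewrite nsqZ c1 expr1n mul1r; exact: w.
  have halfE (c : R[i]) i : (2^-1)%:C *: ((amp (P (i, true)) x - (l (i, true))%:C *: x) +
      c *: (amp (P (i, false)) x - (l (i, false))%:C *: x)) =
    (fun a => (2^-1)%:C *: (P (i, true) (x a) + c *: P (i, false) (x a))) -
    ((2^-1)%:C * ((l (i, true))%:C + c * (l (i, false))%:C)) *: x.
    apply/funext => a; rewrite !fctE /amp.
    exact: scale_comb.
  split=> //.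
  - exact: (xe (fun x => G x + s%:C *: x) (or_introl erefl)).
  - move=> i; have := half _ i (normc_i R); rewrite halfE.
    congr (_ <= _); congr (nsq _ (_ - _)); apply/funext => a.
    rewrite PtE PfE scalerA ii scale1r addrACA addrN addr0 scalerDr.
    by rewrite -scalerDl two scale1r.
  - move=> i; have := half (- 'i%C) i; rewrite normcN => /(_ (normc_i R)); rewrite halfE.
    congr (_ <= _); congr (nsq _ (_ - _)).
      apply/funext => a; rewrite PtE PfE scalerA mulrNN -expr2 sqr_i scaleN1r.
      rewrite opprB addrCA [N i _ + _]addrC addrK scalerDr.
      by rewrite -scalerDl two scale1r.
    by rewrite /z cjM cjD cjM cji !conj_real.
(* If [z] were outside the joint spectrum, applying 1 = sum_i B_i (N_i - z_i) to a good enough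
   approximate eigenvector would make its norm smaller than 1. *)
have Kz : K z.
  apply: NK => -[B _ BE].
  have [c cP] := choice (fun i => amp_bounded n (B i)).
  pose D := 2 ^+ #|I| * \sum_i `|c i|.
  have D0 : 0 <= D by rewrite mulr_ge0 ?exprn_ge0// sumr_ge0.
  have [|x [x1 _ xN _]] := approx (2 * (D + 1))^-1.
    by rewrite invr_gt0 mulr_gt0// ltr_wpDl.
  have xE : x = \sum_i amp (B i) (amp (N i) x - z i *: x).
    apply/funext => a; have := congr1 (fun T : bop L L => T (x a)) BE.
    rewrite bop_sumE /= => <-; rewrite fct_sumE; apply: eq_bigr => i _.
    by [].
  have : nsq ip x <= D * (2 * (D + 1))^-1.
    rewrite {1}xE (le_trans (nsq_sum_le ge0 _))// /D -mulrA ler_wpM2l ?exprn_ge0//.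
    rewrite mulr_suml ler_sum// => i _; rewrite (le_trans (cP i _))//.
    rewrite (@le_trans _ _ (`|c i| * nsq ip (amp (N i) x - z i *: x)))//.
      by rewrite ler_wpM2r ?nsq_ge0// ler_norm.
    by rewrite ler_wpM2l.
  by rewrite x1 leNgt half_frac_lt1.
pose z' (j : option I) := if j is Some i then z i else 1.
pose B a b := A0 a b + \sum_i z i * A i a b.
have BE : B = fun a b => \sum_j z' j * A' j a b.
  by apply/funext => a; apply/funext => b; rewrite sum_option /= mul1r.
have [cA cAP] := choice (fun j =>
  (fun '(ex_intro2 c _ cP) => ex_intro _ c cP) (mact_bounded L (A' j))).
have [cB cBP] := choice (fun j =>
  (fun '(ex_intro2 c _ cP) => ex_intro _ c cP) (mact_bounded L (adjmx (A' j)))).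
pose CA : R := 2 ^+ #|{: option I}| * \sum_j `|cA j|.
pose CB : R := 2 ^+ #|{: option I}| * \sum_j `|cB j|.
have CA0 : 0 <= CA by rewrite mulr_ge0 ?exprn_ge0// sumr_ge0.
have CB0 : 0 <= CB by rewrite mulr_ge0 ?exprn_ge0// sumr_ge0.
pose C := 2 * (CA + CB).
have C0 : 0 <= C by rewrite mulr_ge0// addr_ge0.
(* [G] with each [N i] replaced by the scalar [z i]. Its form is nonnegative by hypothesis, and it
   is close to [G] on the approximate eigenvectors, where [G] acts nearly as [- s]. *)
pose Gz (x : E) : E := mact B x + mact (adjmx B) x.
have BxE (x : E) : mact B x = \sum_j mact (A' j) (z' j *: x).
  rewrite BE; apply/funext => b; rewrite fct_sumE exchange_big.
  apply: eq_bigr => a _; rewrite scaler_suml; apply: eq_bigr => j _.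
  by rewrite mulrC -scalerA.
have BdE (x : E) : mact (adjmx B) x = \sum_j mact (adjmx (A' j)) (cj (z' j) *: x).
  rewrite BE; apply/funext => b; rewrite fct_sumE exchange_big.
  apply: eq_bigr => a _; rewrite /adjmx rmorph_sum scaler_suml.
  by apply: eq_bigr => j _ /=; rewrite rmorphM /= mulrC -scalerA.
have GzE (x : E) : G x - Gz x =
    \sum_j mact (A' j) (amp (N' j) x - z' j *: x) +
    \sum_j mact (adjmx (A' j)) (amp (S' j) x - cj (z' j) *: x).
  have sub4 (a b c e : E) : (a + b) - (c + e) = (a - c) + (b - e).
    by rewrite opprD addrACA.
  rewrite [Gz x](congr2 +%R (BxE x) (BdE x)).
  rewrite [LHS]sub4; congr (_ + _); rewrite -[LHS]sumrB; apply: eq_bigr => j _;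
  by rewrite [RHS]mactB.
have e0 : 0 < s ^+ 2 / (4 * (1 + C)).
  by rewrite divr_gt0 ?exprn_gt0// mulr_gt0// ltr_wpDr.
have [x [x1 xG xN xS]] := approx _ e0.
set e := s ^+ 2 / _ in e0 xG xN xS.
have close (T : option I -> bop L L) (y : option I -> R[i])
    (M : option I -> 'I_n -> 'I_n -> R[i]) (c : option I -> R) :
    (forall j, nsq_bounded ip (c j) (mact (M j))) ->
    (forall j, nsq ip (amp (T j) x - y j *: x) <= e) ->
    nsq ip (\sum_j mact (M j) (amp (T j) x - y j *: x)) <=
      2 ^+ #|{: option I}| * (\sum_j `|c j|) * e.
  move=> Mc Te; rewrite (le_trans (nsq_sum_le ge0 _))// -mulrA ler_wpM2l ?exprn_ge0//.
  rewrite mulr_suml ler_sum// => j _; rewrite (le_trans (Mc j _))//.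
  rewrite (@le_trans _ _ (`|c j| * nsq ip (amp (T j) x - y j *: x)))//.
    by rewrite ler_wpM2r ?nsq_ge0// ler_norm.
  by rewrite ler_wpM2l.
have xx : nsq ip (amp (bop1 L) x - 1 *: x) <= e.
  by rewrite scale1r [amp _ _](_ : _ = x)// subrr nsq0 ltW.
have NA : nsq ip (\sum_j mact (A' j) (amp (N' j) x - z' j *: x)) <= CA * e.
  by apply: close => // -[i|]; [exact: xN|exact: xx].
have SA : nsq ip (\sum_j mact (adjmx (A' j)) (amp (S' j) x - cj (z' j) *: x)) <= CB * e.
  apply: close => // -[i|]; first exact: xS.
  by rewrite /= rmorph1.
have Gze : nsq ip (G x - Gz x) <= C * e.
  rewrite GzE (le_trans (nsqD_le ge0 _ _))// -mulrA ler_pM2l// mulrDl.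
  by apply: lerD.
have Gzpos : 0 <= Re (ip (Gz x) x).
  rewrite ipDl ReD [ip (mact (adjmx B) x) x]ipC.
  rewrite -[ip x (mact (adjmx B) x)](mact_adjoint B x x) Re_conj.
  have : 0 <= Re (ip (mact B x) x).
    apply: le_trans (gram_form_pos x (@inner_ge0 R L) (Apos z Kz)) _.
    by rewrite [ip _ _]ip_mact.
  by move=> h; rewrite addr_ge0.
have low : s ^+ 2 <= nsq ip (Gz x + s%:C *: x).
  rewrite nsqD nsqZr x1 mulr1 ipZr conj_real Re_realM.
  rewrite addrAC lerDr addr_ge0 ?nsq_ge0// mulr_ge0// mulr_ge0//.
  exact: ltW.
have high : nsq ip (Gz x + s%:C *: x) <= 2 * (e + C * e).
  have -> : Gz x + s%:C *: x = (G x + s%:C *: x) - (G x - Gz x).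
    by rewrite opprB [RHS]addrC; apply: esym; exact: subrKA.
  rewrite (le_trans (nsqB_le ge0 _ _))// ler_pM2l//.
  by apply: lerD.
exact: (small_shift_absurd s0 C0 (le_trans low high)).
Qed.

End JointPositivity.

Section DualInequality.
Variable R : realType.

(* The inequalities satisfied by every compression of a normal tuple with joint
   spectrum in K; y i a b stands for <X_i e_a, e_b>. *)
Definition dual_ineq (I : finType) n (K : set (I -> R[i]))
    (y : I -> 'I_n -> 'I_n -> R[i]) :=
  forall (A0 : 'I_n -> 'I_n -> R[i]) (A : I -> 'I_n -> 'I_n -> R[i]),
    (forall z, K z -> form_pos (fun a b => A0 a b + \sum_i z i * A i a b)) ->
    0 <= Re (\sum_a A0 a a + \sum_i \sum_a \sum_b A i a b * y i a b).

Lemma isometry_inner (H K : hilbertType R) (V : bop H K) x y :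
  op_isometry V -> inner (V x) (V y) = inner x y.
Proof.
move=> Viso; have Vn z : hnsq (V z) = hnsq z.
  have := Viso z; rewrite !normE => /(@complexI R) h.
  by rewrite -!sqr_hnorm h.
have ReV u v : Re (inner (V u) (V v)) = Re (inner u v).
  have := Vn (u + v); rewrite linearD /= !hnsqD !Vn => /addrI h.
  by apply: (mulfI (_ : 2 != 0 :> R)).
apply: complexP; first exact: ReV.
have := ReV ('i%C *: x) y; rewrite linearZ /= !innerZl !ReM /=.
by rewrite !mul0r !mul1r !sub0r => /oppr_inj.
Qed.

Definition evec n (a : 'I_n) : euclid R n := delta_mx a 0.

Lemma inner_evec n (a b : 'I_n) : inner (evec a) (evec b) = (a == b)%:R.
Proof.
rewrite [LHS]/(cdot _ _) /cdot (bigD1 a)//= big1 ?addr0 => [|k ka].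
  by rewrite !mxE !eqxx /= andbT mul1r rmorph_nat.
by rewrite !mxE (negbTE ka) /= mul0r.
Qed.

Lemma inner_evecr n (u : euclid R n) (b : 'I_n) : inner u (evec b) = u b 0.
Proof.
rewrite [LHS]/(cdot _ _) /cdot (bigD1 b)//= big1 ?addr0 => [|k kb].
  by rewrite !mxE !eqxx /= rmorph1 mulr1.
by rewrite !mxE (negbTE kb) /= rmorph0 mulr0.
Qed.

Lemma mxop_evec n (M : 'M[R[i]]_n) a b : inner (mxop M (evec a)) (evec b) = M b a.
Proof.
rewrite inner_evecr mxE (bigD1 a)//= big1 ?addr0 => [|k ka].
  by rewrite mxE !eqxx /= mulr1.
by rewrite mxE (negbTE ka) /= mulr0.
Qed.

(** [joint_positivity] is evaluated at the vectors [V (evec a)]; their orthonormality reduces the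
    constant term to the trace of [A0]. *)
Lemma Wmin_dual (I : finType) (K : set (I -> R[i])) (X : mxtuple R I) :
  Wmin K X -> dual_ineq K (fun i a b => tagged X i b a).
Proof.
move=> [L [N [Nn [V [W [Viso VW XE]]] NK]]] A0 A Apos.
have := joint_positivity Nn (fun a => V (evec a)) NK Apos.
congr (0 <= Re (_ + _)).
  apply: eq_bigr => a _; rewrite (bigD1 a)//= big1 ?addr0.
    by rewrite (isometry_inner _ _ Viso) inner_evec eqxx mulr1.
  move=> b ba; rewrite (isometry_inner _ _ Viso) inner_evec eq_sym.
  by rewrite (negbTE ba) mulr0.
apply: eq_bigr => i _; apply: eq_bigr => a _; apply: eq_bigr => b _.
rewrite -(is_adjointC VW); congr (_ * _); have := congr1 (fun T : bop (euclid R _) (euclid R _) =>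
  inner (T (evec a)) (evec b)) (XE i).
by rewrite /mxtuple_op mxop_evec.
Qed.

End DualInequality.

(** * Sufficiency of the dual inequality: separation and diagonal dilations *)

Section UltrafilterLimits.
Variables (R : realType) (T : Type) (U : set_system T).
Hypothesis UU : UltraFilter U.
Implicit Types (f g : T -> R[i]) (c d : R[i]).

Definition is_ulim f c := forall e : R, 0 < e -> U [set t | normc (f t - c) < e].

(** The limit is the supremum of the [a] with [a <= f t] for [U]-almost all [t]; the upper estimate
    uses that [U] contains a set or its complement. *)
Lemma ultra_real_lim (f : T -> R) (M : R) : (forall t, `|f t| <= M) ->
  exists c : R, forall e : R, 0 < e -> U [set t | `|f t - c| < e].
Proof.
move=> fM; pose A := [set a | U [set t | a <= f t]].
have A0 : A (- M).
  by apply: filterS filterT => t _ /=; have := fM t; rewrite ler_norml => /andP[].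
have AM : ubound A M.
  move=> a /filter_ex[t /= at_]; rewrite (le_trans at_)//.
  by have := fM t; rewrite ler_norml => /andP[].
have Asup : has_sup A by split; [exists (- M)|exists M].
exists (sup A) => e e0.
have [a Aa ae] := sup_adherent e0 Asup.
have [h|h] := in_ultra_setVsetC [set t | sup A + e <= f t] UU.
  have := ub_le_sup (proj2 Asup) h; by rewrite leNgt ltrDl e0.
near=> t; rewrite /= ltr_distl; apply/andP; split.
  have : a <= f t by near: t.
  by apply: lt_le_trans.
by rewrite ltNge; apply/negP; near: t; exact: h.
Unshelve. all: by end_near. Qed.

Lemma is_ulim_exists f (M : R) : (forall t, normc (f t) <= M) -> exists c, is_ulim f c.
Proof.
move=> fM; have M0 (t : T) : 0 <= M by exact: le_trans (normc_ge0 _) (fM t).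
have ReIm t : Re (f t) ^+ 2 + Im (f t) ^+ 2 <= M ^+ 2.
  by rewrite -sqr_normc ler_pXn2r ?nnegrE ?normc_ge0 ?(M0 t).
have [|a aP] := @ultra_real_lim (fun t => Re (f t)) M.
  move=> t; rewrite -(@ler_pXn2r _ 2)// ?nnegrE ?(M0 t)// real_normK ?num_real//.
  by rewrite (le_trans _ (ReIm t))// lerDl sqr_ge0.
have [|b bP] := @ultra_real_lim (fun t => Im (f t)) M.
  move=> t; rewrite -(@ler_pXn2r _ 2)// ?nnegrE ?(M0 t)// real_normK ?num_real//.
  by rewrite (le_trans _ (ReIm t))// lerDr sqr_ge0.
exists (a +i* b) => e e0; have e2 : 0 < e / 2 by rewrite divr_gt0.
apply: filterS2 (aP _ e2) (bP _ e2) => t /= ta tb.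
have -> : f t - (a +i* b) = (Re (f t) - a)%:C + 'i%C * (Im (f t) - b)%:C.
  by case: (f t) => u v /=; simpc.
rewrite (le_lt_trans (normcD _ _))// Normc.normcM normc_i mul1r !normc_real.
by rewrite (splitr e) ltrD.
Qed.

Lemma is_ulim_unique f c d : is_ulim f c -> is_ulim f d -> c = d.
Proof.
move=> fc fd; apply/eqP; rewrite -subr_eq0; apply: contraT => cd.
have n0 : 0 < normc (c - d) / 2.
  rewrite divr_gt0// lt_def normc_ge0 andbT.
  by apply: contra cd => /eqP/Normc.eq0_normc ->.
have [t [/= tc td]] := @filter_ex _ U _ _ (filterI (fc _ n0) (fd _ n0)).
have : normc (c - d) < normc (c - d).
  rewrite -[X in normc X < _](subrKA (f t)) addrC [ltRHS]splitr.
  rewrite (le_lt_trans (normcD _ _))// ltrD//.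
  by rewrite -normcN opprB.
by rewrite ltxx.
Qed.

Lemma is_ulim_near f g c : U [set t | f t = g t] -> is_ulim f c -> is_ulim g c.
Proof. by move=> fg fc e /fc; apply: filterS2 fg => t /= <-. Qed.

Lemma is_ulim_cst c : is_ulim (fun=> c) c.
Proof. by move=> e e0; apply: filterS filterT => t _; rewrite /= subrr Normc.normc0. Qed.

Lemma is_ulimD f g c d : is_ulim f c -> is_ulim g d ->
  is_ulim (fun t => f t + g t) (c + d).
Proof.
move=> fc gd e e0; have e2 : 0 < e / 2 by rewrite divr_gt0.
apply: filterS2 (fc _ e2) (gd _ e2) => t /= tc td.
by rewrite opprD addrACA (le_lt_trans (normcD _ _))// (splitr e) ltrD.
Qed.

Lemma is_ulimM f g c d : is_ulim f c -> is_ulim g d ->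
  is_ulim (fun t => f t * g t) (c * d).
Proof.
move=> fc gd e e0; pose m : R := normc c + normc d + 1.
have m0 : 0 < m by rewrite ltr_wpDl// addr_ge0// normc_ge0.
pose e' := Num.min 1 (e / (2 * m)).
have e'0 : 0 < e' by rewrite lt_min ltr01 divr_gt0// mulr_gt0.
apply: filterS2 (fc _ e'0) (gd _ e'0) => t /= tc td.
have -> : f t * g t - c * d = (f t - c) * g t + c * (g t - d) by ring.
rewrite (le_lt_trans (normcD _ _))// !Normc.normcM.
have gm : normc (g t) <= normc d + 1.
  rewrite -[g t](subrK d) (le_trans (normcD _ _))// addrC lerD2l (le_trans (ltW td))//.
  by rewrite ge_min lexx.
have e'e : e' * m <= e / 2.
  by rewrite -ler_pdivlMr// -mulrA -invfM ge_min lexx orbT.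
apply: lt_le_trans (_ : e / 2 + e / 2 <= _); last by rewrite -splitr.
have h1 : normc (f t - c) * normc (g t) <= e' * (normc d + 1).
  by rewrite ler_pM ?normc_ge0// ltW.
have h2 : normc c * normc (g t - d) <= normc c * e'.
  by rewrite ler_wpM2l ?normc_ge0// ltW.
have : normc c * e' + e' * (normc d + 1) = e' * m by rewrite /m; ring.
have : 0 < e / 2 by rewrite divr_gt0.
lra.
Qed.

Lemma is_ulim_conj f c : is_ulim f c -> is_ulim (fun t => cj (f t)) (cj c).
Proof.
move=> fc e /fc; apply: filterS => t /=.
by rewrite -normc_conj -[cj _ - _](_ : cj (f t - c) = _)// cjD cjN.
Qed.

Lemma is_ulimZ f c a : is_ulim f c -> is_ulim (fun t => a * f t) (a * c).
Proof. by move=> fc; apply: is_ulimM => //; exact: is_ulim_cst. Qed.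

Lemma is_ulim_sum (I : Type) (r : seq I) (P : pred I) (F : I -> T -> R[i]) (l : I -> R[i]) :
  (forall i, P i -> is_ulim (F i) (l i)) ->
  is_ulim (fun t => \sum_(i <- r | P i) F i t) (\sum_(i <- r | P i) l i).
Proof.
move=> Fl; elim: r => [|i r IHr].
  by rewrite big_nil; under eq_fun do rewrite big_nil; exact: is_ulim_cst.
rewrite big_cons; under eq_fun do rewrite big_cons.
by case: ifP => // Pi; apply: is_ulimD => //; exact: Fl.
Qed.

Lemma is_ulim_le f c (a : R) : U [set t | Re (f t) <= a] -> is_ulim f c -> Re c <= a.
Proof.
move=> fa fc; apply/ler_addgt0Pl => e e0.
have [t [/= ta tc]] := @filter_ex _ U _ _ (filterI fa (fc _ e0)).
have := Re_le_normc (c - f t); rewrite -normcN opprB ReB.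
by move: ta tc; lra.
Qed.

Lemma is_ulim_ge f c (a : R) : U [set t | a <= Re (f t)] -> is_ulim f c -> a <= Re c.
Proof.
move=> fa /(is_ulimZ (-1)) fc; rewrite -lerN2 -ReN -mulN1r.
by apply: is_ulim_le fc; apply: filterS fa => t /=; rewrite mulN1r ReN lerN2.
Qed.

Lemma is_ulim_real f c : (forall t, Im (f t) = 0) -> is_ulim f c -> Im c = 0.
Proof.
move=> f0 fc; have : c = cj c.
  apply: (is_ulim_unique fc); have := is_ulim_conj fc.
  congr is_ulim; apply/funext => t; apply: complexP; rewrite ?Re_conj// Im_conj.
  by rewrite f0 oppr0.
by move/(congr1 (@complex.Im R)); rewrite Im_conj; lra.
Qed.

End UltrafilterLimits.

Lemma hnsq_segment (R : realType) (H : hilbertType R) (y c s : H) (t : R) :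
  hnsq (y - (c + t%:C *: (s - c))) =
  hnsq (y - c) + t * (t * hnsq (s - c)) - t * (2 * Re (inner (s - c) (y - c))).
Proof.
rewrite opprD addrA [LHS]hnsqD hnsqN hnsqZr innerNr innerZr conj_real ReN Re_realM.
by rewrite [Re (inner (y - c) _)]Re_innerC; ring.
Qed.

Section ConvexHulls.
Variables (R : realType) (q : nat).
Local Notation E := (euclid R q).
Implicit Types (S : set E) (y : E).

(** Weights and points are indexed by [nat], so that their number [p] can change without casts. It
    is kept explicit because compactness of the hull needs a bound on it. *)
Definition hull_upto p S y := exists (w : nat -> R) (s : nat -> E),
  [/\ forall j, 0 <= w j, \sum_(j < p) w j = 1, forall j, S (s j) &
      y = \sum_(j < p) (w j)%:C *: s j].

Lemma lin_dep p d (M : 'M[R]_(p, d)) : (d < p)%N ->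
  exists2 a : 'rV[R]_p, a != 0 & a *m M = 0.
Proof.
move=> dp; have kM : kermx M != 0.
  by rewrite kermx_eq0 /row_free neq_ltn (leq_ltn_trans (rank_leq_col M)).
have /rowV0Pn[a aM a0] := kM; exists a => //.
by apply/sub_kermxP.
Qed.

(** Caratheodory's reduction: C^q has real dimension q + q, and one more linear condition preserves
    the sum of the weights. *)
Lemma hull_reduce S p y : (q + q + 1 < p.+1)%N ->
  hull_upto p.+1 S y -> hull_upto p S y.
Proof.
move=> qp [w [s [w0 w1 Ss yE]]].
pose MRe : 'M[R]_(p.+1, q) := \matrix_(i, k) Re (s i k 0).
pose MIm : 'M[R]_(p.+1, q) := \matrix_(i, k) Im (s i k 0).
have [a a0] := lin_dep (row_mx (row_mx MRe MIm) (const_mx 1 : 'M[R]_(p.+1, 1))) qp.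
move/eqP; rewrite !mul_mx_row !row_mx_eq0 => /andP[/andP[/eqP aRe /eqP aIm] /eqP a1'].
have a1 : \sum_(i < p.+1) a 0 i = 0.
  have := congr1 (fun A : 'rV[R]_1 => A 0 0) a1'; rewrite !mxE.
  by under eq_bigr do rewrite mxE mulr1.
have as0 : \sum_(i < p.+1) (a 0 i)%:C *: s i = 0.
  apply/colP => k; rewrite summxE [RHS]mxE; apply: complexP.
    have := congr1 (fun A : 'rV[R]_q => A 0 k) aRe; rewrite !mxE Re_sum => h.
    by apply: etrans h; apply: eq_bigr => i _; rewrite !mxE Re_realM.
  have := congr1 (fun A : 'rV[R]_q => A 0 k) aIm; rewrite !mxE Im_sum => h.
  by apply: etrans h; apply: eq_bigr => i _; rewrite !mxE Im_realM.
have [j1 j1P] : exists j, 0 < a 0 j.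
  apply: contrapT => /forallNP na; move: a0 => /eqP; apply.
  have an j : a 0 j <= 0 by rewrite leNgt; apply/negP.
  apply/rowP => j; rewrite mxE; apply/eqP; rewrite -oppr_eq0.
  have /psumr_eq0P : forall i, true -> 0 <= - a 0 i by move=> i _; rewrite oppr_ge0.
  by rewrite sumrN a1 oppr0 => /(_ erefl j isT) ->.
(* The weights are moved along the dependence [a] until the first of them vanishes. *)
pose j0 := [arg min_(j < j1 | 0 < a 0 j) (w j / a 0 j)]%O.
have [aj0 wmin] : 0 < a 0 j0 /\ forall j, 0 < a 0 j -> w j0 / a 0 j0 <= w j / a 0 j.
  by rewrite /j0; case: arg_minP => // j aj jm; split.
pose t := w j0 / a 0 j0; have t0 : 0 <= t by rewrite divr_ge0// ltW.
pose a' (j : nat) : R := if insub j is Some i then a 0 i else 0.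
have a'E (i : 'I_p.+1) : a' i = a 0 i.
  by rewrite /a' valK.
(* The maximum makes nonnegativity immediate at every natural index; by [w'E] it is inactive on the
   indices summed. *)
pose w' j := Num.max 0 (w j - t * a' j).
have w'E (i : 'I_p.+1) : w' i = w i - t * a 0 i.
  rewrite /w' a'E max_r// subr_ge0; have [ai|ai] := ltP 0 (a 0 i).
    by rewrite -ler_pdivlMr// wmin.
  by rewrite (le_trans _ (w0 i))// mulr_ge0_le0.
have w'j0 : w' j0 = 0 by rewrite w'E /t divfK ?subrr// gt_eqF.
exists (fun j => w' (bump j0 j)), (fun j => s (bump j0 j)); split.
- by move=> j; rewrite /w' le_max lexx.
- have : \sum_(i < p.+1) w' i = 1.
    under eq_bigr do rewrite w'E.
    by rewrite sumrB w1 -mulr_sumr a1 mulr0 subr0.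
  by rewrite (bigD1_ord j0)//= w'j0 add0r.
- by [].
have : \sum_(i < p.+1) (w' i)%:C *: s i = y.
  transitivity (y - t%:C *: (\sum_(i < p.+1) (a 0 i)%:C *: s i)); last first.
    by rewrite as0 scaler0 subr0.
  rewrite yE scaler_sumr -sumrB; apply: eq_bigr => i _; rewrite w'E scalerA -scalerBl -realCM.
  by rewrite -[in RHS](rmorphB (real_complex R)).
by move=> <-; rewrite (bigD1_ord j0)//= w'j0 scale0r add0r.
Qed.

Lemma hull_mix S p x y (t : R) : 0 <= t <= 1 -> hull_upto p S x -> S y ->
  hull_upto p.+1 S (x + t%:C *: (y - x)).
Proof.
move=> /andP[t0 t1] [w [s [w0 w1 Ss xE]]] Sy.
exists (fun j => if (j < p)%N then (1 - t) * w j else t).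
exists (fun j => if (j < p)%N then s j else y); split.
- by move=> j; case: ifP => // _; rewrite mulr_ge0// subr_ge0.
- rewrite big_ord_recr /= ltnn; under eq_bigr do rewrite ltn_ord.
  by rewrite -mulr_sumr w1 mulr1 subrK.
- by move=> j; case: ifP.
rewrite big_ord_recr /= ltnn; under eq_bigr do rewrite ltn_ord realCM -scalerA.
have -> : (1 - t)%:C = 1 - t%:C :> R[i] by rewrite rmorphB rmorph1.
rewrite -scaler_sumr -xE scalerBl scale1r scalerBr.
by rewrite addrA addrAC.
Qed.

Variable U : set_system nat.
Hypothesis UU : UltraFilter U.
Hypothesis Uoo : \oo `<=` U.

Definition ulim_closed S := forall (s : nat -> E) (l : E), (forall m, S (s m)) ->
  (forall k, is_ulim U (fun m => s m k 0) (l k 0)) -> S l.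

Lemma is_ulim_hnsq (s : nat -> E) (l : E) :
  (forall k, is_ulim U (fun m => s m k 0) (l k 0)) ->
  is_ulim U (fun m => (hnsq (s m))%:C) (hnsq l)%:C.
Proof.
move=> sl; rewrite -inner_hnsq; under eq_fun do rewrite -inner_hnsq.
apply: is_ulim_sum => k _; apply: is_ulimM; first exact: sl.
exact: is_ulim_conj.
Qed.

(* The nearest point c of the hull to y satisfies <s - c, y - c> <= 0 on S. *)
Lemma hull_dual S y : ulim_closed S -> (exists M : R, forall s, S s -> hnsq s <= M) ->
  (forall (c : E) (t : R), (forall s, S s -> Re (inner s c) <= t) -> Re (inner y c) <= t) ->
  exists p, hull_upto p S y.
Proof.
move=> Scl [M SM] ydual; pose p := (q + q + 1)%N; exists p.
have [s0 Ss0] : exists s, S s.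
  (* For empty [S] the hypothesis with [c = 0] and [t = -1] would read 0 <= -1. *)
  apply: contrapT => /forallNP nS; have := ydual 0 (-1) (fun s Ss => match nS s Ss with end).
  by rewrite inner0r /= lerNr oppr0 ler10.
have p1 : (q + q).+1 = p by rewrite /p addn1.
have hne : hull_upto p S s0.
  exists (fun j => if j == 0%N then 1 else 0), (fun=> s0); split=> //.
  - by move=> j; case: ifP.
  - by rewrite -p1 big_ord_recl /= big1 ?addr0.
  by rewrite -p1 big_ord_recl /= big1 ?scale1r ?addr0// => j _; rewrite scale0r.
pose D := [set hnsq (y - c) | c in hull_upto p S].
have Dinf : has_inf D.
  by split; [exists (hnsq (y - s0)), s0|exists 0 => _ [c _ <-]; exact: hnsq_ge0].
(* A sequence approaching the infimum of the distances, with the number of points fixed: weights and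
   points stay bounded and so have limits along [U]. *)
have cex (m : nat) : exists ws : (nat -> R) * (nat -> E),
    [/\ forall j, 0 <= ws.1 j, \sum_(j < p) ws.1 j = 1, forall j, S (ws.2 j) &
        hnsq (y - \sum_(j < p) (ws.1 j)%:C *: ws.2 j) < inf D + m.+1%:R^-1].
  have m0 : 0 < m.+1%:R^-1 :> R by rewrite invr_gt0.
  have [_ [c [w [s [w0 w1 Ss cE]]] <-] cm] := inf_adherent m0 Dinf.
  by exists (w, s); split=> //=; rewrite -cE.
have [ws wsP] := choice cex.
have wex (j : 'I_p) : exists c, is_ulim U (fun m => ((ws m).1 j)%:C) c.
  apply: (@is_ulim_exists _ _ _ UU _ 1) => m; have [w0 w1 _ _] := wsP m.
  by rewrite normc_real ger0_norm// -w1 (bigD1 j)//= lerDl sumr_ge0.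
have [w wl] := choice wex.
have sex (jk : 'I_p * 'I_q) : exists c, is_ulim U (fun m => (ws m).2 jk.1 jk.2 0) c.
  case: jk => j k; apply: (@is_ulim_exists _ _ _ UU _ (Num.sqrt M)) => m /=.
  have [_ _ Ss _] := wsP m; rewrite -lecR -normcE.
  rewrite (le_trans (normr_coord_le _ _))// normE lecR ler_wsqrtr//.
  exact/SM/Ss.
have [s sl] := choice sex.
pose sv (j : nat) : E := if insub j is Some i then \col_k s (i, k) else s0.
pose wv (j : nat) : R := if insub j is Some i then Re (w i) else 0.
have svE (i : 'I_p) : sv i = \col_k s (i, k).
  by rewrite /sv valK.
have wvE (i : 'I_p) : (wv i)%:C = w i.
  rewrite /wv valK; apply: complexP => //=; apply/esym.
  by apply: is_ulim_real (wl i).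
have wv0 j : 0 <= wv j.
  rewrite /wv; case: insubP => // i _ _; apply: is_ulim_ge (wl i) => //.
  by apply: filterS filterT => m _ /=; have [] := wsP m.
have wv1 : \sum_(j < p) wv j = 1.
  apply: (@complexI R); rewrite rmorph_sum rmorph1 /=.
  under eq_bigr do rewrite wvE.
  have lim : is_ulim U (fun m => \sum_(j < p) ((ws m).1 j)%:C) (\sum_(j < p) w j).
    by apply: is_ulim_sum.
  apply: (is_ulim_unique UU) lim _; apply: is_ulim_near (is_ulim_cst _ 1).
  apply: filterS filterT => m _ /=.
  by have [_ w1 _ _] := wsP m; rewrite -(rmorph_sum (real_complex R)) w1.
have Ssv j : S (sv j).
  rewrite /sv; case: insubP => // i _ _; apply: (Scl (fun m => (ws m).2 i)).
    by move=> m; have [] := wsP m.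
  by move=> k; rewrite mxE; exact: (sl (i, k)).
pose c := \sum_(j < p) (wv j)%:C *: sv j.
have hc : hull_upto p S c by exists wv, sv.
have cD : hnsq (y - c) <= inf D.
  have lim : is_ulim U (fun m => (hnsq (y - \sum_(j < p) ((ws m).1 j)%:C *: (ws m).2 j))%:C)
      (hnsq (y - c))%:C.
    apply: is_ulim_hnsq => k.
    rewrite !mxE; under eq_fun do rewrite !mxE.
    apply: is_ulimD; first exact: is_ulim_cst.
    rewrite -mulN1r; under eq_fun do rewrite -mulN1r; apply: is_ulimZ => //.
    rewrite summxE; under eq_fun do rewrite summxE.
    apply: is_ulim_sum => j _; rewrite mxE; under eq_fun do rewrite mxE.
    by apply: is_ulimM => //; [rewrite wvE|rewrite svE mxE; exact: (sl (j, k))].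
  apply/ler_addgt0Pl => e e0; apply: is_ulim_le lim => //.
  apply: Uoo; exists (Num.bound e^-1) => // m /= em.
  have [_ _ _ /ltW/le_trans] := wsP m; apply; rewrite addrC lerD2r.
  have einv : 0 <= e^-1 by rewrite invr_ge0 ltW.
  rewrite -[leRHS]invrK lef_pV2 ?posrE ?invr_gt0//.
  rewrite (le_trans (ltW (archi_boundP einv)))// ler_nat.
  exact: leq_trans em _.
have Dle s1 : hull_upto p.+1 S s1 -> inf D <= hnsq (y - s1).
  move=> /(hull_reduce (ltnSn _)) h; apply: ge_inf; first by case: Dinf.
  by exists s1.
have obtuse s1 : S s1 -> Re (inner s1 (y - c)) <= Re (inner c (y - c)).
  move=> Ss1; rewrite -subr_le0 -ReB -innerBl.
  set r := Re _; set n := hnsq (s1 - c).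
  (* Moving from [c] towards [s1] stays in the hull, after reduction from [p.+1] to [p] points, so
     the distance to [y] does not decrease; dividing by [t] leaves this bound, which forces r <= 0
     for small [t]. *)
  have tP (t : R) : 0 < t <= 1 -> 2 * r <= t * n.
    move=> /andP[t0 t1].
    have := Dle _ (hull_mix (_ : 0 <= t <= 1) hc Ss1); rewrite ltW//= => /(_ t1).
    move/(le_trans cD).
    rewrite (hnsq_segment y c s1 t : hnsq (y - (c + t%:C *: (s1 - c))) = _) -/n -/r.
    by move=> h; rewrite -(ler_pM2l t0); move: h; lra.
  rewrite leNgt; apply/negP => r0.
  have n0 : 0 <= n by exact: hnsq_ge0.
  pose t := Num.min 1 (r / (n + 1)).
  have n1 : 0 < n + 1 by rewrite ltr_wpDl.
  have t01 : 0 < t <= 1 by rewrite lt_min ltr01 divr_gt0//= ge_min lexx.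
  have := tP t t01; have tr : t * (n + 1) <= r by rewrite -ler_pdivlMr// ge_min lexx orbT.
  have /andP[t0 _] := t01; nra.
have := ydual (y - c) _ obtuse; rewrite -subr_le0 -ReB -innerBl -/(hnsq (y - c)) => yc.
have : y - c = 0 by apply: hnsq_eq0; apply/eqP; rewrite eq_le hnsq_ge0 andbT.
by move/subr0_eq ->.
Qed.

End ConvexHulls.

Section DiagonalRepresentation.
Variables (R : realType) (I : finType) (n : nat).
Implicit Types (K : set (I -> R[i])) (y : I -> 'I_n -> 'I_n -> R[i]).

(* A dilation to the diagonal tuple with joint eigenvalues z j, whose isometry
   has matrix (u j a). *)
Definition diag_rep K y := exists (p : nat) (z : 'I_p -> I -> R[i])
    (u : 'I_p -> 'I_n -> R[i]),
  [/\ forall j, K (z j),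
      forall a b, \sum_j u j a * cj (u j b) = (a == b)%:R &
      forall i a b, y i a b = \sum_j z j i * (u j a * cj (u j b))].

Variable U : set_system nat.
Hypothesis UU : UltraFilter U.
Hypothesis Uoo : \oo `<=` U.

Definition ulim_closed_fun K := forall (s : nat -> I -> R[i]) l,
  (forall m, K (s m)) -> (forall i, is_ulim U (fun m => s m i) (l i)) -> K l.

(** Block [Some i] holds the entries of the i-th matrix and block [None] those of the identity,
    which records the isometry condition of a dilation. *)
Let Q : finType := (option I * ('I_n * 'I_n))%type.
Let q := #|{: Q}|.
Let enc (F : Q -> R[i]) : euclid R q := \col_k F (enum_val k).

Let encE F x : enc F (enum_rank x) 0 = F x.
Proof. by rewrite mxE enum_rankK. Qed.

Let inner_enc F (c : euclid R q) :
  inner (enc F) c = \sum_x F x * cj (c (enum_rank x) 0).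
Proof.
rewrite [LHS]/(cdot _ _) /cdot (reindex enum_rank)/=; last first.
  by apply: onW_bij; exists enum_val; [exact: enum_rankK|exact: enum_valK].
by apply: eq_bigr => x _; rewrite encE.
Qed.

Let sumQ (F : Q -> R[i]) : \sum_x F x =
  \sum_a \sum_b F (None, (a, b)) + \sum_i \sum_a \sum_b F (Some i, (a, b)).
Proof.
have sumab G : \sum_(ab : 'I_n * 'I_n) G ab = \sum_a \sum_b G (a, b) :> R[i].
  by rewrite pair_bigA; apply: eq_bigr => -[].
transitivity (\sum_j \sum_ab F (j, ab)).
  by rewrite pair_bigA; apply: eq_bigr => -[].
by rewrite sum_option sumab; congr (_ + _); apply: eq_bigr => i _; rewrite sumab.
Qed.

Let ext z (j : option I) : R[i] := if j is Some i then z i else 1.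
(** A rank one building block of [diag_rep]: the contribution of a single joint eigenvalue. *)
Let phi z (v : 'I_n -> R[i]) : euclid R q :=
  enc (fun x => ext z x.1 * (v x.2.1 * cj (v x.2.2))).

Lemma dual_diag_rep K y : ulim_closed_fun K ->
  (exists M : R, forall z i, K z -> normc (z i) <= M) ->
  dual_ineq K y -> diag_rep K y.
Proof.
move=> Kcl [M KM] Ky.
have [n0|n0] := posnP n.
  exists 0%N, (fun _ _ => 0), (fun _ _ => 0); split; first by case.
    by move=> a; have : (a < 0)%N by rewrite -n0.
  by move=> i a; have : (a < 0)%N by rewrite -n0.
have nR : 0 < n%:R :> R by rewrite ltr0n.
pose S := [set s | exists z v, [/\ K z, \sum_a normc (v a) ^+ 2 = n%:R & s = phi z v]].
pose Y := enc (fun x => let: (j, (a, b)) := x in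
  if j is Some i then y i a b else (a == b)%:R).
have vle (v : 'I_n -> R[i]) a : \sum_a normc (v a) ^+ 2 = n%:R -> normc (v a) <= n%:R.
  move=> v1; rewrite -(@ler_pXn2r _ 2)// ?nnegrE ?normc_ge0//.
  apply: (@le_trans _ _ n%:R); last by rewrite expr2 ler_peMl// ler1n.
  by rewrite -v1 (bigD1 a)//= lerDl sumr_ge0// => b _; exact: sqr_ge0.
have Scl : ulim_closed U S.
  move=> s l Ss sl.
  have [zv zvP] := choice (fun m => (fun '(ex_intro z (ex_intro v h)) =>
    ex_intro (fun zv : (I -> R[i]) * ('I_n -> R[i]) => [/\ K zv.1,
       \sum_a normc (zv.2 a) ^+ 2 = n%:R & s m = phi zv.1 zv.2]) (z, v) h) (Ss m)).
  have zex i : exists c, is_ulim U (fun m => (zv m).1 i) c.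
    by apply: (@is_ulim_exists _ _ _ UU _ M) => m; apply: KM; have [] := zvP m.
  have vex a : exists c, is_ulim U (fun m => (zv m).2 a) c.
    by apply: (@is_ulim_exists _ _ _ UU _ n%:R) => m; apply: vle; have [] := zvP m.
  have [z zl] := choice zex; have [v vl] := choice vex.
  exists z, v; split.
  - by apply: (Kcl (fun m => (zv m).1)) => // m; have [] := zvP m.
  - apply: (@complexI R); rewrite rmorph_sum rmorph_nat /=.
    under eq_bigr do rewrite -mulr_conj.
    have lim : is_ulim U (fun m => \sum_a (zv m).2 a * cj ((zv m).2 a))
        (\sum_a v a * cj (v a)).
      by apply: is_ulim_sum => a _; apply: is_ulimM => //; exact: is_ulim_conj.
    apply: (is_ulim_unique UU) lim _; apply: is_ulim_near (is_ulim_cst _ n%:R).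
    apply: filterS filterT => m _ /=.
    under eq_bigr do rewrite mulr_conj.
    have [_ v1 _] := zvP m.
    by rewrite -(rmorph_sum (real_complex R)) v1 /= -(rmorph_nat (real_complex R)).
  apply/colP => k; rewrite mxE; set x := enum_val k.
  apply: (is_ulim_unique UU) (sl k) _.
  have -> : (fun m => s m k 0) =
      (fun m => ext (zv m).1 x.1 * ((zv m).2 x.2.1 * cj ((zv m).2 x.2.2))).
    by apply/funext => m; have [_ _ ->] := zvP m; rewrite mxE.
  apply: is_ulimM; last by apply: is_ulimM => //; exact: is_ulim_conj.
  by case: x.1 => [i|] /=; [exact: zl|exact: is_ulim_cst].
have Sbd : exists M : R, forall s, S s -> hnsq s <= M.
  exists (\sum_(k < q) ((`|M| + 1) * (n%:R * n%:R)) ^+ 2) => _ [z [v [Kz v1 ->]]].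
  rewrite /hnsq [inner _ _]/(cdot _ _) /cdot Re_sum; apply: ler_sum => k _.
  rewrite mulr_conj /= ler_pXn2r ?nnegrE ?normc_ge0 ?mulr_ge0 ?addr_ge0//.
  rewrite mxE !Normc.normcM normc_conj ler_pM ?mulr_ge0 ?normc_ge0//.
    case: (enum_val k).1 => [i|]; last by rewrite [normc _]Normc.normc1 lerDr.
    by rewrite (le_trans (KM _ i Kz))// (le_trans (ler_norm _))// lerDl.
  by rewrite ler_pM ?normc_ge0// vle.
have Ydual (c : euclid R q) (t : R) :
    (forall s, S s -> Re (inner s c) <= t) -> Re (inner Y c) <= t.
  move=> Sct; pose C j a b := cj (c (enum_rank ((j, (a, b)) : Q)) 0).
  (* The pencil whose form at [v] is (t / n) |v|^2 - <phi z v, c>: a functional bounded by [t] on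
     the blocks becomes a positive pencil. *)
  pose A0 a b : R[i] := (if a == b then (t / n%:R)%:C else 0) - C None a b.
  pose A i a b := - C (Some i) a b.
  have formE z (v : 'I_n -> R[i]) : inner (phi z v) c =
      \sum_a \sum_b (C None a b + \sum_i z i * C (Some i) a b) * (v a * cj (v b)).
    rewrite inner_enc sumQ /=.
    under [RHS]eq_bigr => a _ do under eq_bigr => b _ do rewrite mulrDl mulr_suml.
    under [RHS]eq_bigr => a _ do rewrite big_split /= exchange_big.
    rewrite big_split /= [X in _ = _ + X]exchange_big /=; congr (_ + _).
      apply: eq_bigr => a _; apply: eq_bigr => b _.
      by rewrite mul1r mulrC.
    apply: eq_bigr => i _; apply: eq_bigr => a _; apply: eq_bigr => b _.
    by rewrite mulrAC.
  have Apos z : K z -> form_pos (fun a b => A0 a b + \sum_i z i * A i a b).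
    move=> Kz v; pose m : R := \sum_a normc (v a) ^+ 2.
    have -> : \sum_a \sum_b (A0 a b + \sum_i z i * A i a b) * (v a * cj (v b)) =
        (t / n%:R * m)%:C - inner (phi z v) c.
      rewrite formE realCM [m%:C]rmorph_sum mulr_sumr -sumrB; apply: eq_bigr => a _.
      transitivity (\sum_b (if a == b then (t / n%:R)%:C * (v a * cj (v b)) else 0) -
          \sum_b (C None a b + \sum_i z i * C (Some i) a b) * (v a * cj (v b))).
        rewrite -sumrB; apply: eq_bigr => b _; rewrite /A0 /A.
        under eq_bigr do rewrite mulrN.
        rewrite sumrN -addrA -opprD mulrBl; congr (_ - _).
        by case: ifP => // _; rewrite mul0r.
      rewrite -big_mkcond (big_pred1 a)/=; last by move=> b; rewrite eq_sym.
      by rewrite mulr_conj.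
    rewrite ReB subr_ge0 /=.
    have m0 : 0 <= m by rewrite sumr_ge0// => a _; exact: sqr_ge0.
    move: m0; rewrite le_eqVlt => /predU1P[m0|m0].
      rewrite -m0 mulr0 formE big1//= => a _; rewrite big1// => b _.
      have /psumr_eq0P va : forall a, true -> 0 <= normc (v a) ^+ 2.
        by move=> a' _; exact: sqr_ge0.
      have /eqP := va (esym m0) a isT; rewrite sqrf_eq0 => /eqP/Normc.eq0_normc ->.
      by rewrite mul0r mulr0.
    (* Rescales [v] to squared norm [n], where the bound by [t] is available. *)
    pose l := Num.sqrt (n%:R / m).
    have l2 : l ^+ 2 = n%:R / m by rewrite sqr_sqrtr// divr_ge0// ltW.
    have : Re (inner (phi z (fun a => l%:C * v a)) c) <= t.
      apply: Sct; exists z, (fun a => l%:C * v a); split=> //.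
      under eq_bigr do rewrite Normc.normcM normc_real exprMn real_normK ?num_real// l2.
      by rewrite -mulr_sumr -/m divfK// gt_eqF.
    have -> : inner (phi z (fun a => l%:C * v a)) c = (l ^+ 2)%:C * inner (phi z v) c.
      rewrite !formE mulr_sumr; apply: eq_bigr => a _.
      rewrite mulr_sumr; apply: eq_bigr => b _.
      rewrite cjM conj_real [in RHS]mulrCA; congr (_ * _).
      by rewrite mulrACA -realCM -expr2.
    rewrite Re_realM l2 mulrC -ler_pdivlMr ?divr_gt0// invf_div.
    by rewrite [m / _]mulrC mulrA.
  have := Ky A0 A Apos.
  have -> : \sum_a A0 a a + \sum_i \sum_a \sum_b A i a b * y i a b = t%:C - inner Y c.
    rewrite inner_enc sumQ /= opprD addrA; congr (_ + _).
      have -> : t%:C = \sum_(a < n) (t / n%:R)%:C.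
        rewrite sumr_const card_ord -(rmorphMn (real_complex R)) /= -mulr_natr.
        by rewrite divfK// gt_eqF.
      rewrite -sumrB; apply: eq_bigr => a _; rewrite /A0 eqxx (bigD1 a)//= eqxx mul1r.
      by rewrite big1 ?addr0// => b /negbTE ba; rewrite eq_sym ba mul0r.
    rewrite -sumrN; apply: eq_bigr => i _; rewrite -sumrN; apply: eq_bigr => a _.
    by rewrite -sumrN; apply: eq_bigr => b _; rewrite /A mulNr mulrC.
  by rewrite ReB subr_ge0.
have [p [w [s [w0 w1 Ss YE]]]] := hull_dual UU Uoo Scl Sbd Ydual.
have [zv zvP] := choice (fun m => (fun '(ex_intro z (ex_intro v h)) =>
    ex_intro (fun zv : (I -> R[i]) * ('I_n -> R[i]) => [/\ K zv.1,
       \sum_a normc (zv.2 a) ^+ 2 = n%:R & s m = phi zv.1 zv.2]) (z, v) h) (Ss m)).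
(* The convex weights are absorbed into the vectors as square roots. *)
pose u (j : 'I_p) a : R[i] := (Num.sqrt (w j))%:C * (zv j).2 a.
have uE j a b : u j a * cj (u j b) = (w j)%:C * ((zv j).2 a * cj ((zv j).2 b)).
  rewrite /u cjM conj_real mulrACA -realCM -expr2 sqr_sqrtr//.
have coord (x : Q) : Y (enum_rank x) 0 =
    \sum_(j < p) ext (zv j).1 x.1 * (u j x.2.1 * cj (u j x.2.2)).
  rewrite YE summxE; apply: eq_bigr => j _; have [_ _ ->] := zvP j.
  by rewrite mxE encE uE mulrCA.
exists p, (fun j => (zv j).1), u; split.
- by move=> j; have [] := zvP j.
- move=> a b; have := coord (None, (a, b)); rewrite encE => ->.
  by apply: eq_bigr => j _; rewrite mul1r.
by move=> i a b; have := coord (Some i, (a, b)); rewrite encE => ->.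
Qed.

End DiagonalRepresentation.

Section DiagonalOperators.
Variables (R : realType) (p : nat).
Implicit Types (f g : 'I_p -> R[i]).

Definition dop f : bop (euclid R p) (euclid R p) := mxop (diag_mx (\row_j f j)).

Lemma dopE f (v : euclid R p) j : (dop f v : euclid R p) j 0 = f j * v j 0.
Proof. by rewrite /= mul_diag_mx !mxE. Qed.

Lemma dop_comp f g : bop_comp (dop f) (dop g) = dop (fun j => f j * g j).
Proof. by apply: bopP => v; apply/colP => j; rewrite !dopE mulrA. Qed.

Lemma dop_add f g : dop f + dop g = dop (fun j => f j + g j).
Proof.
by apply: bopP => v; apply/colP => j; rewrite dopE bop_addE mxE !dopE mulrDl.
Qed.

Lemma dop_scale c f : c *: dop f = dop (fun j => c * f j).
Proof.
by apply: bopP => v; apply/colP => j; rewrite dopE bop_scaleE mxE dopE mulrA.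
Qed.

Lemma dop1 : dop (fun=> 1) = bop1 (euclid R p).
Proof. by apply: bopP => v; apply/colP => j; rewrite dopE mul1r. Qed.

Lemma dop_sum (J : Type) (r : seq J) (F : J -> 'I_p -> R[i]) :
  \sum_(k <- r) dop (F k) = dop (fun j => \sum_(k <- r) F k j).
Proof.
apply: bopP => v; apply/colP => j; rewrite dopE bop_sumE summxE mulr_suml.
by apply: eq_bigr => k _; rewrite dopE.
Qed.

Lemma inner_euclid (u v : euclid R p) : inner u v = \sum_k u k 0 * cj (v k 0).
Proof. by []. Qed.

Lemma dop_adjoint f : is_adjoint (dop f) (dop (fun j => cj (f j))).
Proof.
move=> u v; rewrite !inner_euclid; apply: eq_bigr => j _.
by rewrite !dopE cjM conjCK mulrCA mulrA.
Qed.

Lemma opnorm_dop f (M : R) : 0 <= M -> (forall j, normc (f j) <= M) ->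
  opnorm (dop f) <= M.
Proof.
move=> M0 fM; apply: opnorm_le => // v; rewrite le_hnorm// /hnsq !inner_euclid.
rewrite !Re_sum mulr_sumr; apply: ler_sum => j _.
rewrite !mulr_conj dopE Normc.normcM exprMn ler_wpM2r ?sqr_ge0//.
by rewrite ler_pXn2r ?nnegrE ?normc_ge0.
Qed.

Variables (I : finType) (z : 'I_p -> I -> R[i]).

Lemma normal_tuple_dop : normal_tuple (fun i => dop (z^~ i)).
Proof.
split=> [i|i j].
  exists (dop (fun j => cj (z j i))); first exact: dop_adjoint.
  by rewrite !dop_comp; congr dop; apply/funext => j; rewrite mulrC.
by rewrite !dop_comp; congr dop; apply/funext => k; rewrite mulrC.
Qed.

(* If w is not one of the z j then D = sum_i |N_i - w_i|^2 is invertible, and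
   since prod_j (1 - D/D_j) = 0 its inverse is a polynomial in D. *)
Lemma joint_spectrum_dop : joint_spectrum (fun i => dop (z^~ i)) `<=` range z.
Proof.
move=> w; apply: contra_notP => nw; pose Dg j := \sum_i (z j i - w i) * cj (z j i - w i).
have D0 j : Dg j != 0.
  apply/eqP => /eqP; rewrite psumr_eq0; last first.
    by move=> i _; rewrite mulr_conj ler0c sqr_ge0.
  move=> /allP zw; apply: nw; exists j => //; apply/funext => i.
  have := zw i (mem_index_enum i) => /=.
  by rewrite mul_conjC_eq0 subr_eq0 => /eqP.
pose N i := dop (z^~ i); pose B i := dop (fun j => (Dg j)^-1 * cj (z j i - w i)).
exists B; last first.
  have -> : \sum_i bop_comp (B i) (N i - w i *: bop1 (euclid R p)) =
      \sum_i dop (fun j => (Dg j)^-1 * ((z j i - w i) * cj (z j i - w i))).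
    apply: eq_bigr => i _; rewrite -dop1 dop_scale -scaleN1r dop_scale dop_add dop_comp.
    by congr dop; apply/funext => j; rewrite mulr1 mulN1r -mulrA [cj _ * _]mulrC.
  rewrite dop_sum -dop1; congr dop; apply/funext => j.
  by rewrite -mulr_sumr mulVf.
move=> i C [[[C1 CD] CZ CM Cadj _] CN].
pose A f := C (dop f).
have A1 : A (fun=> 1) by rewrite /A dop1.
have AD f g : A f -> A g -> A (fun j => f j + g j).
  by rewrite /A -dop_add; exact: CD.
have AM f g : A f -> A g -> A (fun j => f j * g j).
  by rewrite /A -dop_comp; exact: CM.
have AZ c f : A f -> A (fun j => c * f j).
  by rewrite /A -dop_scale; exact: CZ.
have Aw k : A (fun j => z j k - w k).
  have -> : (fun j => z j k - w k) = (fun j => z j k + (- w k) * 1).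
    by apply/funext => j; rewrite mulr1.
  by apply: AD; [apply: CN; exists k|exact: AZ].
have Awc k : A (fun j => cj (z j k - w k)).
  by apply: Cadj (Aw k); exact: dop_adjoint.
have A0 : A (fun=> 0).
  by have := AZ 0 _ A1; congr A; apply/funext => j; rewrite mul0r.
have ADg : A Dg.
  rewrite /Dg; elim: (index_enum I) => [|k s IHs].
    by rewrite [X in A X](_ : _ = fun=> 0)//; apply/funext => j; rewrite big_nil.
  rewrite [X in A X](_ : _ = fun j => (z j k - w k) * cj (z j k - w k) +
     \sum_(i <- s) (z j i - w i) * cj (z j i - w i)); last first.
    by apply/funext => j; rewrite big_cons.
  by apply: AD => //; exact: AM.
have [g Ag gE] : exists2 g, A g &
    forall j, \prod_(k < p) (1 - Dg j / Dg k) = 1 - Dg j * g j.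
  elim: (index_enum _) => [|k s [g Ag gE]].
    by exists (fun=> 0) => // j; rewrite big_nil mulr0 subr0.
  exists (fun j => g j + (Dg k)^-1 * (1 + (-1) * (Dg j * g j))).
    by apply: (AD) => //; apply: (AZ); apply: (AD) => //; apply: (AZ); exact: (AM).
  by move=> j; rewrite big_cons gE; ring.
have gV j : g j = (Dg j)^-1.
  have := gE j; rewrite (bigD1 j)//= divff// subrr mul0r => /esym/subr0_eq h.
  by apply: (mulfI (D0 j)); rewrite -h divff.
have -> : B i = dop (fun j => g j * cj (z j i - w i)).
  by congr dop; apply/funext => j; rewrite gV.
exact: (AM g).
Qed.

End DiagonalOperators.

Section Dilations.
Variables (R : realType) (I : finType).

Lemma op_isometryP (H K : hilbertType R) (V : bop H K) :
  (forall x y, inner (V x) (V y) = inner x y) -> op_isometry V.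
Proof. by move=> VV x; rewrite !normE /hnorm /hnsq VV. Qed.

Lemma dilatesP (H K : hilbertType R) (N : I -> bop K K) (T : I -> bop H H)
    (V : bop H K) : op_isometry V ->
  (forall i x y, inner (N i (V x)) (V y) = inner (T i x) y) -> dilates N T.
Proof.
move=> Viso NT; have [W VW] := adjoint_exists V; exists V, W; split=> // i.
apply: bopP => x; apply: inner_inj => y; apply: (can_inj (@conjCK _)).
by rewrite -!innerC -NT (is_adjointC VW).
Qed.

(** [V x] has the coordinates sum_a <x, f a> u j a. With an arbitrary diagonal [g], one formula
    covers inner products of images ([g = 1]) and compressions of diagonal operators; for
    orthonormal [f] the map is isometric on their span. *)
Lemma coordinate_map (H : hilbertType R) n (f : 'I_n -> H) p
    (u : 'I_p -> 'I_n -> R[i]) :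
  (forall a b, \sum_j u j a * cj (u j b) = (a == b)%:R) ->
  exists V : bop H (euclid R p), forall g x y, inner (dop g (V x)) (V y) =
    \sum_a \sum_b (inner x (f a) * cj (inner y (f b))) *
      \sum_j g j * (u j a * cj (u j b)).
Proof.
move=> uu; pose Vf (x : H) : euclid R p := \col_j \sum_a inner x (f a) * u j a.
have VfE g x y : inner (dop g (Vf x)) (Vf y) =
    \sum_a \sum_b (inner x (f a) * cj (inner y (f b))) *
      \sum_j g j * (u j a * cj (u j b)).
  rewrite inner_euclid.
  under [RHS]eq_bigr => a _ do under eq_bigr => b _ do rewrite mulr_sumr.
  under [RHS]eq_bigr => a _ do rewrite exchange_big.
  rewrite [RHS]exchange_big; apply: eq_bigr => j _ /=.
  rewrite -[X in X * _]/((dop g (Vf x) : euclid R p) j 0) dopE !mxE rmorph_sum.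
  rewrite [g j * _]mulr_sumr [LHS]mulr_suml; apply: eq_bigr => a _.
  rewrite mulr_sumr; apply: eq_bigr => b _ /=.
  by rewrite rmorphM /=; ring.
have lV : linear Vf.
  move=> c x y; apply/colP => j; rewrite !mxE mulr_sumr -big_split.
  by apply: eq_bigr => a _; rewrite innerDl innerZl mulrDl mulrA.
have uu1 a b : \sum_j 1 * (u j a * cj (u j b)) = (a == b)%:R.
  by under eq_bigr do rewrite mul1r; exact: uu.
have [|V VE] := @exists_bop _ _ _ Vf (\sum_a hnsq (f a)) lV.
  move=> x; have := VfE (fun=> 1) x x; rewrite dop1 [bop1 _ _]/= => /(congr1 (@complex.Re R)).
  rewrite -/(hnsq _) => ->; rewrite Re_sum mulr_suml; apply: ler_sum => a _.
  under eq_bigr => b _ do rewrite uu1.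
  rewrite (bigD1 a)//= big1 ?addr0 => [|b ba]; last first.
    by rewrite eq_sym (negbTE ba) mulr0.
  by rewrite eqxx mulr1 mulr_conj /= mulrC inner_CS.
by exists V => g x y; rewrite !VE.
Qed.

Lemma diag_rep_Wmin (K : set (I -> R[i])) (X : mxtuple R I) :
  diag_rep K (fun i a b => tagged X i b a) -> Wmin K X.
Proof.
move=> [p [z [u [Kz uu XE]]]].
have [V VE] := coordinate_map (@evec R (tag X).+1) uu.
exists (euclid R p), (fun i => dop (z^~ i)); split.
- exact: normal_tuple_dop.
- apply: (@dilatesP _ _ _ _ V) => [x|i x y].
    apply: (op_isometryP) => {}x y; rewrite -[V x]/(bop1 _ (V x)) -dop1 VE.
    rewrite inner_euclid; apply: eq_bigr => a _.
    under eq_bigr => b _ do (under eq_bigr do rewrite mul1r); rewrite /=.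
    rewrite (bigD1 a)//= uu eqxx mulr1 !inner_evecr big1 ?addr0// => b ba.
    by rewrite uu eq_sym (negbTE ba) mulr0.
  rewrite VE exchange_big inner_euclid; apply: eq_bigr => b _.
  rewrite mxE mulr_suml; apply: eq_bigr => a _.
  by rewrite -XE !inner_evecr; ring.
by move=> w /joint_spectrum_dop[j _ <-].
Qed.

End Dilations.

(** * Fejer kernels and the dual inequality for contractions *)

Section MatrixOperators.
Variables (R : realType) (n : nat).
Implicit Types A B : 'M[R[i]]_n.

Definition adjm A : 'M[R[i]]_n := map_mx Num.conj A^T.

Lemma mxopD A B : mxop (A + B) = mxop A + mxop B.
Proof. by apply: bopP => v; rewrite bop_addE /= mulmxDl. Qed.

Lemma mxopZ c A : mxop (c *: A) = c *: mxop A.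
Proof. by apply: bopP => v; rewrite bop_scaleE /= scalemxAl. Qed.

Lemma mxop1 : mxop 1%:M = bop1 (euclid R n).
Proof. by apply: bopP => v; rewrite /= mul1mx. Qed.

Lemma mxop_sum (I : Type) (r : seq I) (P : pred I) (F : I -> 'M[R[i]]_n) :
  mxop (\sum_(i <- r | P i) F i) = \sum_(i <- r | P i) mxop (F i).
Proof.
apply: (big_morph (@mxop R n) mxopD).
by apply: bopP => v; rewrite bop_zeroE /= mul0mx.
Qed.

Lemma mxop_adjoint A : is_adjoint (mxop A) (mxop (adjm A)).
Proof.
move=> u v; rewrite !inner_euclid.
under eq_bigr do rewrite mxE mulr_suml.
under [RHS]eq_bigr do rewrite mxE rmorph_sum mulr_sumr.
rewrite exchange_big; apply: eq_bigr => j _; apply: eq_bigr => k _ /=.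
by rewrite !mxE rmorphM /= conjCK mulrCA mulrA.
Qed.

Lemma adjm_additive : {morph adjm : A B / A + B}.
Proof. by move=> A B; apply/matrixP => i j; rewrite !mxE rmorphD. Qed.

Lemma adjmZ c A : adjm (c *: A) = cj c *: adjm A.
Proof. by apply/matrixP => i j; rewrite !mxE rmorphM. Qed.

Lemma adjm_sum (I : Type) (r : seq I) (P : pred I) (F : I -> 'M[R[i]]_n) :
  adjm (\sum_(i <- r | P i) F i) = \sum_(i <- r | P i) adjm (F i).
Proof.
apply: (big_morph adjm adjm_additive).
by apply/matrixP => i j; rewrite !mxE rmorph0.
Qed.

End MatrixOperators.

(* The Fejer means of the Toeplitz kernel of a contraction X are positive; at
   the q-th roots of unity they form a positive operator measure whose first
   moment is (m-1)/m X. *)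
Section FejerMeans.
Variables (R : realType) (n : nat) (X : 'M[R[i]]_n.+1).
Hypothesis X_contr : forall v : euclid R n.+1, hnsq (mxop X v) <= hnsq v.

Let Q (c : R[i]) m := \sum_(j < m) c ^+ j.+1 *: X ^+ j.+1.
Let P (c : R[i]) m := \sum_(j < m) c ^+ j *: X ^+ j.

(** Unnormalised: the sum over r < m of the partial sums 1 + sum_(1 <= j <= r) (c^j X^j + adjoint),
    that is, m times the Fejer mean. *)
Fixpoint fejer (c : R[i]) m : 'M[R[i]]_n.+1 :=
  if m is m.+1 then fejer c m + 1 + (\sum_(j < m) c ^+ j.+1 *: X ^+ j.+1 +
    adjm (\sum_(j < m) c ^+ j.+1 *: X ^+ j.+1)) else 0.

Let fejerS c m : fejer c m.+1 = fejer c m + 1 + (Q c m + adjm (Q c m)).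
Proof. by []. Qed.

(** Stronger than positivity so that the induction closes: P_(m+1) = 1 + c X P_m, and |c X P_m v| <=
    |P_m v| is absorbed by the hypothesis for [m]. *)
Lemma fejer_ge c m (v : euclid R n.+1) : normc c = 1 ->
  (hnsq (mxop (P c m) v))%:C <= inner (mxop (fejer c m) v) v.
Proof.
move=> c1; elim: m => [|m IHm].
  have -> : P c 0 = 0 by rewrite /P big_ord0.
  have -> : mxop 0 v = 0 by rewrite /= mul0mx.
  by rewrite hnsq0 [inner 0 v]ip0l.
have -> : P c m.+1 = 1 + Q c m.
  by rewrite /P big_ord_recl expr0 scale1r.
have QP : Q c m = (c *: X) *m P c m.
  rewrite /P mulmx_sumr; apply: eq_bigr => j _.
  by rewrite -scalemxAl -scalemxAr scalerA -exprS [X ^+ j.+1]exprS.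
rewrite fejerS !mxopD mxop1 !bop_addE !innerDl inner_hnsq.
rewrite (is_adjointC (mxop_adjoint _)) [inner v (mxop _ v)]innerC.
set z := inner (mxop (Q c m) v) v.
have -> : z + cj z = (2 * Re z)%:C.
  by apply: complexP; rewrite ?ReD ?ImD ?Re_conj ?Im_conj /=; ring.
have -> : (hnsq (bop1 (euclid R n.+1) v + mxop (Q c m) v))%:C =
    (hnsq (mxop (Q c m) v))%:C + (hnsq v)%:C + (2 * Re z)%:C.
  by rewrite hnsqD -[bop1 _ v]/v [Re (inner v _)]Re_innerC !rmorphD /= [_ + (hnsq v)%:C]addrC.
rewrite !lerD2r; apply: le_trans IHm; rewrite lecR QP.
have -> : mxop ((c *: X) *m P c m) v = c *: mxop X (mxop (P c m) v).
  by rewrite /= -scalemxAl -scalemxAl mulmxA.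
by rewrite [leLHS]nsqZ c1 expr1n mul1r; exact: X_contr.
Qed.

Lemma fejer_ge0 c m (v : euclid R n.+1) : normc c = 1 ->
  0 <= inner (mxop (fejer c m) v) v.
Proof. by move=> /(fejer_ge m v); apply: le_trans; rewrite ler0c hnsq_ge0. Qed.

Variables (m : nat) (w : R[i]).
Hypothesis wP : m.+1.-primitive_root w.

Let w1 : normc w = 1 := normc_prim_root wP.

Let cjw (e : nat) : cj (w ^+ e) * w ^+ e = 1.
Proof. by rewrite mulrC mulr_conj normcX w1 expr1n expr1n. Qed.

Let sumw e : (e < m.+1)%N -> \sum_(k < m.+1) (w ^+ k) ^+ e =
  if e == 0%N then m.+1%:R else 0.
Proof.
move=> em; under eq_bigr do rewrite -exprM.
rewrite (sum_prim_root _ wP); case: e em => [|e] em; first by rewrite dvdn0.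
by rewrite gtnNdvd.
Qed.

Let sumwc e : (0 < e < m.+1)%N -> \sum_(k < m.+1) cj ((w ^+ k) ^+ e) = 0.
Proof.
by case: e => // e em; rewrite -rmorph_sum sumw//= rmorph0.
Qed.

(** Apart from the constant terms, the exponents of w^k lie strictly between 0 and m + 1, so summing
    over the roots leaves the identities, one for each root and each of the [r] partial sums. *)
Lemma fejer_sum r : (r <= m)%N ->
  \sum_(k < m.+1) fejer (w ^+ k) r = (m.+1%:R * r%:R) *: (1 : 'M[R[i]]_n.+1).
Proof.
elim: r => [|r IHr] rm; first by rewrite big1// mulr0 scale0r.
under eq_bigr do rewrite fejerS.
rewrite !big_split /= IHr 1?ltnW// sumr_const card_ord.
have Q0 : \sum_(k < m.+1) Q (w ^+ k) r = 0.
  rewrite exchange_big big1// => j _ /=; rewrite -scaler_suml sumw ?scale0r//=.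
  by rewrite ltnS (leq_trans (ltn_ord j)) ?(ltnW rm).
have -> : \sum_(k < m.+1) adjm (Q (w ^+ k) r) = 0.
  by rewrite -adjm_sum Q0; apply/matrixP => i j; rewrite !mxE rmorph0.
rewrite Q0 !addr0 -[r.+1%:R]natr1 mulrDr mulr1 scalerDl; congr (_ + _).
by rewrite scaler_nat.
Qed.

(** The conjugate of w^k singles out the terms in X, present in all but the first of the [r] partial
    sums. The adjoint terms then carry exponents from 2 to m, which the m + 1 roots still
    annihilate. *)
Lemma fejer_moment r : (0 < r <= m)%N ->
  \sum_(k < m.+1) cj (w ^+ k) *: fejer (w ^+ k) r = (m.+1%:R * r.-1%:R) *: X.
Proof.
elim: r => // r IHr /andP[_ rm]; rewrite [r.+1.-1]/=.
under eq_bigr do rewrite fejerS !scalerDr.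
rewrite !big_split /= -scaler_suml.
have -> : \sum_(k < m.+1) cj (w ^+ k) = 0.
  have := @sumwc 1; under eq_bigr do rewrite expr1; apply.
  by rewrite /= ltnS (leq_trans _ rm).
have -> : \sum_(k < m.+1) cj (w ^+ k) *: adjm (Q (w ^+ k) r) = 0.
  under eq_bigr do rewrite adjm_sum scaler_sumr.
  rewrite exchange_big big1// => j _ /=.
  under eq_bigr do rewrite adjmZ scalerA -cjM -exprS.
  rewrite -scaler_suml sumwc ?scale0r//=.
  by have := ltn_ord j; lia.
have -> : \sum_(k < m.+1) cj (w ^+ k) *: Q (w ^+ k) r =
    if r is r'.+1 then m.+1%:R *: X else 0.
  under eq_bigr do rewrite scaler_sumr.
  rewrite exchange_big /=.
  have E (j : 'I_r) : \sum_(k < m.+1) cj (w ^+ k) *: ((w ^+ k) ^+ j.+1 *: X ^+ j.+1) =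
      (if j == 0%N :> nat then m.+1%:R else 0) *: X ^+ j.+1.
    under eq_bigr do rewrite scalerA exprS mulrA cjw mul1r.
    by rewrite -scaler_suml sumw//; have := ltn_ord j; lia.
  under eq_bigr do rewrite E.
  case: (r) => [|r']; first by rewrite big_ord0.
  by rewrite big_ord_recl /= big1 ?addr0// => j _; rewrite scale0r.
rewrite scale0r !addr0; case: r IHr rm => [|r] IHr rm.
  by rewrite big1 ?mulr0 ?scale0r ?addr0// => k _; rewrite scaler0.
rewrite IHr ?(ltnW rm)//= -[r.+1%:R]natr1 mulrDr mulr1 scalerDl.
by [].
Qed.

End FejerMeans.

Section UnitalPositiveMaps.
Variables (R : realType) (H : hilbertType R) (n : nat).
Variable psi : bop H H -> 'M[R[i]]_n.
Hypothesis psi_ucp : ucp psi.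

Lemma ucp_ge0 (S : bop H H) (v : euclid R n) :
  (forall x, 0 <= inner (S x) x) -> 0 <= inner (mxop (psi S) v) v.
Proof.
have [_ _ pos] := psi_ucp => S0.
have /pos/(_ (fun=> v)) : opmx_ge0 (const_mx S : 'M[bop H H]_1).
  by move=> x; rewrite !big_ord1 mxE.
by rewrite !big_ord1 !mxE.
Qed.

(** For a contraction, the block matrix with identities on the diagonal and [T], [T'] off it is
    positive; complete positivity transports this to [psi T], which is then a contraction as
    well. *)
Lemma ucp_contraction (T : bop H H) (v : euclid R n) :
  (forall x, hnsq (T x) <= hnsq x) -> hnsq (mxop (psi T) v) <= hnsq v.
Proof.
have [_ psi1 pos] := psi_ucp => Tc; have [T' TT'] := adjoint_exists T.
pose A : 'M[bop H H]_2 := \matrix_(i, j)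
  if i == j then bop1 H else if i == 0 then T else T'.
have A0 : opmx_ge0 A.
  move=> x; rewrite !big_ord_recr !big_ord0 /= !add0r !mxE /=.
  set x0 := x _; set x1 := x _.
  have -> : inner x0 x0 + inner (T x1) x0 + (inner (T' x0) x1 + inner x1 x1) =
     (hnsq (x0 + T x1) + (hnsq x1 - hnsq (T x1)))%:C.
    rewrite (is_adjointC TT') !inner_hnsq hnsqD.
    rewrite -[X in _ + (X + _)]conjCK -innerC.
    apply: complexP; rewrite ?ReD ?ImD ?Re_conj ?Im_conj /=; last by ring.
    by rewrite (Re_innerC x0); ring.
  by rewrite ler0c addr_ge0 ?hnsq_ge0// subr_ge0.
have form (y0 y1 : euclid R n) : 0 <= (hnsq y0)%:C + inner (mxop (psi T) y1) y0 +
    (inner (mxop (psi T') y0) y1 + (hnsq y1)%:C).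
  have := pos 2%N A A0 (fun i => if i == 0 then y0 else y1).
  by rewrite !big_ord_recr !big_ord0 /= !add0r !mxE /= psi1 !mul1mx !inner_hnsq.
(* Preservation of adjoints is derived: the form is real at [y0] and at i times [y0]. *)
have adj (y0 y1 : euclid R n) :
    inner (mxop (psi T') y0) y1 = cj (inner (mxop (psi T) y1) y0).
  have h1 := form y0 y1; have := form ('i%C *: y0) y1; move: h1.
  rewrite innerZr linearZ /= innerZl.
  have -> : cj ('i%C : R[i]) = - 'i%C by apply: complexP; rewrite /= ?oppr0.
  rewrite !lecE => /andP[/eqP h1 _] /andP[/eqP h2 _].
  move: h1 h2; rewrite mulNr !(ImD, ReM, ImM) ImN !(ImD, ReM, ImM) /= => h1 h2.
  by apply: complexP; rewrite ?Re_conj ?Im_conj; lra.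
have := form (- mxop (psi T) v) v; rewrite adj innerNr hnsqN inner_hnsq => /ge0_Re.
rewrite !ReD Re_conj ReN /=; lra.
Qed.

End UnitalPositiveMaps.

Section Simplex.
Variable R : realType.

(** Dividing by the total weight lets the induction drop the last point whatever its weight. *)
Lemma convex_set_sum (E : lmodType R) (C : set E) (n : nat) (w : 'I_n -> R)
    (x : 'I_n -> E) : @convex_set R E C -> (forall i, 0 <= w i) ->
  (forall i, C (x i)) -> 0 < \sum_i w i ->
  C ((\sum_i w i)^-1 *: \sum_i w i *: x i).
Proof.
move=> Cc; elim: n w x => [|n IHn] w x w0 Cx; first by rewrite big_ord0 ltxx.
rewrite !big_ord_recr /=; set S := \sum_(i < n) _; set t := w ord_max => St0.
have S0 : 0 <= S by rewrite sumr_ge0.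
move: S0; rewrite le_eqVlt => /predU1P[S0|S0].
  rewrite big1 => [|i _].
    move: St0; rewrite -S0 !add0r => t0.
    by rewrite scalerA mulVf ?gt_eqF// scale1r.
  have /psumr_eq0P wi : forall i : 'I_n, true -> 0 <= w (widen_ord (leqnSn n) i) by [].
  by rewrite (wi (esym S0) i isT) scale0r.
pose l := S / (S + t); have l0 : 0 <= l by rewrite divr_ge0// ltW.
have l1 : l <= 1 by rewrite ler_pdivrMr// mul1r lerDl; exact: w0.
have CS := IHn _ (fun i => x (widen_ord (leqnSn n) i)) (fun i => w0 _) (fun i => Cx _) S0.
have : C (l *: (S^-1 *: \sum_(i < n) w (widen_ord (leqnSn n) i) *: x (widen_ord (leqnSn n) i)) +
    (1 - l) *: x ord_max).
  have := Cc _ _ (Itv01 l0 l1) (mem_set (A := C) CS) (mem_set (A := C) (Cx ord_max)).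
  by rewrite inE.
congr C; rewrite scalerDr !scalerA; congr (_ *: _ + _ *: _).
  by rewrite /l mulrAC divff ?mul1r// gt_eqF.
rewrite /l -[X in X - _](@divff _ (S + t)) ?gt_eqF//.
by rewrite -mulrBl addrAC subrr add0r mulrC.
Qed.

Lemma mem_simplex n (x : 'rV[R]_n) : (forall k, 0 <= x 0 k) ->
  \sum_k x 0 k = 1 -> simplex x.
Proof.
move=> x0 x1 C [Cc CS].
have := @convex_set_sum _ C n (fun k => x 0 k) (fun k => delta_mx 0 k) Cc x0.
rewrite x1 invr1 scale1r -row_sum_delta; apply=> // k.
by apply: CS; right; exists k.
Qed.

Lemma simplex_bounds n (x : 'rV[R]_n) : simplex x ->
  (forall k, 0 <= x 0 k) /\ \sum_k x 0 k <= 1.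
Proof.
move=> /(_ [set x | (forall k, 0 <= x 0 k) /\ \sum_k x 0 k <= 1]); apply; split.
  move=> /= u v l; rewrite !inE => -[u0 u1] [v0 v1].
  have l0 : 0 <= l%:num by []; have l1 : 0 <= 1 - l%:num by rewrite subr_ge0.
  split=> [k|]; first by rewrite !mxE addr_ge0// mulr_ge0.
  under eq_bigr do rewrite !mxE.
  rewrite big_split /= -!mulr_sumr.
  apply: (@le_trans _ _ (l%:num * 1 + (1 - l%:num) * 1)).
    by apply: lerD; [exact: ler_wpM2l u1|exact: ler_wpM2l v1].
  by rewrite !mulr1 addrC subrK.
move=> u [->|[k _ <-]]; split=> [j|].
- by rewrite mxE.
- by rewrite big1 ?ler01// => j _; rewrite mxE.
- by rewrite mxE /= ler0n.
- rewrite (bigD1 k)//= big1 ?addr0 ?mxE ?eqxx//= => j jk.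
  by rewrite mxE (negbTE jk).
Qed.

Lemma polydiskE d (a : 'I_d -> R) (z : 'I_d -> R[i]) : (forall j, 0 < a j) ->
  polydisk a z <-> forall j, normc (z j) <= a j.
Proof.
move=> a0; split=> za j.
  have [u /= u1 <-] := za j; rewrite Normc.normcM normc_real ger0_norm ?(ltW (a0 j))//.
  by rewrite ger_pMr// -lecR -normcE.
exists ((a j)^-1%:C * z j) => /=.
  rewrite normcE lecR Normc.normcM normc_real ger0_norm ?invr_ge0 ?(ltW (a0 j))//.
  by rewrite mulrC ler_pdivrMr// mul1r.
by rewrite mulrA -realCM divff ?gt_eqF// mul1r.
Qed.

End Simplex.

Section ScalingDual.
Variables (R : realType) (d : nat) (a : 'I_d -> R).
Hypothesis a_SD : SDtuple a.

(** Removes the factor (m-1)/m of [fejer_moment]: if u + v < 0, any m > v / (u + v) contradicts the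
    hypothesis. *)
Lemma ge0_limit_frac (u v : R) :
  (forall m, (0 < m)%N -> 0 <= u + m.-1%:R / m%:R * v) -> 0 <= u + v.
Proof.
move=> h; rewrite leNgt; apply/negP => uv.
have u0 : 0 <= u by have := h 1%N isT; rewrite !mul0r addr0.
have v0 : 0 <= v / (u + v) by rewrite -mulrNN -invrN divr_ge0//; lra.
have /archi_boundP := v0; set m := Num.bound _ => vm.
have m0 : (0 < m)%N by rewrite -(ltr0n R) (le_lt_trans v0).
have mR : 0 < m%:R :> R by rewrite ltr0n.
have := h m m0; have -> : m.-1%:R = m%:R - 1 :> R.
  by rewrite -[m in RHS]prednK// -natr1 addrK.
move: vm; rewrite ltr_ndivrMr// => vm.
have -> : u + (m%:R - 1) / m%:R * v = (m%:R * (u + v) - v) / m%:R.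
  by field; rewrite gt_eqF.
by rewrite pmulr_lge0 ?invr_gt0//; lra.
Qed.

(** The moments are formed on the dual side: testing the tuple [P] against cj (w^k) A_i amounts to
    testing its moments against A_i, so the spectrum of a moment need not be computed. *)
Lemma SD_dual n (X : 'I_d -> 'M[R[i]]_n.+1) :
  (forall i (v : euclid R n.+1), hnsq (mxop (X i) v) <= hnsq v) ->
  dual_ineq (polydisk a) (fun i s t => X i t s).
Proof.
move=> Xc A0 A Apos; have [a0 SD] := a_SD.
rewrite ReD; apply: ge0_limit_frac => m m0.
have [w wP] := @prim_root_exists R m.+1 (ltn0Sn m).
have mR : (m.+1%:R * m%:R : R[i]) != 0 by rewrite -natrM pnatr_eq0 muln_eq0 -lt0n m0.
pose c : R[i] := (m.+1%:R * m%:R)^-1.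
pose P (ik : 'I_d * 'I_m.+1) : 'M[R[i]]_n.+1 := c *: fejer (X ik.1) (w ^+ ik.2) m.
have c0 : 0 <= c by rewrite invr_ge0 mulr_ge0.
have wk1 k : normc (w ^+ k) = 1 by rewrite normcX (normc_prim_root wP) expr1n.
have P0 ik (v : euclid R n.+1) : 0 <= inner (mxop (P ik) v) v.
  rewrite mxopZ bop_scaleE innerZl mulr_ge0//.
  by apply: fejer_ge0 => //; exact: Xc.
have P1 i : \sum_k P (i, k) = 1.
  rewrite -scaler_sumr (fejer_sum (X i) wP (leqnn m)) scalerA mulVf//.
  by rewrite scale1r.
have PX i : \sum_(k < m.+1) cj (w ^+ k) *: P (i, k) = (m.-1%:R / m%:R) *: X i.
  under eq_bigr do rewrite scalerA mulrC -scalerA.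
  rewrite -scaler_sumr (fejer_moment (X i) wP) ?m0 ?leqnn// scalerA; congr (_ *: _).
  by rewrite /c invfM mulrACA mulVf ?pnatr_eq0// mul1r mulrC.
(* A UCP map to 1 by 1 matrices sends the [P (i, k)] to nonnegative numbers adding up to 1 over [k],
   a point of the face of the simplex opposite to 0. *)
have PWmax : Wmax (real_prod (fun _ : 'I_d => @simplex R m.+1)) (existT _ n P).
  move=> Y [psi psiu YE]; have [psi_lin psi1 _] := psiu.
  have Y0 ik : 0 <= Y ik 0 0.
    rewrite YE -mxop_evec; apply: ucp_ge0 => // v; exact: P0.
  exists (fun j => \row_k Re (Y (j, k) 0 0)) => j; last first.
    by move=> k; rewrite mxE -ge0_complex.
  apply: mem_simplex => [k|]; first by rewrite mxE ge0_Re.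
  under eq_bigr do rewrite mxE YE.
  rewrite -Re_sum -summxE.
  have psi0 : psi 0 = 0 by have := psi_lin (-1) 0 0; rewrite scaler0 add0r scaleN1r addNr.
  have psiD : {morph psi : S T / S + T}.
    by move=> S T; have := psi_lin 1 S T; rewrite !scale1r.
  rewrite -(big_morph psi psiD psi0) -[X in psi X](mxop_sum _ _ (fun k => P (j, k))).
  by rewrite P1 mxop1 psi1 mxE.
have pairE (F : 'I_d -> 'I_m.+1 -> R[i]) :
    \sum_ik F ik.1 ik.2 = \sum_i \sum_k F i k by rewrite pair_bigA.
have := Wmin_dual (SD m.+1 isT _ PWmax).
move=> /(_ A0 (fun (ik : 'I_d * 'I_m.+1) s t => cj (w ^+ ik.2) * A ik.1 s t)).
have pos z : real_prod (fun j => [set a j *: x | x in @diamond R m.+1]) z ->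
    form_pos (fun s t => A0 s t + \sum_(ik : 'I_d * 'I_m.+1) z ik * (cj (w ^+ ik.2) * A ik.1 s t)).
  (* The moment of a point of the diamonds. Since |w| = 1, its modulus is at most the l^1 norm,
     hence at most [a i]. *)
  move=> [x xa zx]; pose zeta i := \sum_(k < m.+1) z (i, k) * cj (w ^+ k).
  have /Apos : polydisk a zeta.
    apply/polydiskE => // i; rewrite (le_trans (normc_sum _ _ _))//.
    have [y /= y1 yx] := xa i.
    rewrite (@le_trans _ _ (a i * \sum_k `|y 0 k|))//; last first.
      by rewrite ger_pMr.
    rewrite mulr_sumr; apply: ler_sum => k _.
    rewrite Normc.normcM normc_conj wk1 mulr1 zx normc_real -yx mxE normrM.
    by rewrite ger0_norm// ltW.
  congr form_pos; apply/funext => s; apply/funext => t; congr (_ + _).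
  transitivity (\sum_i \sum_(k < m.+1) z (i, k) * (cj (w ^+ k) * A i s t)).
    by apply: eq_bigr => i _; rewrite mulr_suml; apply: eq_bigr => k _; rewrite mulrA.
  by rewrite -pairE; apply: eq_bigr => -[].
move=> /(_ pos).
have -> : \sum_(ik : 'I_d * 'I_m.+1) \sum_s \sum_t (cj (w ^+ ik.2) * A ik.1 s t) * P ik t s =
   (m.-1%:R / m%:R)%:C * \sum_i \sum_s \sum_t A i s t * X i t s.
  transitivity (\sum_i \sum_(k < m.+1) \sum_s \sum_t (cj (w ^+ k) * A i s t) * P (i, k) t s).
    by rewrite -pairE; apply: eq_bigr => -[].
  rewrite mulr_sumr; apply: eq_bigr => i _; rewrite exchange_big mulr_sumr.
  apply: eq_bigr => s _; rewrite exchange_big mulr_sumr; apply: eq_bigr => t _ /=.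
  have -> : (m.-1%:R / m%:R)%:C * (A i s t * X i t s) =
      A i s t * ((m.-1%:R / m%:R) *: X i) t s.
    rewrite mxE mulrCA; congr (_ * (_ * _)).
    by rewrite rmorphM fmorphV !rmorph_nat.
  rewrite -PX summxE mulr_sumr; apply: eq_bigr => k _.
  rewrite [X in _ = _ * X](_ : _ = cj (w ^+ k) * P (i, k) t s); last by rewrite mxE.
  by rewrite mulrA [cj _ * _]mulrC.
by rewrite ReD Re_realM.
Qed.

End ScalingDual.

(** * The matrix range, and dilations on finite-dimensional spaces *)

Section FiniteDilations.
Variable R : realType.

Lemma ultrafilter_oo : exists U : set_system nat, UltraFilter U /\ \oo `<=` U.
Proof. exact: ultraFilterLemma. Qed.

Lemma is_ulim_normc_le (T : Type) (U : set_system T) (f : T -> R[i]) c (M : R) :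
  UltraFilter U -> (forall t, normc (f t) <= M) -> is_ulim U f c -> normc c <= M.
Proof.
move=> UU fM fc; have M0 : 0 <= M.
  have [t _] := @filter_ex _ U _ _ (filterT : U setT).
  exact: le_trans (normc_ge0 _) (fM t).
rewrite -(@ler_pXn2r _ 2)// ?nnegrE ?normc_ge0//.
have := is_ulimM UU fc (is_ulim_conj UU fc) => lim.
rewrite -[leLHS]/(Re (normc c ^+ 2)%:C) -mulr_conj.
apply: is_ulim_le lim; apply: filterS filterT => t _ /=.
by rewrite mulr_conj /= ler_pXn2r ?nnegrE ?normc_ge0.
Qed.

Variables (d : nat) (a : 'I_d -> R).
Hypothesis a_SD : SDtuple a.

Let a_gt0 i : 0 < a i. Proof. by have [] := a_SD. Qed.

Lemma SD_diag_rep n (X : 'I_d -> 'M[R[i]]_n.+1) :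
  (forall i (v : euclid R n.+1), hnsq (mxop (X i) v) <= hnsq v) ->
  diag_rep (polydisk a) (fun i s t => X i t s).
Proof.
move=> Xc; have [U [UU Uoo]] := ultrafilter_oo.
apply: (dual_diag_rep UU Uoo); last exact: SD_dual.
  move=> s l sK sl; apply/polydiskE => // i.
  by apply: (is_ulim_normc_le UU _ (sl i)) => m; have /polydiskE := sK m; apply.
exists (\sum_i a i) => z i /polydiskE zi; rewrite (le_trans (zi _ _))//.
by rewrite (bigD1 i)//= lerDl sumr_ge0// => j _; exact: ltW.
Qed.

Lemma opnorm_le1 (H K : hilbertType R) (T : bop H K) : opnorm T <= 1 ->
  forall x, hnsq (T x) <= hnsq x.
Proof.
move=> T1 x; rewrite -!sqr_hnorm ler_pXn2r ?nnegrE ?hnorm_ge0//.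
by rewrite (le_trans (le_opnorm T x))// ler_piMl ?hnorm_ge0.
Qed.

Variables (H : hilbertType R) (T : 'I_d -> bop H H).
Hypothesis T_contr : forall i, opnorm (T i) <= 1.

Lemma matrix_range_Wmin : matrix_range T `<=` Wmin (polydisk a).
Proof.
move=> X [psi psiu XE]; apply: diag_rep_Wmin; apply: SD_diag_rep => i v.
by rewrite XE; apply: ucp_contraction => //; exact: opnorm_le1.
Qed.

Lemma bessel n (f : 'I_n -> H) x :
  (forall j k, inner (f j) (f k) = (j == k)%:R) ->
  \sum_j normc (inner x (f j)) ^+ 2 <= hnsq x.
Proof.
move=> fo; rewrite -subr_ge0.
have := hnsq_ge0 (x - \sum_j inner x (f j) *: f j); rewrite hnsqD hnsqN innerNr inner_sumr.
under [X in - X]eq_bigr do rewrite innerZr mulrC mulr_conj.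
rewrite ReN Re_sum /=.
have -> : hnsq (\sum_j inner x (f j) *: f j) = \sum_j normc (inner x (f j)) ^+ 2.
  rewrite /hnsq inner_suml Re_sum; apply: eq_bigr => j _.
  rewrite innerZl inner_sumr (bigD1 j)//= big1 ?addr0 => [|k kj].
    by rewrite innerZr fo eqxx mulr1 mulr_conj.
  by rewrite innerZr fo eq_sym (negbTE kj) mulr0.
lra.
Qed.

(** [V] is exact only on the subspace [D] containing [s], but it is a contraction on all of [H], so
    that for a fixed [x] the vectors [V x] stay bounded as [s] varies. *)
Lemma partial_dilation (s : seq H) : exists (p : nat) (V : bop H (euclid R p))
    (z : 'I_p -> 'I_d -> R[i]) (D : set H),
  [/\ forall j i, normc (z j i) <= a i, forall x, hnsq (V x) <= hnsq x,
      [/\ forall x, x \in s -> D x, D 0 &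
        forall c x y, D x -> D y -> D (c *: x + y)],
      forall x y, D x -> D y -> inner (V x) (V y) = inner x y &
      forall i x y, D x -> D y -> inner (dop (z^~ i) (V x)) (V y) = inner (T i x) y].
Proof.
have [r [f0 [fo fs]]] := orthonormalize (@inner_ge0 R H) s.
pose f (j : 'I_r) := f0 j.
have {}fo j k : inner (f j) (f k) = (j == k)%:R by exact: fo.
pose D := [set x | x = \sum_j inner x (f j) *: f j].
have Ds x : x \in s -> D x by move=> /fs/hnsq_eq0/subr0_eq.
have Dlin c x y : D x -> D y -> D (c *: x + y).
  rewrite /D /= => xD yD; rewrite {1}xD {1}yD scaler_sumr -big_split /=.
  by apply: eq_bigr => j _; rewrite innerDl innerZl scalerA -scalerDl.
have D0 : D 0.
  by rewrite /D /= big1// => j _; rewrite [inner 0 _]ip0l scale0r.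
have TD i x y : D x -> D y -> inner (T i x) y =
    \sum_j \sum_k (inner x (f j) * cj (inner y (f k))) * inner (T i (f j)) (f k).
  rewrite /D /= => xD yD; rewrite {1}xD {1}yD. rewrite (linear_sum (T i)) /= inner_suml.
  apply: eq_bigr => j _; rewrite inner_sumr; apply: eq_bigr => k _.
  by rewrite (linearZ_LR (T i)) /= innerZl innerZr mulrA.
have xyD x y : D x -> D y -> inner x y = \sum_j inner x (f j) * cj (inner y (f j)).
  rewrite /D /= => xD _; rewrite {1}xD inner_suml; apply: eq_bigr => j _.
  by rewrite innerZl [inner (f j) y]innerC.
(* The compressions of the [T i] to the span of the [f j] are contractive matrices; an empty family
   is treated apart because [SD_diag_rep] concerns matrices of positive size. *)
have [p [z [u [zK uu XE]]]] : exists p (z : 'I_p -> 'I_d -> R[i]) (u : 'I_p -> 'I_r -> R[i]),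
    [/\ forall j i, normc (z j i) <= a i,
        forall s t, \sum_j u j s * cj (u j t) = (s == t)%:R &
        forall i s t, inner (T i (f s)) (f t) = \sum_j z j i * (u j s * cj (u j t))].
  case: (r) f fo {D Ds D0 Dlin TD xyD fs} => [|n] f fo.
    by exists 0%N, (fun _ _ => 0), (fun _ _ => 0); split; [case|case|move=> i []].
  pose X i : 'M[R[i]]_n.+1 := \matrix_(s, t) inner (T i (f t)) (f s).
  have Xc i (v : euclid R n.+1) : hnsq (mxop (X i) v) <= hnsq v.
    pose x := \sum_t v t 0 *: f t.
    have vx : hnsq x = hnsq v.
      rewrite /hnsq inner_euclid inner_suml; congr Re; apply: eq_bigr => j _.
      rewrite innerZl inner_sumr (bigD1 j)//= big1 ?addr0 => [|k kj].
        by rewrite innerZr fo eqxx mulr1.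
      by rewrite innerZr fo eq_sym (negbTE kj) mulr0.
    rewrite -vx (le_trans _ (opnorm_le1 (T_contr i) x))//.
    apply: le_trans (bessel (T i x) fo); rewrite /hnsq inner_euclid Re_sum.
    apply: ler_sum => j _; rewrite mulr_conj /= mxE /x (linear_sum (T i)) /= inner_suml.
    rewrite le_eqVlt; apply/orP; left; apply/eqP; congr (normc _ ^+ 2).
    by apply: eq_bigr => k _; rewrite mxE (linearZ_LR (T i)) /= innerZl mulrC.
  have [p [z [u [zK uu XE]]]] := SD_diag_rep Xc.
  exists p, z, u; split=> //.
    by move=> j; apply/polydiskE.
  by move=> i s' t; rewrite -XE mxE.
have [V VE] := coordinate_map f uu.
have VV x y : inner (V x) (V y) = \sum_j inner x (f j) * cj (inner y (f j)).
  rewrite -[V x]/(bop1 _ (V x)) -dop1 VE; apply: eq_bigr => j _.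
  have uu1 s' t : \sum_j 1 * (u j s' * cj (u j t)) = (s' == t)%:R.
    by under eq_bigr do rewrite mul1r; exact: uu.
  under eq_bigr do rewrite uu1.
  rewrite (bigD1 j)//= eqxx mulr1 big1 ?addr0// => k kj.
  by rewrite eq_sym (negbTE kj) mulr0.
exists p, V, z, D; split=> //.
- move=> x; apply: le_trans (bessel x fo); rewrite /hnsq VV Re_sum.
  by apply: ler_sum => j _; rewrite mulr_conj.
- by move=> x y Dx Dy; rewrite VV xyD.
move=> i x y Dx Dy; rewrite VE TD//; apply: eq_bigr => j _; apply: eq_bigr => k _.
by rewrite XE.
Qed.

Lemma finite_dim_euclid p : finite_dim (euclid R p).
Proof.
exists p, (@evec R p) => x; exists (fun k => x k 0); apply/colP => k.
rewrite summxE (bigD1 k)//= big1 ?addr0; first by rewrite !mxE !eqxx mulr1.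
by move=> j jk; rewrite !mxE eq_sym (negbTE jk) mulr0.
Qed.

Lemma finite_dim_dilation : finite_dim H ->
  exists (K : hilbertType R) (N : 'I_d -> bop K K),
    [/\ normal_tuple N, dilates N T, forall i, opnorm (N i) <= a i & finite_dim K].
Proof.
move=> [n [e eP]].
have [p [V [z [D [za _ [Ds D0 Dlin] VV VT]]]]] := partial_dilation (codom e).
have DH x : D x.
  have [c ->] := eP x.
  elim/big_rec: _ => [//|k y _ Dy]; apply: Dlin => //.
  by apply: Ds; exact: codom_f.
exists (euclid R p), (fun i => dop (z^~ i)); split.
- exact: normal_tuple_dop.
- apply: (@dilatesP _ _ _ _ _ _ V) => [|i x y]; last exact: VT.
  by apply: op_isometryP => x y; exact: VV.
- by move=> i; apply: opnorm_dop => //; exact: ltW.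
exact: finite_dim_euclid.
Qed.

End FiniteDilations.

(** * Ultraproducts of Hilbert spaces *)

(** Completeness is asked along sequences of geometric speed; the constant 16 is the one obtained
    for sections of an ultraproduct in [uip_complete]. *)
Record semiHilbert (R : realType) := SemiHilbert {
  sh_car : lmodType R[i];
  sh_ip : {hermitian sh_car for false & (@Num.conj R[i])};
  sh_ge0 : forall x, 0 <= sh_ip x x;
  sh_complete : forall x : nat -> sh_car,
    (forall k, nsq sh_ip (x k.+1 - x k) <= (4^-1) ^+ k) ->
    exists y, forall k, nsq sh_ip (y - x k) <= 16 * (4^-1) ^+ k
}.

Lemma sqr_geometric (R : realType) (c : R) k :
  (c * (2^-1) ^+ k) ^+ 2 = c ^+ 2 * (4^-1) ^+ k.
Proof. by rewrite exprMn -exprM mulnC exprM [2^-1 ^+ 2]expr2 -invfM -natrM. Qed.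

Section HilbertQuotient.
Variables (R : realType) (S : semiHilbert R).
Local Notation E := (sh_car S).
Local Notation ip := (@sh_ip R S).
Local Notation ge0 := (@sh_ge0 R S).

Definition nullrel : rel E := fun x y => nsq ip (x - y) == 0.

Lemma nullrel_refl : reflexive nullrel.
Proof. by move=> x; rewrite /nullrel subrr nsq0. Qed.

Lemma nullrel_sym : symmetric nullrel.
Proof. by move=> x y; rewrite /nullrel nsqBC. Qed.

Lemma nullrel_trans : transitive nullrel.
Proof.
move=> y x z /eqP xy /eqP yz; rewrite /nullrel -(subrKA y) eq_le (nsq_ge0 ge0) andbT.
by rewrite (le_trans (nsqD_le ge0 _ _))// xy yz addr0 mulr0.
Qed.

Local Open Scope quotient_scope.

Canonical nullrel_equiv := EquivRel nullrel nullrel_refl nullrel_sym nullrel_trans.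

Definition hquot := {eq_quot nullrel}.
HB.instance Definition _ : EqQuotient _ nullrel hquot := EqQuotient.on hquot.
HB.instance Definition _ := Choice.on hquot.

Local Notation "\p x" := (\pi_hquot x) (at level 8, x at level 8).

Lemma hquotP x y : nsq ip (x - y) = 0 <-> \p x = \p y.
Proof. by split=> [xy|/eqP]; [apply/eqP|]; rewrite eqmodE; [rewrite /= /nullrel xy|move/eqP]. Qed.

Lemma hquot_repr (u : hquot) : \p (repr u) = u. Proof. exact: reprK. Qed.

Lemma repr_null x : nsq ip (repr (\p x) - x) = 0.
Proof. by apply/hquotP; rewrite hquot_repr. Qed.

Definition hq_add (u v : hquot) : hquot := \p (repr u + repr v).
Definition hq_opp (u : hquot) : hquot := \p (- repr u).
Definition hq_scale c (u : hquot) : hquot := \p (c *: repr u).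

Lemma nsq_add0 x y : nsq ip x = 0 -> nsq ip y = 0 -> nsq ip (x + y) = 0.
Proof.
move=> x0 y0; apply/eqP; rewrite eq_le (nsq_ge0 ge0) andbT.
by rewrite (le_trans (nsqD_le ge0 _ _))// x0 y0 addr0 mulr0.
Qed.

Lemma hq_addE x y : hq_add (\p x) (\p y) = \p (x + y).
Proof.
apply/hquotP; rewrite opprD addrACA; apply: nsq_add0; exact: repr_null.
Qed.

Lemma hq_oppE x : hq_opp (\p x) = \p (- x).
Proof. by apply/hquotP; rewrite -opprD nsqN repr_null. Qed.

Lemma hq_scaleE c x : hq_scale c (\p x) = \p (c *: x).
Proof. by apply/hquotP; rewrite -scalerBr nsqZ repr_null mulr0. Qed.

Lemma hq_addA : associative hq_add.
Proof.
move=> u v t; rewrite -(hquot_repr u) -(hquot_repr v) -(hquot_repr t).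
by rewrite !hq_addE addrA.
Qed.

Lemma hq_addC : commutative hq_add.
Proof. by move=> u v; rewrite /hq_add addrC. Qed.

Lemma hq_add0 : left_id (\p 0) hq_add.
Proof. by move=> u; rewrite -(hquot_repr u) hq_addE add0r. Qed.

Lemma hq_addN : left_inverse (\p 0) hq_opp hq_add.
Proof. by move=> u; rewrite -(hquot_repr u) hq_oppE hq_addE addNr. Qed.

HB.instance Definition _ := GRing.isZmodule.Build hquot hq_addA hq_addC hq_add0 hq_addN.

Lemma hq_scaleA a b u : hq_scale a (hq_scale b u) = hq_scale (a * b) u.
Proof. by rewrite -(hquot_repr u) !hq_scaleE scalerA. Qed.

Lemma hq_scale1 : left_id 1 hq_scale.
Proof. by move=> u; rewrite -(hquot_repr u) hq_scaleE scale1r. Qed.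

Lemma hq_scaleDr : right_distributive hq_scale +%R.
Proof.
move=> c u v; rewrite -(hquot_repr u) -(hquot_repr v).
rewrite -[\p _ + \p _]/(hq_add _ _) -[RHS]/(hq_add _ _).
by rewrite !(hq_addE, hq_scaleE) scalerDr.
Qed.

Lemma hq_scaleDl u : {morph hq_scale^~ u : a b / a + b}.
Proof.
move=> a b; rewrite -(hquot_repr u) -[RHS]/(hq_add _ _).
by rewrite !hq_scaleE hq_addE scalerDl.
Qed.

HB.instance Definition _ := GRing.Zmodule_isLmodule.Build R[i] hquot
  hq_scaleA hq_scale1 hq_scaleDr hq_scaleDl.

Lemma pi_lin c x y : \p (c *: x + y) = c *: \p x + \p y.
Proof. by rewrite -hq_addE -hq_scaleE. Qed.

Lemma piB x y : \p (x - y) = \p x - \p y.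
Proof. by rewrite -hq_addE -hq_oppE. Qed.

Definition hq_ip (u v : hquot) : R[i] := ip (repr u) (repr v).

Lemma hq_ipE x y : hq_ip (\p x) (\p y) = ip x y.
Proof.
rewrite /hq_ip -[repr (\p x)](subrK x) ipDl (nsq0_ip ge0) ?repr_null// add0r.
by rewrite -[repr (\p y)](subrK y) ipDr ipC (nsq0_ip ge0) ?repr_null// rmorph0 add0r.
Qed.

Lemma nsq_hq_ip x : Re (hq_ip (\p x) (\p x)) = nsq ip x.
Proof. by rewrite hq_ipE. Qed.

Lemma hq_ip_linearl v : GRing.linear_for *%R (hq_ip^~ v).
Proof.
move=> c x y; rewrite -(hquot_repr v) -(hquot_repr x) -(hquot_repr y) -pi_lin !hq_ipE.
by rewrite ipDl ipZl.
Qed.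

Lemma hq_ip_linearr v : GRing.linear_for (Num.conj \; *%R) (hq_ip v).
Proof.
move=> c x y; rewrite -(hquot_repr v) -(hquot_repr x) -(hquot_repr y) -pi_lin !hq_ipE.
by rewrite ipDr ipZr.
Qed.

HB.instance Definition _ := bilinear_isBilinear.Build R[i] hquot hquot R[i]
  *%R (Num.conj \; *%R) hq_ip (hq_ip_linearl, hq_ip_linearr).

Lemma hq_ip_hermitian u v : hq_ip u v = (-1) ^+ false * cj (hq_ip v u).
Proof. by rewrite expr0 mul1r /hq_ip ipC. Qed.

HB.instance Definition _ := isHermitianSesquilinear.Build _ _ _ _ hq_ip
  hq_ip_hermitian.

Lemma hq_ip_gt0 u : u != 0 -> 0 < hq_ip u u.
Proof.
rewrite lt_def ge0 andbT; apply: contra => /eqP u0.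
rewrite -(hquot_repr u); apply/eqP/hquotP; rewrite subr0.
by rewrite /nsq -/(hq_ip u u) u0.
Qed.

HB.instance Definition _ := isDotProduct.Build _ _ hq_ip hq_ip_gt0.

Lemma hq_ip_ge0 u : 0 <= hq_ip u u. Proof. exact: ge0. Qed.

Lemma nsq_pi x : nsq hq_ip (\p x) = nsq ip x.
Proof. exact: nsq_hq_ip. Qed.

Definition hq_norm (u : hquot) : R[i] := (Num.sqrt (nsq hq_ip u))%:C.

Lemma hq_normD u v : hq_norm (u + v) <= hq_norm u + hq_norm v.
Proof. by rewrite /hq_norm -(rmorphD (real_complex R)) lecR sqrt_nsqD//; exact: hq_ip_ge0. Qed.

Lemma hq_normZ c u : hq_norm (c *: u) = `|c| * hq_norm u.
Proof.
rewrite /hq_norm nsqZ normcE -realCM sqrtrM ?sqr_ge0// sqrtr_sqr.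
by rewrite ger0_norm ?normc_ge0.
Qed.

Lemma hq_norm_eq0 u : hq_norm u = 0 -> u = 0.
Proof.
move=> /(@complexI R) /eqP; rewrite sqrtr_eq0 => u0; apply/eqP.
apply: contraT => /hq_ip_gt0; rewrite ltcE => /andP[_].
by rewrite ltNge u0.
Qed.

HB.instance Definition _ := Lmodule_isNormed.Build R[i] hquot
  hq_normD hq_normZ hq_norm_eq0.

Lemma hq_normE (u : hquot) : hq_ip u u = `|u| ^+ 2.
Proof.
rewrite -[`|u|]/(hq_norm u) -rmorphXn sqr_sqrtr; last by apply: nsq_ge0; exact: hq_ip_ge0.
by apply: ge0_complex; exact: hq_ip_ge0.
Qed.

(** The filter is reduced to a sequence: [u k] is within 2^-k / 2 of all points of some set of [F],
    and two such sets meet, so consecutive terms are within 2^-k of each other. *)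
Lemma hq_complete (F : set_system hquot) : ProperFilter F -> cauchy F -> cvg F.
Proof.
move=> FF /cauchy_ballP cF.
pose r k : R := (2^-1) ^+ k / 2.
have r0 k : 0 < r k by rewrite divr_gt0// exprn_gt0// invr_gt0.
have near k : exists u : hquot, F [set v | Num.sqrt (nsq hq_ip (u - v)) < r k].
  have rC : 0 < (r k)%:C :> R[i] by rewrite ltcR.
  have [A [B [FA FB AB]]] : exists A B, [/\ F A, F B &
      forall a b, A a -> B b -> ball a (r k)%:C b].
    have [[A B] /= [FA FB] AB] := cF _ rC.
    by exists A, B; split=> // a b Aa Bb; exact: (AB (a, b)).
  have [u Au] := filter_ex FA; exists u; apply: filterS FB => v Bv /=.
  by have := AB _ _ Au Bv; rewrite -ball_normE /= -[`|_|]/(hq_norm _) ltcR.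
have [u uP] := choice near.
have sq (x y : R) : 0 <= x -> 0 <= y -> (x <= y) = (x ^+ 2 <= y ^+ 2).
  by move=> x0 y0; rewrite ler_pXn2r.
have nge0 v : 0 <= nsq hq_ip v by apply: nsq_ge0; exact: hq_ip_ge0.
have step k : nsq hq_ip (u k.+1 - u k) <= (4^-1) ^+ k.
  have [v [/= v1 v2]] := @filter_ex _ F _ _ (filterI (uP k.+1) (uP k)).
  have h : Num.sqrt (nsq hq_ip (u k.+1 - u k)) <= (2^-1) ^+ k.
    rewrite -(subrKA v) (le_trans (sqrt_nsqD hq_ip_ge0 _ _))//.
    rewrite (le_trans (lerD (ltW v1) _) (_ : r k.+1 + r k <= _))//.
      by rewrite nsqBC ltW.
    by rewrite /r exprS; have : 0 < (2^-1 : R) ^+ k; [rewrite exprn_gt0|lra].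
  rewrite -[leLHS]sqr_sqrtr// (le_trans (_ : _ <= ((2^-1) ^+ k) ^+ 2))//.
    by rewrite -sq ?sqrtr_ge0// exprn_ge0.
  by have := @sqr_geometric R 1 k; rewrite mul1r expr1n mul1r => ->.
have [y yP] : exists y : hquot, forall k, nsq hq_ip (y - u k) <= 16 * (4^-1) ^+ k.
  have [|y yP] := @sh_complete R S (fun k => repr (u k)).
    by move=> k; rewrite -nsq_pi piB !hquot_repr.
  exists (\p y) => k; have := yP k.
  by rewrite -nsq_pi piB hquot_repr.
apply/cvg_ex; exists y; apply/cvgrPdist_lt => e e0.
have eE : e = (Re e)%:C by apply: ge0_complex; exact: ltW.
have {}e0 : 0 < Re e by rewrite -ltcR -eE.
(* 5 = 4 + 1, with 4 the square root of the constant 16 in [yP] and 1 a bound for the contribution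
   of [uP]. *)
have [k ke] : exists k, 5 * (2^-1) ^+ k < Re e.
  apply: contrapT => /forallNP ne.
  suff : Re e ^+ 2 <= 0 by rewrite leNgt exprn_gt0.
  apply: (@le_geometric0 _ _ (5 ^+ 2)) => k.
  have := ne k => /negP; rewrite -leNgt => ek.
  apply: (@le_trans _ _ ((5 * 2^-1 ^+ k) ^+ 2)).
    by rewrite -sq ?mulr_ge0 ?exprn_ge0 ?invr_ge0// ltW.
  by rewrite sqr_geometric.
apply: filterS (uP k) => v /= vk.
rewrite -[`|_|]/(hq_norm _) eE ltcR -(subrKA (u k)).
rewrite (le_lt_trans (sqrt_nsqD hq_ip_ge0 _ _))//.
apply: le_lt_trans ke; rewrite (_ : 5 = 4 + 1 :> R); last by rewrite natr1.
rewrite mulrDl mul1r lerD//; last first.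
  rewrite (le_trans (ltW vk))// /r.
  by have : 0 < (2^-1 : R) ^+ k; [rewrite exprn_gt0|lra].
rewrite sq ?sqrtr_ge0 ?mulr_ge0 ?exprn_ge0// sqr_sqrtr// (le_trans (yP k))//.
by rewrite sqr_geometric [4 ^+ 2]expr2 -natrM.
Qed.

HB.instance Definition _ := Uniform_isComplete.Build hquot hq_complete.

HB.instance Definition _ := CompleteNormedModule_isHilbert.Build R hquot hq_normE.

End HilbertQuotient.

Section BoundedSections.
Variables (R : realType) (J : Type) (L : J -> hilbertType R).

Record bsec := BSec {
  bsec_fun :> forall s, L s;
  bsec_bounded : exists M : R, forall s, hnsq (bsec_fun s) <= M
}.

HB.instance Definition _ := gen_eqMixin bsec.
HB.instance Definition _ := gen_choiceMixin bsec.

Lemma bsecP (f g : bsec) : (forall s, f s = g s) -> f = g.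
Proof.
case: f g => [f fb] [g gb] /= fg.
have e : f = g by apply: functional_extensionality_dep.
by case: _ / e gb => gb; congr BSec; exact: Prop_irrelevance.
Qed.

Lemma bsec_add_subproof (f g : bsec) :
  exists M : R, forall s, hnsq (f s + g s) <= M.
Proof.
have [M fM] := bsec_bounded f; have [N gN] := bsec_bounded g.
exists (2 * (M + N)) => s; rewrite (le_trans (nsqD_le (@inner_ge0 _ _) _ _))//.
by rewrite ler_pM2l// lerD ?fM ?gN.
Qed.

Lemma bsec_scale_subproof c (f : bsec) :
  exists M : R, forall s, hnsq (c *: f s) <= M.
Proof.
have [M fM] := bsec_bounded f; exists (normc c ^+ 2 * M) => s.
by rewrite [leLHS]nsqZ ler_wpM2l ?sqr_ge0 ?fM.
Qed.

Lemma bsec_zero_subproof : exists M : R, forall s, hnsq (0 : L s) <= M.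
Proof. by exists 0 => s; rewrite hnsq0. Qed.

Definition bsec_add f g := BSec (bsec_add_subproof f g).
Definition bsec_scale c f := BSec (bsec_scale_subproof c f).
Definition bsec_zero := BSec bsec_zero_subproof.
Definition bsec_opp f := bsec_scale (-1) f.

Lemma bsec_addA : associative bsec_add.
Proof. by move=> f g h; apply: bsecP => s /=; rewrite addrA. Qed.

Lemma bsec_addC : commutative bsec_add.
Proof. by move=> f g; apply: bsecP => s /=; rewrite addrC. Qed.

Lemma bsec_add0 : left_id bsec_zero bsec_add.
Proof. by move=> f; apply: bsecP => s /=; rewrite add0r. Qed.

Lemma bsec_addN : left_inverse bsec_zero bsec_opp bsec_add.
Proof. by move=> f; apply: bsecP => s /=; rewrite scaleN1r addNr. Qed.

HB.instance Definition _ := GRing.isZmodule.Build bsec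
  bsec_addA bsec_addC bsec_add0 bsec_addN.

Lemma bsec_scaleA a b f : bsec_scale a (bsec_scale b f) = bsec_scale (a * b) f.
Proof. by apply: bsecP => s /=; rewrite scalerA. Qed.

Lemma bsec_scale1 : left_id 1 bsec_scale.
Proof. by move=> f; apply: bsecP => s /=; rewrite scale1r. Qed.

Lemma bsec_scaleDr : right_distributive bsec_scale +%R.
Proof. by move=> c f g; apply: bsecP => s /=; rewrite scalerDr. Qed.

Lemma bsec_scaleDl f : {morph bsec_scale^~ f : a b / a + b}.
Proof. by move=> a b; apply: bsecP => s /=; rewrite scalerDl. Qed.

HB.instance Definition _ := GRing.Zmodule_isLmodule.Build R[i] bsec
  bsec_scaleA bsec_scale1 bsec_scaleDr bsec_scaleDl.

Lemma bsecD (f g : bsec) s : (f + g) s = f s + g s. Proof. by []. Qed.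
Lemma bsecZ c (f : bsec) s : (c *: f) s = c *: f s. Proof. by []. Qed.

Variable U : set_system J.
Hypothesis UU : UltraFilter U.

(** The default 0 is not met in [uip], since inner products of bounded sections do converge along
    [U] ([uipP]). *)
Definition ulim (f : J -> R[i]) : R[i] := xget 0 [set c | is_ulim U f c].

Definition uip (f g : bsec) : R[i] := ulim (fun s => inner (f s) (g s)).

Lemma uipP (f g : bsec) : is_ulim U (fun s => inner (f s) (g s)) (uip f g).
Proof.
have [M fM] := bsec_bounded f; have [N gN] := bsec_bounded g.
have [|c cP] := @is_ulim_exists _ _ _ UU (fun s => inner (f s) (g s)) (Num.sqrt (M * N)).
  move=> s; rewrite -[leLHS]ger0_norm ?normc_ge0// -sqrtr_sqr ler_wsqrtr//.
  by rewrite (le_trans (inner_CS _ _))// ler_pM ?hnsq_ge0 ?fM ?gN.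
by rewrite /uip /ulim; apply: (@xgetPex _ _ [set c | is_ulim U _ c]); exists c.
Qed.

Lemma uipE (f g : bsec) c : is_ulim U (fun s => inner (f s) (g s)) c -> uip f g = c.
Proof. exact: is_ulim_unique (uipP f g). Qed.

Lemma uip_linearl g : GRing.linear_for *%R (uip^~ g).
Proof.
move=> c x y; apply: uipE; under eq_fun do rewrite bsecD bsecZ innerDl innerZl.
by apply: is_ulimD; [apply: is_ulimZ|]; exact: uipP.
Qed.

Lemma uip_linearr f : GRing.linear_for (Num.conj \; *%R) (uip f).
Proof.
move=> c x y; apply: uipE; under eq_fun do rewrite bsecD bsecZ innerDr innerZr.
by apply: is_ulimD; [apply: is_ulimZ|]; exact: uipP.
Qed.

HB.instance Definition _ := bilinear_isBilinear.Build R[i] bsec bsec R[i]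
  *%R (Num.conj \; *%R) uip (uip_linearl, uip_linearr).

Lemma uip_hermitian f g : uip f g = (-1) ^+ false * cj (uip g f).
Proof.
rewrite expr0 mul1r; apply: uipE; under eq_fun do rewrite innerC.
by apply: is_ulim_conj; exact: uipP.
Qed.

HB.instance Definition _ := isHermitianSesquilinear.Build _ _ _ _ uip uip_hermitian.

Lemma uip_ge0 (f : bsec) : 0 <= uip f f.
Proof.
rewrite lecE /=; apply/andP; split.
  apply/eqP/(is_ulim_real UU _ (uipP f f)) => s.
  by rewrite inner_hnsq.
apply: is_ulim_ge (uipP f f); apply: filterS filterT => s _ /=.
exact: hnsq_ge0.
Qed.

Lemma nsq_uip_le (f : bsec) (c : R) : U [set s | hnsq (f s) <= c] -> nsq uip f <= c.
Proof. by move=> fc; apply: is_ulim_le (uipP f f). Qed.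

Lemma nsq_uip_lt (f : bsec) (c : R) : nsq uip f < c -> U [set s | hnsq (f s) < c].
Proof.
move=> fc; have d0 : 0 < c - nsq uip f by rewrite subr_gt0.
apply: filterS (uipP f f d0) => s /= sd.
have := Re_le_normc (inner (f s) (f s) - uip f f).
move=> /le_lt_trans/(_ sd); rewrite ReB -/(hnsq (f s)) -[Re (uip f f)]/(nsq uip f).
by rewrite ltrD2r.
Qed.

(* Modifying the terms of a fast Cauchy sequence off large sets makes it
   uniformly Cauchy, so that its limit can be taken fibrewise. *)
Lemma uip_complete (x : nat -> bsec) :
  (forall k, nsq uip (x k.+1 - x k) <= (4^-1) ^+ k) ->
  exists y, forall k, nsq uip (y - x k) <= 16 * (4^-1) ^+ k.
Proof.
move=> xx; have q0 k : 0 < (4^-1) ^+ k :> R by rewrite exprn_gt0// invr_gt0.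
pose G k := [set s | hnsq (x k.+1 s - x k s) < 4 * (4^-1) ^+ k].
have UG k : U (G k).
  have := @nsq_uip_lt (x k.+1 - x k) (4 * (4^-1) ^+ k).
  rewrite (le_lt_trans (xx k)); last by rewrite ltr_pMl// ltr1n.
  move=> /(_ isT); by apply: filterS => s /=; rewrite scaleN1r.
pose x' s := fix x' k : L s := if k is k.+1 then
  x' k + (if `[< G k s >] then x k.+1 s - x k s else 0) else x 0%N s.
have x'S s k : hnsq (x' s k.+1 - x' s k) <= 4 * (4^-1) ^+ k.
  rewrite /= addrAC subrr add0r; case: asboolP => [/ltW//|_].
  by rewrite hnsq0 mulr_ge0// ltW.
have x'E k : U [set s | x' s k = x k s].
  elim: k => [|k IHk]; first by apply: filterS filterT.
  apply: filterS2 IHk (UG k) => s /= -> Gs.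
  by rewrite asboolT// addrC subrK.
have yex s : exists y : L s, forall k, hnsq (y - x' s k.+1) <= 4 * (4^-1) ^+ k.
  (* The index is shifted because the steps of [x'] are bounded by 4 * 4^-k whereas [cauchy_fast]
     wants 4^-k. *)
  apply: (@cauchy_fast _ _ (fun k => x' s k.+1)) => k.
  rewrite (le_trans (x'S s k.+1))// exprS mulrA divff ?mul1r//.
pose y s : L s := projT1 (cid (yex s)).
have yP s k : hnsq (y s - x' s k.+1) <= 4 * (4^-1) ^+ k := projT2 (cid (yex s)) k.
have y0 s : hnsq (y s - x' s 0%N) <= 16.
  rewrite -(subrKA (x' s 1%N)) (le_trans (nsqD_le (@inner_ge0 _ _) _ _))//.
  have := yP s 0%N; have := x'S s 0%N; rewrite !expr0 !mulr1 => h1 h2.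
  apply: le_trans (_ : 2 * (4 + 4) <= _); first by rewrite ler_pM2l// lerD.
  by rewrite -natrD -natrM.
have yb : exists M : R, forall s, hnsq (y s) <= M.
  have [M xM] := bsec_bounded (x 0%N); exists (2 * (16 + M)) => s.
  rewrite -[y s](subrK (x' s 0%N)) (le_trans (nsqD_le (@inner_ge0 _ _) _ _))//.
  by rewrite ler_pM2l//; apply: lerD; [exact: y0|exact: xM].
(* The constant 16 arises as 2 (4 + 4) for [k = 0], and from 4 * 4^-k = 16 * 4^-(k+1) at the later
   indices. *)
exists (BSec yb) => k; apply: nsq_uip_le; apply: filterS (x'E k) => s /=.
rewrite scaleN1r => <-; case: k => [|k]; first by rewrite expr0 mulr1.
rewrite (le_trans (yP s k))// exprS mulrA.
by rewrite (_ : 16 / 4 = 4 :> R)// (_ : 16 = 4 * 4 :> R) ?mulfK// -natrM.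
Qed.

Definition usemi : semiHilbert R := @SemiHilbert R bsec uip uip_ge0 uip_complete.

Definition ultraproduct : hilbertType R := hquot usemi.

Definition uclass (f : bsec) : ultraproduct := (\pi_(hquot usemi) (f : sh_car usemi))%qT.

Definition urepr (u : ultraproduct) : bsec := repr (u : hquot usemi).

Lemma ureprK u : uclass (urepr u) = u.
Proof. exact: hquot_repr. Qed.

Lemma inner_uclass (f g : bsec) c :
  is_ulim U (fun s => inner (f s) (g s)) c -> inner (uclass f) (uclass g) = c.
Proof. by move=> /uipE <-; exact: (@hq_ipE R usemi). Qed.

Lemma inner_uclass_lim (f g : bsec) :
  is_ulim U (fun s => inner (f s) (g s)) (inner (uclass f) (uclass g)).
Proof. by rewrite (inner_uclass (uipP f g)); exact: uipP. Qed.

Lemma uclass_lin c (f g : bsec) :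
  uclass (c *: f + g) = c *: uclass f + uclass g.
Proof. exact: (@pi_lin R usemi). Qed.

End BoundedSections.

Section UltraproductOperators.
Variables (R : realType) (J : Type) (L : J -> hilbertType R).
Variables (U : set_system J) (UU : UltraFilter U).
Local Notation K := (ultraproduct L UU).
Local Notation cls := (uclass UU).

Lemma uclassP (f g : bsec L) : (forall s, f s = g s) -> cls f = cls g.
Proof. by move=> fg; congr (cls _); exact: bsecP. Qed.

Lemma hnsq_uclass_le (f g : bsec L) (c : R) :
  (forall s, hnsq (f s) <= c * hnsq (g s)) -> hnsq (cls f) <= c * hnsq (cls g).
Proof.
move=> fg; rewrite -subr_ge0.
rewrite (_ : _ - _ = Re (c%:C * inner (cls g) (cls g) + (-1) * inner (cls f) (cls f))).
  apply: is_ulim_ge (is_ulimD UU (is_ulimZ UU _ (inner_uclass_lim UU g g))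
    (is_ulimZ UU _ (inner_uclass_lim UU f f))).
  apply: filterS filterT => s _ /=.
  by rewrite ReD Re_realM mulN1r ReN subr_ge0; exact: fg.
by rewrite ReD Re_realM mulN1r ReN. 
Qed.

(** The operator acts on representatives; the uniform bound sends null sections to null sections, so
    the class of the image is well defined. *)
Lemma exists_uop (A : forall s, bop (L s) (L s)) (c : R) :
  (forall s x, hnsq (A s x) <= c * hnsq x) ->
  exists B : bop K K,
    (forall f : bsec L, exists2 g : bsec L,
      B (cls f) = cls g & forall s, g s = A s (f s)) /\
    (forall u, hnsq (B u) <= c * hnsq u).
Proof.
move=> Ac.
have gb (f : bsec L) : exists M : R, forall s, hnsq (A s (f s)) <= M.
  have [M fM] := bsec_bounded f; exists (`|c| * M) => s.
  rewrite (le_trans (Ac _ _))// (le_trans (_ : _ <= `|c| * hnsq (f s)))//.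
    by rewrite ler_wpM2r ?hnsq_ge0// ler_norm.
  by rewrite ler_wpM2l ?fM.
pose G f := BSec (gb f).
have Glin a f g : cls (G (a *: f + g)) = a *: cls (G f) + cls (G g).
  by rewrite -uclass_lin; apply: uclassP => s /=; rewrite linearP.
have Gle f : hnsq (cls (G f)) <= c * hnsq (cls f) by apply: hnsq_uclass_le => s; exact: Ac.
pose B0 (u : K) : K := cls (G (urepr u)).
have GE f g : cls f = cls g -> cls (G f) = cls (G g).
  move=> fg; apply/eqP; rewrite -subr_eq0; apply/eqP/hnsq_eq0/eqP.
  rewrite eq_le hnsq_ge0 andbT.
  rewrite -scaleN1r addrC -Glin (le_trans (Gle _))// uclass_lin fg scaleN1r addNr.
  by rewrite hnsq0 mulr0.
have B0E f : B0 (cls f) = cls (G f) by apply: GE; rewrite ureprK.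
have [||B BE] := @exists_bop R K K B0 c.
- by move=> a u v; rewrite -(ureprK u) -(ureprK v) -uclass_lin !B0E Glin.
- by move=> u; rewrite -[in leRHS](ureprK u); exact: Gle.
exists B; split=> [f|u]; last by rewrite BE -[in leRHS](ureprK u); exact: Gle.
by exists (G f) => //; rewrite BE B0E.
Qed.

Lemma ultraproduct_normal_tuple (I : Type) (N S : I -> forall s, bop (L s) (L s))
    (c : I -> R) :
  (forall i s x, hnsq (N i s x) <= c i * hnsq x) ->
  (forall i s x, hnsq (S i s x) <= c i * hnsq x) ->
  (forall i s, is_adjoint (N i s) (S i s)) ->
  (forall i s, bop_comp (N i s) (S i s) = bop_comp (S i s) (N i s)) ->
  (forall i j s, bop_comp (N i s) (N j s) = bop_comp (N j s) (N i s)) ->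
  exists M : I -> bop K K, [/\ normal_tuple M,
    forall i (f : bsec L), exists2 g : bsec L,
      M i (cls f) = cls g & forall s, g s = N i s (f s) &
    forall i u, hnsq (M i u) <= c i * hnsq u].
Proof.
move=> Nc Sc NS NSC NN.
have [M MP] := choice (fun i => exists_uop (Nc i)).
have [M' M'P] := choice (fun i => exists_uop (Sc i)).
have bopC (A B : forall s, bop (L s) (L s)) (P Q : bop K K) :
    (forall f, exists2 g : bsec L, P (cls f) = cls g & forall s, g s = A s (f s)) ->
    (forall f, exists2 g : bsec L, Q (cls f) = cls g & forall s, g s = B s (f s)) ->
    (forall s, bop_comp (A s) (B s) = bop_comp (B s) (A s)) ->
    bop_comp P Q = bop_comp Q P.
  move=> PA QB AB; apply: bopP => u; rewrite -(ureprK u) /=.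
  have [g -> gE] := QB (urepr u); have [h -> hE] := PA (urepr u).
  have [g' -> g'E] := PA g; have [h' -> h'E] := QB h.
  apply: uclassP => s; rewrite g'E h'E gE hE.
  exact: (congr1 (fun C : bop _ _ => C (urepr u s)) (AB s)).
exists M; split.
- split=> [i|i j]; last exact: bopC (MP i).1 (MP j).1 (NN i j).
  exists (M' i); last exact: bopC (MP i).1 (M'P i).1 (NSC i).
  move=> u v; rewrite -(ureprK u) -(ureprK v).
  have [g -> gE] := (MP i).1 (urepr u); have [h -> hE] := (M'P i).1 (urepr v).
  apply: inner_uclass; have := inner_uclass_lim UU (urepr u) h.
  by apply: is_ulim_near; apply: filterS filterT => s _ /=; rewrite gE hE NS.
- by move=> i; exact: (MP i).1.
- by move=> i; exact: (MP i).2.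
Qed.

End UltraproductOperators.

(** * Dilations in infinite dimension *)

(** Lists stand for finite subsets. The sets of lists containing a given list generate a proper
    filter, because two lists are both contained in their concatenation. *)
Lemma ultrafilter_finite_subsets (E : eqType) : exists U : set_system (seq E),
  UltraFilter U /\ forall x : E, U [set s : seq E | x \in s].
Proof.
pose F : set_system (seq E) :=
  filter_from setT (fun l : seq E => [set s : seq E | {subset l <= s}]).
have FF : ProperFilter F.
  apply: filter_from_proper; last by move=> l _; exists l => x.
  apply: filter_from_filter; first by exists [::].
  move=> l m _ _; exists (l ++ m) => // s /= lms; split=> x xl; apply: lms.
    by rewrite mem_cat xl.
  by rewrite mem_cat xl orbT.
have [U [UU FU]] := ultraFilterLemma FF; exists U; split=> // x; apply: FU.
by exists [:: x] => // s /= xs; apply: xs; rewrite mem_head.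
Qed.

Section InfiniteDilations.
Variables (R : realType) (d : nat) (H : hilbertType R).
Variables (T : 'I_d -> bop H H) (a : 'I_d -> R).
Hypotheses (a_SD : SDtuple a) (T_contr : forall i, opnorm (T i) <= 1).

(** Given [x] and [y], almost all finite subsets contain both, so the inner products that express
    isometry and dilation are limits of families constant almost everywhere. *)
Lemma normal_dilation : exists (K : hilbertType R) (N : 'I_d -> bop K K),
  [/\ normal_tuple N, dilates N T & forall i, opnorm (N i) <= a i].
Proof.
have [U [UU Ux]] := ultrafilter_finite_subsets H.
have a0 i : 0 < a i by case: a_SD.
pose L (p : seq H -> nat) s := euclid R (p s) : hilbertType R.
have [p pP] := choice (partial_dilation a_SD T_contr).
(* The types of [V s] and [z s] depend on [p s], hence pointwise choice by [cid]. *)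
pose V s := projT1 (cid (pP s)).
have VP s := projT2 (cid (pP s)).
pose z s := projT1 (cid (VP s)).
have zP s := projT2 (cid (VP s)).
have [D DP] := choice zP.
pose N i s : bop (L p s) (L p s) := dop ((z s)^~ i).
pose S i s : bop (L p s) (L p s) := dop (fun j => cj (z s j i)).
have za s j i : normc (z s j i) <= a i by have [h _ _ _ _] := DP s; exact: h.
have dopc s f (c : R) : 0 < c -> (forall j, normc (f j) <= c) ->
    forall x : L p s, hnsq (dop f x) <= c ^+ 2 * hnsq x.
  move=> c0 fc x; rewrite -le_hnorm ?(ltW c0)// (le_trans (le_opnorm _ _))//.
  by rewrite ler_wpM2r ?hnorm_ge0// opnorm_dop// ltW.
have [] := @ultraproduct_normal_tuple R _ (L p) U UU _ N S (fun i => a i ^+ 2).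
- by move=> i s x; apply: dopc.
- by move=> i s x; apply: dopc => // j; rewrite normc_conj.
- by move=> i s; exact: dop_adjoint.
- by move=> i s; rewrite !dop_comp; congr dop; apply/funext => j; rewrite mulrC.
- by move=> i j s; rewrite !dop_comp; congr dop; apply/funext => k; rewrite mulrC.
move=> M [Mnormal MN Ma].
have Vb x : exists c : R, forall s, hnsq (V s x : L p s) <= c.
  by exists (hnsq x) => s; have [_ h _ _ _] := DP s; exact: h.
pose v x : bsec (L p) := BSec (Vb x).
have [|x|W WE] := @exists_bop R H (ultraproduct (L p) UU) (fun x => uclass UU (v x)) 1.
- move=> c x y; rewrite -uclass_lin; apply: uclassP => s /=.
  by rewrite linearP.
- rewrite mul1r; apply: (is_ulim_le UU _ (inner_uclass_lim UU (v x) (v x))).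
  by apply: filterS filterT => s _ /=; have [_ h _ _ _] := DP s; exact: h.
have xyD x y : U [set s | D s x /\ D s y].
  apply: filterS2 (Ux x) (Ux y) => s xs ys.
  by have [_ _ [Ds _ _] _ _] := DP s; split; exact: Ds.
exists (ultraproduct (L p) UU), M; split=> //.
  apply: (@dilatesP _ _ _ _ _ _ W) => [|i x y].
    apply: op_isometryP => x y; rewrite !WE; apply: inner_uclass.
    apply: is_ulim_near (is_ulim_cst _ _); apply: filterS (xyD x y) => s [Dx Dy] /=.
    by have [_ _ _ VV _] := DP s; rewrite VV.
  rewrite !WE; have [g -> gE] := MN i (v x); apply: inner_uclass.
  apply: is_ulim_near (is_ulim_cst _ _); apply: filterS (xyD x y) => s [Dx Dy] /=.
  by have [_ _ _ _ VT] := DP s; rewrite gE VT.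
move=> i; apply: opnorm_le => [|u]; first exact: ltW.
by rewrite le_hnorm ?Ma// ltW.
Qed.

End InfiniteDilations.

(** * The constant U(d) gives an SD-tuple *)

Section PositiveMatrices.
Variables (R : realType) (n : nat) (Y : 'M[R[i]]_n).
Hypothesis Y_ge0 : forall v : euclid R n, 0 <= inner (mxop Y v) v.

Definition psd_form (u v : euclid R n) : R[i] := inner (mxop Y u) v.

Lemma psd_form_linearl v : GRing.linear_for *%R (psd_form^~ v).
Proof. by move=> c x y; rewrite /psd_form linearP innerDl innerZl. Qed.

Lemma psd_form_linearr u : GRing.linear_for (Num.conj \; *%R) (psd_form u).
Proof. by move=> c x y; rewrite /psd_form innerDr innerZr. Qed.

HB.instance Definition _ := bilinear_isBilinear.Build R[i] (euclid R n)
  (euclid R n) R[i] *%R (Num.conj \; *%R) psd_form (psd_form_linearl, psd_form_linearr).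

(** Over the complex numbers positivity forces symmetry: the form is real at u + v and at i u +
    v. *)
Lemma psd_form_hermitian u v : psd_form u v = (-1) ^+ false * cj (psd_form v u).
Proof.
rewrite expr0 mul1r.
have D x y : psd_form (x + y) (x + y) =
    psd_form x x + psd_form x y + (psd_form y x + psd_form y y).
  by rewrite /psd_form (linearD (mxop Y)) !innerDl !innerDr.
have Im0 x : Im (psd_form x x) = 0 by have := Y_ge0 x; rewrite lecE => /andP[/eqP].
have := Im0 (u + v); have := Im0 ('i%C *: u + v).
rewrite !D !ImD !Im0.
have -> : psd_form ('i%C *: u) v = 'i%C * psd_form u v.
  by rewrite /psd_form (linearZ_LR (mxop Y)) innerZl.
have -> : psd_form v ('i%C *: u) = cj 'i%C * psd_form v u by rewrite /psd_form innerZr.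
rewrite !ImM Re_conj Im_conj /= => h1 h2.
by apply: complexP; rewrite ?Re_conj ?Im_conj; lra.
Qed.

HB.instance Definition _ := isHermitianSesquilinear.Build _ _ _ _ psd_form
  psd_form_hermitian.

(** Up to transposition [Y] is the Gram matrix of the standard basis for the semi-inner product that
    it defines, so [gram_form_pos] applies. *)
Lemma psd_pairing (B : 'I_n -> 'I_n -> R[i]) : form_pos B ->
  0 <= Re (\tr ((\matrix_(a, b) B a b) *m Y)).
Proof.
move=> Bpos; have := gram_form_pos (ip := psd_form) (@evec R n) Y_ge0 Bpos.
congr (0 <= Re _); apply: eq_bigr => a _; rewrite mxE; apply: eq_bigr => b _.
by rewrite mxE -mxop_evec.
Qed.

End PositiveMatrices.

Section VectorStates.
Variables (R : realType) (H : hilbertType R).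

(** Among the maps over which [Wmax] quantifies, these suffice to recover operator inequalities. *)
Lemma vector_state (v : H) : 0 < hnsq v ->
  ucp (fun S : bop H H => ((hnsq v)^-1%:C * inner (S v) v)%:M : 'M[R[i]]_1).
Proof.
move=> v0; split=> [c S T||k A Apos x].
- rewrite -[(c *: S + T) v]/(c *: S v + T v) innerDl innerZl mulrDr mulrCA.
  by rewrite raddfD scale_scalar_mx.
- by rewrite inner_hnsq -realCM mulVf ?gt_eqF.
have := Apos (fun i => x i 0 0 *: v) => Av.
have : 0 <= (hnsq v)^-1%:C * \sum_i \sum_j inner (A i j (x j 0 0 *: v)) (x i 0 0 *: v).
  by rewrite mulr_ge0// ler0c invr_ge0 ltW.
congr (0 <= _); rewrite mulr_sumr; apply: eq_bigr => i _.
rewrite mulr_sumr; apply: eq_bigr => j _; rewrite mxE (linearZ_LR (A i j)) innerZl innerZr.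
rewrite [RHS]/(cdot _ _) /cdot big_ord1 /= mul_scalar_mx mxE.
ring.
Qed.

End VectorStates.

Section DiamondProducts.
Variables (R : realType) (d : nat).
Implicit Type a : 'I_d -> R.

Definition diamonds a n : set ('I_d * 'I_n -> R[i]) :=
  real_prod (fun j => [set a j *: x | x in @diamond R n]).

Arguments diamonds : clear implicits.

Lemma diamondsE a n z : (forall j, 0 < a j) ->
  diamonds a n z <->
  (forall jk, Im (z jk) = 0) /\ forall j, \sum_k `|Re (z (j, k))| <= a j.
Proof.
move=> a0; split=> [[x xa zx]|[z0 za]].
  split=> [[j k]|j]; first by rewrite zx.
  have [y /= y1 yx] := xa j; rewrite -[leRHS]mulr1.
  apply: le_trans (ler_wpM2l (ltW (a0 j)) y1); rewrite mulr_sumr; apply: ler_sum => k _.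
  by rewrite zx -yx mxE /= normrM ger0_norm// ltW.
exists (fun j => \row_k Re (z (j, k))) => [j|j k]; last first.
  by rewrite mxE; apply: complexP; rewrite //= z0.
exists ((a j)^-1 *: \row_k Re (z (j, k))) => /=.
  rewrite /diamond /=; under eq_bigr do rewrite !mxE normrM ger0_norm ?invr_ge0 ?(ltW (a0 j))//.
  by rewrite -mulr_sumr mulrC ler_pdivrMr// mul1r.
by rewrite scalerA divff ?scale1r// gt_eqF.
Qed.

Lemma diamonds_closed a n (U : set_system nat) : UltraFilter U ->
  (forall j, 0 < a j) -> ulim_closed_fun U (diamonds a n).
Proof.
move=> UU a0 s l sK sl; apply/(@diamondsE a _ _ a0); split=> [jk|j].
  by apply: (is_ulim_real UU _ (sl jk)) => m; have /(@diamondsE a _ _ a0)[] := sK m.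
(* The signs of the limit turn its l^1 norm into a linear expression, which passes to the limit. *)
pose e k : R := if 0 <= Re (l (j, k)) then 1 else -1.
have -> : \sum_k `|Re (l (j, k))| = Re (\sum_k (e k)%:C * l (j, k)).
  rewrite Re_sum; apply: eq_bigr => k _; rewrite Re_realM /e.
  by case: leP => [/ger0_norm|/ltr0_norm] ->; rewrite ?mul1r ?mulN1r.
have := @is_ulim_sum _ _ _ UU _ (index_enum _) xpredT _ _
  (fun k _ => is_ulimZ UU (e k)%:C (sl (j, k))).
apply: (is_ulim_le UU).
apply: filterS filterT => m _ /=; have /(@diamondsE a _ _ a0)[_ /(_ j)] := sK m.
apply: le_trans; rewrite Re_sum; apply: ler_sum => k _; rewrite Re_realM /e.
by case: ifP => _; rewrite ?mul1r ?mulN1r ?ler_norm// -normrN ler_norm.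
Qed.

Lemma diamonds_bounded a n : (forall j, 0 < a j) ->
  exists M : R, forall z jk, diamonds a n z -> normc (z jk) <= M.
Proof.
move=> a0; exists (\sum_j a j) => z [j k] [x xa ->]; rewrite normc_real.
have [y /= y1 <-] := xa j; rewrite mxE normrM (ger0_norm (ltW (a0 j))).
rewrite (@le_trans _ _ (a j))//; last first.
  by rewrite (bigD1 j)//= lerDl sumr_ge0// => i _; exact: ltW.
rewrite ger_pMr// (le_trans _ y1)// (bigD1 k)//= lerDl.
by rewrite sumr_ge0.
Qed.

Lemma dual_Wmin_diamonds a n (X : mxtuple R ('I_d * 'I_n)) : (forall j, 0 < a j) ->
  dual_ineq (diamonds a n) (fun i s t => tagged X i t s) -> Wmin (diamonds a n) X.
Proof.
move=> a0 Xdual; have [U [UU Uoo]] := ultrafilter_oo; apply: diag_rep_Wmin.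
apply: (dual_diag_rep UU Uoo) => //; first exact: diamonds_closed.
exact: diamonds_bounded.
Qed.

(** Vector states convert the inequalities defining the simplex, tested on quadratic forms, into
    positivity of matrices. *)
Lemma Wmax_simplex n (X : mxtuple R ('I_d * 'I_n)) :
  Wmax (real_prod (fun _ => @simplex R n)) X ->
  (forall jk v, 0 <= inner (mxop (tagged X jk) v) v) /\
  (forall j v, 0 <= inner (mxop (1%:M - \sum_k tagged X (j, k)) v) v).
Proof.
move=> XW.
have st v : v != 0 -> exists2 x : 'I_d -> 'rV[R]_n, forall j, simplex (x j) &
    forall j k, inner (mxop (tagged X (j, k)) v) v = (hnsq v * x j 0 k)%:C.
  move=> v0; have {}v0 : 0 < hnsq v.
    by rewrite lt_def hnsq_ge0 andbT; apply: contra v0 => /eqP/hnsq_eq0 ->.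
  have [|x xs xE] := XW (fun jk => ((hnsq v)^-1%:C * inner (mxop (tagged X jk) v) v)%:M).
    by exists (fun S => ((hnsq v)^-1%:C * inner (S v) v)%:M) => //; exact: vector_state.
  exists x => // j k; rewrite realCM -xE mxE eqxx mulr1n mulrA -realCM divff ?mul1r//.
  by rewrite gt_eqF.
split=> [[j k] v|j v].
  have [->|/st[x xs ->]] := eqVneq v 0; first by rewrite inner0r.
  by rewrite ler0c mulr_ge0 ?hnsq_ge0//; have [] := simplex_bounds (xs j).
have [->|/st[x xs xE]] := eqVneq v 0; first by rewrite inner0r.
have -> : inner (mxop (1%:M - \sum_k tagged X (j, k)) v) v =
    (hnsq v * (1 - \sum_k x j 0 k))%:C.
  have -> : (mxop (1%:M - \sum_k tagged X (j, k)) v : euclid R _) =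
      v - \sum_k mxop (tagged X (j, k)) v.
    by rewrite /= mulmxBl mul1mx mulmx_suml.
  rewrite innerBl inner_suml inner_hnsq mulrBr mulr1 rmorphB; congr (_ - _).
  by rewrite mulr_sumr rmorph_sum; apply: eq_bigr => k _; exact: xE.
by rewrite ler0c mulr_ge0 ?hnsq_ge0// subr_ge0; have [] := simplex_bounds (xs j).
Qed.

End DiamondProducts.

Section OptimalConstant.
Variables (R : realType) (d : nat).
Local Notation diam C n := (@diamonds R d (fun=> C) n).

Lemma trace_form (n : nat) (A : 'I_n -> 'I_n -> R[i]) (Y : 'M[R[i]]_n) :
  \tr ((\matrix_(a, b) A a b) *m Y) = \sum_a \sum_b A a b * Y b a.
Proof.
by apply: eq_bigr => a _; rewrite mxE; apply: eq_bigr => b _; rewrite mxE.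
Qed.

(* On the products of diamonds it suffices to test positivity at 0 and at the
   points C e_(j,k); since the simplices give sum_k X_(j,k) <= 1, averaging the
   resulting inequalities over j loses a factor d. *)
Lemma SD_const_large (C : R) : 0 < C -> d%:R <= C -> SDtuple (fun _ : 'I_d => C).
Proof.
move=> C0 dC; split=> // n n0 X /Wmax_simplex[X0 X1].
apply: dual_Wmin_diamonds => // A0 A Apos.
have A0pos : form_pos A0.
  have := Apos (fun=> 0); rewrite (_ : (fun a b => _) = A0).
    apply; apply/diamondsE => //; split=> // j; rewrite big1 ?ltW// => k _.
    by rewrite normr0.
  by apply/funext => a; apply/funext => b; rewrite big1 ?addr0// => i _; rewrite mul0r.
have Apos1 jk : form_pos (fun a b => A0 a b + C%:C * A jk a b).
  have := Apos (fun i => (i == jk)%:R * C%:C).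
  rewrite (_ : (fun a b => _) = (fun a b => A0 a b + C%:C * A jk a b)).
    apply; apply/diamondsE => //; split=> [i|j].
      by case: eqP => _; rewrite ?mul1r ?mul0r.
    case: jk => j' k'; rewrite (bigD1 k')//= big1 => [|k kk'].
      by rewrite addr0; case: eqP => _; rewrite ?mul1r ?mul0r /= ?normr0 ?gtr0_norm// ltW.
    by rewrite xpair_eqE (negbTE kk') andbF mul0r normr0.
  apply/funext => a; apply/funext => b; rewrite (bigD1 jk)//= eqxx mul1r big1 ?addr0//.
  by move=> i /negbTE ->; rewrite !mul0r.
pose B0 := \matrix_(a, b) A0 a b; pose B jk := \matrix_(a, b) A jk a b.
pose x jk := Re (\tr (B jk *m tagged X jk)).
have tr0 : Re (\tr B0) = Re (\sum_a A0 a a).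
  by congr Re; apply: eq_bigr => a _; rewrite mxE.
(* The positive matrix 1 - sum_k X_(j,k) is paired with the pencil at 0, and each X_(j,k) with the
   pencil at C e_(j,k). *)
have step j : 0 <= Re (\tr B0) + C * \sum_k x (j, k).
  have := psd_pairing (X1 j) A0pos; rewrite -/B0 mulmxBr mulmx1 raddfB /= ReB subr_ge0.
  rewrite mulmx_sumr (raddf_sum (@mxtrace _ _)) Re_sum => p'p.
  rewrite (le_trans _ (lerD p'p (lexx _)))// mulr_sumr -big_split sumr_ge0// => k _ /=.
  have := psd_pairing (X0 (j, k)) (Apos1 (j, k)).
  rewrite (_ : (\matrix_(_, _) _) = B0 + C%:C *: B (j, k)); last first.
    by apply/matrixP => a b; rewrite !mxE.
  by rewrite mulmxDl raddfD /= -scalemxAl mxtraceZ ReD Re_realM.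
have p0 : 0 <= Re (\tr B0).
  have := @psd_pairing R _ 1%:M _ A0 A0pos; rewrite mulmx1; apply=> v.
  by rewrite mxop1; exact: inner_ge0.
have sumE : Re (\sum_i \sum_a \sum_b A i a b * tagged X i b a) = \sum_j \sum_k x (j, k).
  rewrite [RHS]pair_bigA Re_sum; apply: eq_bigr => -[j k] _ /=.
  by rewrite /x /B trace_form.
rewrite ReD -tr0 sumE -(pmulr_rge0 _ C0) mulrDr.
(* Summing [step] over [j] yields d times the nonnegative number Re (tr B0), which [d%:R <= C]
   allows to be replaced by C times it. *)
have : 0 <= \sum_(j < d) (Re (\tr B0) + C * \sum_k x (j, k)) by apply: sumr_ge0.
rewrite big_split sumr_const card_ord -mulr_sumr -mulr_natl => /le_trans; apply.
by rewrite lerD// ler_wpM2r.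
Qed.

(** For [n = 1] the scalars 1 lie in the maximal set over the simplices, while the pencil C -
    z_(j0,0), positive on the diamonds, takes the value C - 1 there. *)
Lemma SD_const_ge1 (C : R) : (0 < d)%N -> SDtuple (fun _ : 'I_d => C) -> 1 <= C.
Proof.
move=> d0 [/(_ (Ordinal d0)) C0 SD]; pose j0 := Ordinal d0.
pose X : mxtuple R ('I_d * 'I_1) := existT _ 0%N (fun=> 1%:M).
have XW : Wmax (real_prod (fun _ : 'I_d => @simplex R 1)) X.
  move=> Y [psi [_ psi1 _] YE]; exists (fun=> 1) => [j|j k].
    by apply: mem_simplex => [k|]; rewrite ?big_ord1 ?ord1 ?mxE.
  rewrite YE /mxtuple_op /= (_ : mxop 1%:M = bop1 _) ?psi1 ?mxE ?ord1//.
  exact: mxop1.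
have := Wmin_dual (SD 1%N isT _ XW).
move=> /(_ (fun _ _ => C%:C) (fun jk _ _ => - (jk == (j0, 0))%:R)).
have h : forall z, diam C 1 z ->
    form_pos (fun _ _ : 'I_1 => C%:C + \sum_i z i * - (i == (j0, 0))%:R).
  move=> z /diamondsE[]// zr /(_ j0); rewrite big_ord1 => zC u.
  rewrite !big_ord1 (bigD1 (j0, 0))//= big1 ?addr0 => [|i /negbTE ->]; last first.
    by rewrite oppr0 mulr0.
  rewrite mulr_conj mulrC Re_realM mulrN1 mulr_ge0 ?sqr_ge0// ReB subr_ge0.
  exact: le_trans (ler_norm _) zC.
move=> /(_ h); rewrite (bigD1 (j0, 0))//= !big_ord1 big1 => [|i /negbTE ij].
  by rewrite mxE addr0 eqxx mulr1 ReB subr_ge0.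
by rewrite !big_ord1 ij oppr0 mul0r.
Qed.

(** The infimum is attained because the dual inequality for C, applied to coefficients A scaled by U
    / C, reads C p + U q >= 0, and this tends to U (p + q) >= 0 as C approaches U. *)
Lemma U_const_SD : SDtuple (fun _ : 'I_d => U_const R d).
Proof.
(* For [d = 0] all functions on ['I_d] coincide, whatever the value of the infimum. *)
have [d0|d0] := posnP d.
  suff <- : (fun _ : 'I_d => 1) = (fun=> U_const R d).
    by apply: SD_const_large; rewrite // d0.
  by apply/funext => j; have := ltn_ord j; rewrite [X in (_ < X)%N]d0.
pose S := [set C : R | 0 < C /\ SDtuple (fun _ : 'I_d => C)].
have S1 : lbound S 1 by move=> C [_]; exact: SD_const_ge1.
have Sd : S d%:R.
  have dR : 0 < d%:R :> R by rewrite ltr0n.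
  by split=> //; exact: SD_const_large.
have Sinf : has_inf S by split; [exists d%:R|exists 1].
set U := U_const R d.
have U0 : 0 < U by apply: lt_le_trans ltr01 (lb_le_inf _ S1); exists d%:R.
split=> // n n0 X XW; apply: dual_Wmin_diamonds => // A0 A Apos.
rewrite ReD; set p := Re _; set q := Re _; rewrite leNgt; apply/negP => pq.
(* For C within this distance of U one has (C - U) |p| < - U (p + q), which contradicts C p + U q >=
   0; the added 1 guards against [p = 0]. *)
have e0 : 0 < U * - (p + q) / (`|p| + 1).
  apply: divr_gt0; last by rewrite ltr_wpDl.
  by apply: mulr_gt0 => //; rewrite oppr_gt0.
have [C [C0 [_ SDC]] CU] := inf_adherent e0 Sinf.
have UC : U <= C by apply: ge_inf; [exists 1|split=> //; split].
have := Wmin_dual (SDC n n0 X XW).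
move=> /(_ A0 (fun jk a b => (U / C)%:C * A jk a b)).
have h : forall z, diam C n z -> form_pos (fun a b =>
    A0 a b + \sum_i z i * ((U / C)%:C * A i a b)).
  move=> z /diamondsE[]// zr zC.
  have /Apos : diam U n (fun i => (U / C)%:C * z i).
    apply/diamondsE => //; split=> [jk|j].
      by rewrite Im_realM zr mulr0.
    under eq_bigr do rewrite Re_realM normrM ger0_norm ?divr_ge0 ?(ltW U0) ?(ltW C0)//.
    by rewrite -mulr_sumr -mulrA ger_pMr// mulrC ler_pdivrMr// mul1r.
  congr form_pos; apply/funext => a; apply/funext => b; congr (_ + _).
  by apply: eq_bigr => i _; rewrite mulrCA mulrA.
move=> /(_ h); rewrite ReD.
have -> : \sum_i \sum_a \sum_b (U / C)%:C * A i a b * tagged X i b a =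
    (U / C)%:C * \sum_i \sum_a \sum_b A i a b * tagged X i b a.
  do 3!(rewrite mulr_sumr; apply: eq_bigr => ? _); by rewrite mulrA.
rewrite Re_realM -/p -/q => pqC.
have {}pqC : 0 <= C * p + U * q.
  by have := mulr_ge0 (ltW C0) pqC; rewrite mulrDr mulrA [C * (U / C)]mulrCA divff ?mulr1// gt_eqF.
have : (C - U) * (`|p| + 1) < U * - (p + q).
  by rewrite -ltr_pdivlMr ?ltr_wpDl// ltrBlDl.
have : (C - U) * p <= (C - U) * `|p| by rewrite ler_wpM2l ?subr_ge0// ler_norm.
move: pqC UC; nra.
Qed.

End OptimalConstant.

Theorem corollary2p18 (R : realType) (d : nat) (H : hilbertType R)
    (T : 'I_d -> bop H H) (T_contr : forall i, opnorm (T i) <= 1) :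
  (forall a : 'I_d -> R, SDtuple a ->
     matrix_range T `<=` Wmin (polydisk a) /\
     exists (K : hilbertType R) (N : 'I_d -> bop K K),
       [/\ normal_tuple N, dilates N T, forall i, opnorm (N i) <= a i &
           finite_dim H -> finite_dim K]) /\
  SDtuple (fun _ : 'I_d => U_const R d).
Proof.
split=> [a a_SD|]; last exact: U_const_SD.
split; first exact: matrix_range_Wmin.
(* The finite-dimensional case is separate because the ultraproduct comes with no bound on its
   dimension. *)
have [Hfin|Hinf] := pselect (finite_dim H).
  have [K [N [Nn NT Na Kfin]]] := finite_dim_dilation a_SD T_contr Hfin.
  by exists K, N.
have [K [N [Nn NT Na]]] := normal_dilation a_SD T_contr.
by exists K, N; split.
Qed.
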